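(* Let $\mathbf{x}=(x_1,\ldots,x_n)$ and let $P(\mathbf{x},y)\in\mathbb{C}[[\mathbf{x}]][y]$ be a monic polynomial in $y$. There exist an integral homogeneous element $\gamma$ and a homogeneous polynomial $h(\mathbf{x})$ such that $P(\mathbf{x},y)$ factors as a product of degree $1$ monic polynomials in $y$ with coefficients in $\mathbb{P}_h[[\mathbf{x},\gamma]]$.
   Context: Let $\nu$ be the $(\mathbf{x})$-adic valuation on $\mathbb{C}[[\mathbf{x}]]$, extended to its fraction field $\mathbb{C}((\mathbf{x}))$; $V_\nu=\{F\in\mathbb{C}((\mathbf{x}))\mid\nu(F)\ge0\}$ is its valuation ring and $\widehat V_\nu$ the completion. Elements of $\widehat V_\nu$ are formal sums $\sum_{k\in\mathbb{N}}a_k/b_k$ with $a_k,b_k\in\mathbb{C}[\mathbf{x}]$ homogeneous, $b_k\ne0$, and $\deg a_k-\deg b_k=k$ when $a_k\neq 0$. Fix an algebraic closure of $\operatorname{Frac}(\widehat V_\nu)$; it contains an algebraic closure of $\mathbb{C}(\mathbf{x})$. For $\omega\in\mathbb{Q}_{\ge0}$, a polynomial $\Gamma(\mathbf{x},z)\in\mathbb{C}[\mathbf{x},z]$ is $\omega$-weighted homogeneous if $\Gamma(\mathbf{x},z^\omega)$ is homogeneous. An integral homogeneous element of degree $\omega$ is an element $\gamma$ of the algebraic closure of $\mathbb{C}(\mathbf{x})$ with $\Gamma(\mathbf{x},\gamma)=0$ for some $\omega$-weighted homogeneous $\Gamma$ that is monic in $z$. Let $d=[\mathbb{C}(\mathbf{x})(\gamma):\mathbb{C}(\mathbf{x})]$.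 The valuation $\nu$ extends by $\nu(\sum_{k=0}^{d-1}a_k\gamma^k)=\min_k\{\nu(a_k)+k\omega\}$, and $\widehat V_{\nu,\gamma}$ (the completion of the valuation ring of $\nu$ on $\mathbb{C}((\mathbf{x}))[\gamma]$) consists of the elements $\sum_{k=0}^{d-1}a_k\gamma^k$ with $a_k\in\operatorname{Frac}(\widehat V_\nu)$ and $\nu(a_k\gamma^k)\ge0$. For a non-zero homogeneous polynomial $h$, $\mathbb{P}_h((\mathbf{x}))$ is the subring of $\operatorname{Frac}(\widehat V_\nu)$ of elements of the form $A=\sum_{k\ge k_0}\frac{a_k(\mathbf{x})}{h^{\alpha k+\beta}}$ with $k_0\in\mathbb{Z}$, $\alpha,\beta\in\mathbb{N}$, and $a_k$ homogeneous polynomials (possibly zero) with $\deg a_k-(\alpha k+\beta)\deg h=k$ when $a_k\ne 0$. $\mathbb{P}_h[[\mathbf{x},\gamma]]$ is the subring of $\widehat V_{\nu,\gamma}$ of elements $\sum_{k=0}^{d-1}A_k\gamma^k$ with $A_k\in\mathbb{P}_h((\mathbf{x}))$ and $\nu(A_k\gamma^k)\ge0$ for all $k$. *)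

(* Defs.v *)
From HB Require Import structures.
From mathcomp Require Import all_boot all_order all_algebra.
From mathcomp Require Import boolp reals complex.
From mathcomp Require Import mpoly.

Set Implicit Arguments.
Unset Strict Implicit.
Unset Printing Implicit Defensive.

Import Order.TTheory GRing.Theory Num.Theory.
Local Open Scope ring_scope.

Notation "x %:F" := (@FracField.tofrac _ x) : ring_scope.

(* The ring C[[x_1, ..., x_n]]: arbitrary families of coefficients indexed by
   multi-indices, with the Cauchy product. *)
Section PowerSeries.
Variables (n : nat) (C : fieldType).

Record mseries := MSeries { mscoef : 'X_{1..n} -> C }.

HB.instance Definition _ := gen_eqMixin mseries.
HB.instance Definition _ := gen_choiceMixin mseries.

Implicit Types f g : mseries.

Lemma mseriesP f g : mscoef f =1 mscoef g -> f = g.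
Proof. by case: f g => [u] [v] /= /funext ->. Qed.

Definition ms0 := MSeries (fun _ => 0).
Definition ms1 := MSeries (fun m => (m == 0%MM)%:R).
Definition msopp f := MSeries (fun m => - mscoef f m).
Definition msadd f g := MSeries (fun m => mscoef f m + mscoef g m).
Definition msmul f g := MSeries (fun m =>
  \sum_(k : 'X_{1..n < (mdeg m).+1, (mdeg m).+1} | m == (k.1 + k.2)%MM)
    mscoef f k.1 * mscoef g k.2).

Lemma msaddA : associative msadd.
Proof. by move=> f g h; apply: mseriesP => m /=; rewrite addrA. Qed.
Lemma msaddC : commutative msadd.
Proof. by move=> f g; apply: mseriesP => m /=; rewrite addrC. Qed.
Lemma msadd0 : left_id ms0 msadd.
Proof. by move=> f; apply: mseriesP => m /=; rewrite add0r. Qed.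
Lemma msaddN : left_inverse ms0 msopp msadd.
Proof. by move=> f; apply: mseriesP => m /=; rewrite addNr. Qed.

HB.instance Definition _ :=
  GRing.isZmodule.Build mseries msaddA msaddC msadd0 msaddN.

Definition msagree K f (p : {mpoly C[n]}) :=
  forall m, (mdeg m < K)%N -> mscoef f m = p@_m.

Definition mstrunc K f : {mpoly C[n]} :=
  \sum_(m : 'X_{1..n < K}) mscoef f m *: 'X_[m].

Lemma mstruncP K f : msagree K f (mstrunc K f).
Proof. by move=> m lt_mK; rewrite /mstrunc mcoeff_mpoly. Qed.

Lemma msagreeM K f g p q :
  msagree K f p -> msagree K g q -> msagree K (msmul f g) (p * q).
Proof.
move=> fp gq m lt_mK /=; rewrite mcoeffM; apply: eq_bigr => k _.
by rewrite fp ?gq //; [apply: leq_trans (valP k.2) _ |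
  apply: leq_trans (valP k.1) _].
Qed.

Lemma msagree_eq f g : (forall K, exists2 p, msagree K f p & msagree K g p) ->
  f = g.
Proof.
move=> fg; apply: mseriesP => m; have [p fp gp] := fg (mdeg m).+1.
by rewrite fp ?gp.
Qed.

Lemma msagreeD K f g p q :
  msagree K f p -> msagree K g q -> msagree K (msadd f g) (p + q).
Proof. by move=> fp gq m lt_mK /=; rewrite mcoeffD fp ?gq. Qed.

Lemma msagree1 K : msagree K ms1 1.
Proof. by move=> m _; rewrite mcoeff1. Qed.

Lemma msmulA : associative msmul.
Proof.
move=> f g h; apply: msagree_eq => K.
have [F G H] := And3 (@mstruncP K f) (@mstruncP K g) (@mstruncP K h).
exists (mstrunc K f * (mstrunc K g * mstrunc K h)); last rewrite mulrA;
  by do ?apply: msagreeM.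
Qed.

Lemma msmulC : commutative msmul.
Proof.
move=> f g; apply: msagree_eq => K.
have [F G] := conj (@mstruncP K f) (@mstruncP K g).
exists (mstrunc K f * mstrunc K g); last rewrite mulrC; exact: msagreeM.
Qed.

Lemma msmul1 : left_id ms1 msmul.
Proof.
move=> f; apply: msagree_eq => K; exists (mstrunc K f); last exact: mstruncP.
rewrite -[X in msagree _ _ X]mul1r.
by apply: msagreeM; [exact: msagree1 | exact: mstruncP].
Qed.

Lemma msmulDl : left_distributive msmul msadd.
Proof.
move=> f g h; apply: msagree_eq => K.
have [F G H] := And3 (@mstruncP K f) (@mstruncP K g) (@mstruncP K h).
exists ((mstrunc K f + mstrunc K g) * mstrunc K h).
  by apply: msagreeM => //; apply: msagreeD.
by rewrite mulrDl; apply: msagreeD; apply: msagreeM.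
Qed.

Lemma ms1_neq0 : ms1 != ms0.
Proof.
apply/eqP => /(congr1 (fun f => mscoef f 0%MM)) /= /eqP.
by rewrite eqxx oner_eq0.
Qed.

HB.instance Definition _ := GRing.Zmodule_isComNzRing.Build mseries
  msmulA msmulC msmul1 msmulDl ms1_neq0.

Definition mhcomp k f : {mpoly C[n]} :=
  \sum_(m : 'X_{1..n < k.+1} | mdeg m == k) mscoef f m *: 'X_[m].

Lemma mcoeff_mhcomp k f m :
  (mhcomp k f)@_m = if mdeg m == k then mscoef f m else 0.
Proof.
rewrite /mhcomp; case: ifP => [/eqP mk|mNk].
  have lt_mk : (mdeg m < k.+1)%N by rewrite mk.
  rewrite raddf_sum (bigD1 (Sub m lt_mk)) /= ?mk //.
  rewrite big1 => [|i]; first by rewrite addr0 mcoeffZ mcoeffX eqxx mulr1.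
  case: i => i /= lt_ik /andP[_]; rewrite eqE /= => ne_im.
  by rewrite mcoeffZ mcoeffX (negbTE ne_im) mulr0.
rewrite raddf_sum big1 // => i /eqP ik; rewrite /= mcoeffZ mcoeffX.
by case: eqP => [im|_]; [rewrite -im ik eqxx in mNk | rewrite mulr0].
Qed.

Lemma mhcomp_homog k f : mhcomp k f \is k.-homog.
Proof. by apply: rpred_sum => m mk; apply: rpredZ; rewrite dhomogX. Qed.

Lemma mcoeff_pihomog k (p : {mpoly C[n]}) m :
  (pihomog mdeg k p)@_m = if mdeg m == k then p@_m else 0.
Proof.
case: ifP => [/eqP mk|mNk]; last first.
  by rewrite (dhomog_nemf_coeff (pihomogP mdeg k p)) ?mNk.
have lt_k : (k < msize p + k.+1)%N by rewrite addnS ltnS leq_addl.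
have := congr1 (mcoeff m)
  (pihomog_partitionE (mf := mdeg) (leq_addr k.+1 (msize p))).
rewrite [in X in _ = X -> _]raddf_sum => ->.
rewrite [RHS](bigD1 (Ordinal lt_k)) //= [X in _ + X]big1 ?addr0 // => i ik.
apply: (dhomog_nemf_coeff (pihomogP mdeg i p)); rewrite /= mk.
by apply: contraNneq ik => ki; apply/eqP/val_inj.
Qed.

Lemma mhcompE k f p : msagree k.+1 f p -> mhcomp k f = pihomog mdeg k p.
Proof.
move=> fp; apply/mpolyP => m; rewrite mcoeff_mhcomp mcoeff_pihomog.
by case: eqP => // mk; rewrite fp // mk.
Qed.

Lemma pihomogM k (p q : {mpoly C[n]}) : pihomog mdeg k (p * q) =
  \sum_(i < k.+1) pihomog mdeg i p * pihomog mdeg (k - i) q.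
Proof.
set K := (msize p + msize q + k.+1)%N.
have pK : (msize p <= K)%N by rewrite /K -addnA leq_addr.
have qK : (msize q <= K)%N by rewrite /K addnAC leq_addl.
have kK : (k < K)%N by rewrite /K addnS ltnS leq_addl.
rewrite {1}(pihomog_partitionE (mf := mdeg) pK).
rewrite {1}(pihomog_partitionE (mf := mdeg) qK).
rewrite mulr_suml raddf_sum (big_ord_widen K (fun i =>
  pihomog mdeg i p * pihomog mdeg (k - i) q) kK) [RHS]big_mkcond /=.
apply: eq_bigr => i _; rewrite mulr_sumr raddf_sum /=.
have homM j : pihomog mdeg i p * pihomog mdeg j q \is (i + j).-homog.
  by apply: dhomogM; apply: pihomogP.
case: ltnP => [le_ik|lt_ki].
  have lt_kiK : (k - i < K)%N by apply: leq_ltn_trans kK; apply: leq_subr.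
  rewrite (bigD1 (Ordinal lt_kiK)) //= big1 ?addr0 => [|j jk].
    by rewrite pihomog_dE // -{2}[k](subnKC (_ : i <= k)%N).
  apply: (pihomog_ne0 _ (homM j)); apply: contraNneq jk => jk.
  by apply/eqP/val_inj; rewrite /= -jk addKn.
rewrite big1 // => j _; apply: (pihomog_ne0 _ (homM j)).
by rewrite gtn_eqF // ltn_addr.
Qed.

Lemma mhcompD k f g : mhcomp k (f + g) = mhcomp k f + mhcomp k g.
Proof.
apply/mpolyP => m; rewrite mcoeffD !mcoeff_mhcomp.
by case: ifP; rewrite ?addr0.
Qed.

Lemma mhcompM k f g :
  mhcomp k (f * g) = \sum_(i < k.+1) mhcomp i f * mhcomp (k - i) g.
Proof.
have [F G] := conj (@mstruncP k.+1 f) (@mstruncP k.+1 g).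
rewrite (mhcompE (msagreeM F G)) pihomogM; apply: eq_bigr => i _.
by congr (_ * _); apply/esym/mhcompE => m lt_mi;
  [apply: F | apply: G]; apply: leq_trans lt_mi _; rewrite ltnS ?leq_subr // -ltnS.
Qed.

Lemma mhcomp1 k : mhcomp k 1 = (k == 0%N)%:R.
Proof.
apply/mpolyP => m; rewrite mcoeff_mhcomp /=.
case: (eqVneq k 0%N) => [->|k0]; rewrite ?mcoeff1 ?mcoeff0 -?mdeg_eq0.
  by case: eqP => // /eqP.
by case: eqP => // ->; rewrite (negbTE k0).
Qed.

Definition mseries_of_mpoly (p : {mpoly C[n]}) : mseries :=
  MSeries (fun m => p@_m).

Lemma mseries_of_mpoly_is_zmod : zmod_morphism mseries_of_mpoly.
Proof. by move=> p q; apply: mseriesP => m /=; rewrite mcoeffB. Qed.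

Lemma mseries_of_mpoly_is_monoid : monoid_morphism mseries_of_mpoly.
Proof.
split=> [|p q]; apply: mseriesP => m /=; first by rewrite mcoeff1.
by rewrite mcoeffM.
Qed.

HB.instance Definition _ := GRing.isZmodMorphism.Build _ _
  mseries_of_mpoly mseries_of_mpoly_is_zmod.
HB.instance Definition _ := GRing.isMonoidMorphism.Build _ _
  mseries_of_mpoly mseries_of_mpoly_is_monoid.

Lemma mseries_of_mpoly_inj : injective mseries_of_mpoly.
Proof.
move=> p q pq; apply/mpolyP => m.
exact: (congr1 (fun f => mscoef f m) pq).
Qed.

End PowerSeries.

(* The completion of the valuation ring of the (x)-adic valuation: formal sums
   \sum_(k >= 0) F_k, where F_k in C(x) is a quotient of homogeneous
   polynomials with deg(numerator) - deg(denominator) = k, unless F_k = 0. *)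
Section CompletedValuationRing.
Variables (n : nat) (C : fieldType).

Local Notation Cx := {fraction {mpoly C[n]}}.

(* The zero polynomial is j.-homog for every j, so this covers F = 0. *)
Definition homfrac (k : nat) (F : Cx) : Prop :=
  exists j (a b : {mpoly C[n]}),
    [/\ a \is (j + k).-homog, b \is j.-homog, b != 0 & F = a%:F / b%:F].

Lemma homfrac_mpoly k (a : {mpoly C[n]}) : a \is k.-homog -> homfrac k a%:F.
Proof.
move=> ha; exists 0%N, a, 1; rewrite dhomog1 oner_eq0.
by split=> //; rewrite rmorph1 divr1.
Qed.

Lemma homfrac0 k : homfrac k 0.
Proof. by rewrite -[0](rmorph0 (@FracField.tofrac _)); apply/homfrac_mpoly/dhomog0. Qed.

Lemma homfracN k F : homfrac k F -> homfrac k (- F).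
Proof.
case=> j [a] [b] [ha hb b0 ->]; exists j, (- a), b.
by split=> //; rewrite ?rpredN // rmorphN mulNr.
Qed.

Lemma homfracD k F G : homfrac k F -> homfrac k G -> homfrac k (F + G).
Proof.
case=> j [a] [b] [ha hb b0 ->] [j'] [a'] [b'] [ha' hb' b'0 ->].
exists (j + j')%N, (a * b' + a' * b), (b * b'); split.
- apply: rpredD; first by rewrite addnAC; apply: dhomogM.
  by rewrite (addnC j) addnAC; apply: dhomogM.
- exact: dhomogM.
- by rewrite mulf_neq0.
- by rewrite addf_div ?tofrac_eq0 // rmorphD !rmorphM.
Qed.

Lemma homfracM k l F G : homfrac k F -> homfrac l G -> homfrac (k + l) (F * G).
Proof.
case=> j [a] [b] [ha hb b0 ->] [j'] [a'] [b'] [ha' hb' b'0 ->].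
exists (j + j')%N, (a * a'), (b * b'); split.
- by rewrite addnACA; apply: dhomogM.
- exact: dhomogM.
- by rewrite mulf_neq0.
- by rewrite mulf_div !rmorphM.
Qed.

Record vhat := Vhat { vcomp : nat -> Cx; vcompP : forall k, homfrac k (vcomp k) }.

HB.instance Definition _ := gen_eqMixin vhat.
HB.instance Definition _ := gen_choiceMixin vhat.

Implicit Types F G H : vhat.

Lemma vhat_eq F G : vcomp F =1 vcomp G -> F = G.
Proof.
case: F G => [u hu] [v hv] /= /funext uv; rewrite uv in hu *.
by congr Vhat; apply: Prop_irrelevance.
Qed.

Definition v0 := Vhat homfrac0.

Fact v1_subproof k : homfrac k (k == 0%N)%:R.
Proof.
case: k => [|k]; last exact: homfrac0.
by rewrite -(rmorph1 (@FracField.tofrac _)); apply/homfrac_mpoly/dhomog1.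
Qed.
Definition v1 := Vhat v1_subproof.

Definition vopp F := Vhat (fun k => homfracN (vcompP F k)).
Definition vadd F G := Vhat (fun k => homfracD (vcompP F k) (vcompP G k)).

Fact vmul_subproof F G k :
  homfrac k (\sum_(i < k.+1) vcomp F i * vcomp G (k - i)).
Proof.
apply: (big_ind (homfrac k)) => [|? ?|i _]; [exact: homfrac0|exact: homfracD|].
have le_ik : (i <= k)%N by rewrite -ltnS.
by rewrite -{1}(subnKC le_ik); apply: homfracM; apply: vcompP.
Qed.
Definition vmul F G := Vhat (vmul_subproof F G).

Lemma vaddA : associative vadd.
Proof. by move=> F G H; apply: vhat_eq => k /=; rewrite addrA. Qed.
Lemma vaddC : commutative vadd.
Proof. by move=> F G; apply: vhat_eq => k /=; rewrite addrC. Qed.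
Lemma vadd0 : left_id v0 vadd.
Proof. by move=> F; apply: vhat_eq => k /=; rewrite add0r. Qed.
Lemma vaddN : left_inverse v0 vopp vadd.
Proof. by move=> F; apply: vhat_eq => k /=; rewrite addNr. Qed.

HB.instance Definition _ :=
  GRing.isZmodule.Build vhat vaddA vaddC vadd0 vaddN.

Definition vagree K F (p : {poly Cx}) := forall k, (k < K)%N -> vcomp F k = p`_k.

Definition vtrunc K F : {poly Cx} := \poly_(k < K) vcomp F k.

Lemma vtruncP K F : vagree K F (vtrunc K F).
Proof. by move=> k lt_kK; rewrite coef_poly lt_kK. Qed.

Lemma vagreeM K F G p q :
  vagree K F p -> vagree K G q -> vagree K (vmul F G) (p * q).
Proof.
move=> Fp Gq k lt_kK /=; rewrite coefM; apply: eq_bigr => i _.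
have le_ik : (i <= k)%N by rewrite -ltnS.
rewrite Fp ?Gq //; first exact: leq_ltn_trans (leq_subr _ _) lt_kK.
exact: leq_ltn_trans lt_kK.
Qed.

Lemma vagreeD K F G p q :
  vagree K F p -> vagree K G q -> vagree K (vadd F G) (p + q).
Proof. by move=> Fp Gq k lt_kK /=; rewrite coefD Fp ?Gq. Qed.

Lemma vagree_eq F G : (forall K, exists2 p, vagree K F p & vagree K G p) ->
  F = G.
Proof.
move=> FG; apply: vhat_eq => k; have [p Fp Gp] := FG k.+1.
by rewrite Fp ?Gp.
Qed.

Lemma vmulA : associative vmul.
Proof.
move=> F G H; apply: vagree_eq => K.
have [f g h] := And3 (@vtruncP K F) (@vtruncP K G) (@vtruncP K H).
exists (vtrunc K F * (vtrunc K G * vtrunc K H)); last rewrite mulrA;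
  by do ?apply: vagreeM.
Qed.

Lemma vmulC : commutative vmul.
Proof.
move=> F G; apply: vagree_eq => K.
have [f g] := conj (@vtruncP K F) (@vtruncP K G).
exists (vtrunc K F * vtrunc K G); last rewrite mulrC; exact: vagreeM.
Qed.

Lemma vmul1 : left_id v1 vmul.
Proof.
move=> F; apply: vagree_eq => K; exists (vtrunc K F); last exact: vtruncP.
rewrite -[X in vagree _ _ X]mul1r.
by apply: vagreeM; [move=> k _; rewrite coef1 | exact: vtruncP].
Qed.

Lemma vmulDl : left_distributive vmul vadd.
Proof.
move=> F G H; apply: vagree_eq => K.
have [f g h] := And3 (@vtruncP K F) (@vtruncP K G) (@vtruncP K H).
exists ((vtrunc K F + vtrunc K G) * vtrunc K H).
  by apply: vagreeM => //; apply: vagreeD.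
by rewrite mulrDl; apply: vagreeD; apply: vagreeM.
Qed.

Lemma v1_neq0 : v1 != v0.
Proof.
apply/eqP => /(congr1 (fun F => vcomp F 0%N)) /= /eqP.
by rewrite oner_eq0.
Qed.

HB.instance Definition _ := GRing.Zmodule_isComNzRing.Build vhat
  vmulA vmulC vmul1 vmulDl v1_neq0.

Lemma vcomp0 k : vcomp (0 : vhat) k = 0.
Proof. by []. Qed.

Lemma vcomp1 k : vcomp (1 : vhat) k = (k == 0%N)%:R.
Proof. by []. Qed.

Lemma vcompM F G k :
  vcomp (F * G) k = \sum_(i < k.+1) vcomp F i * vcomp G (k - i).
Proof. by []. Qed.

Definition vunit : pred vhat := fun F => `[< exists G, G * F = 1 >].
Definition vinv F : vhat :=
  if pselect (exists G, G * F = 1) is left e then projT1 (cid e) else F.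

Lemma vmulV : {in vunit, left_inverse 1 vinv *%R}.
Proof.
move=> F /asboolP uF; rewrite /vinv; case: pselect => // e.
exact: (projT2 (cid e)).
Qed.

Lemma vunitPl F G : G * F = 1 -> vunit F.
Proof. by move=> GF; apply/asboolP; exists G. Qed.

Lemma vinv_out : {in [predC vunit], vinv =1 id}.
Proof.
move=> F; rewrite inE => /asboolPn nF; rewrite /vinv.
by case: pselect.
Qed.

HB.instance Definition _ :=
  GRing.ComNzRing_hasMulInverse.Build vhat vmulV vunitPl vinv_out.

Fact vord_subproof F : {k : nat | F <> 0 ->
  vcomp F k <> 0 /\ forall i, (i < k)%N -> vcomp F i = 0}.
Proof.
case: (pselect (exists k, vcomp F k != 0)) => [e|nF]; last first.
  exists 0%N; case; apply: vhat_eq => k; rewrite vcomp0.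
  by apply/eqP; apply: contrapT => /negP Fk; apply: nF; exists k.
case: (ex_minnP e) => m /eqP Fm minm; exists m => _; split=> // k lt_km; apply/eqP.
by apply: contraTT lt_km => /minm; rewrite -leqNgt.
Qed.

(* The least index of a nonzero component; vord 0 is never used, see nu_ge. *)
Definition vord F : nat := sval (vord_subproof F).

Lemma vordP F : F != 0 ->
  vcomp F (vord F) != 0 /\ forall k, (k < vord F)%N -> vcomp F k = 0.
Proof.
by move=> /eqP F0; have [/eqP Fm ltm] := svalP (vord_subproof F) F0.
Qed.

Lemma vord_uniq F k :
  vcomp F k != 0 -> (forall i, (i < k)%N -> vcomp F i = 0) -> vord F = k.
Proof.
move=> Fk ltk; have /vordP[Fm minm] : F != 0.
  by apply: contraNneq Fk => ->.
case: (ltngtP (vord F) k) => // [/ltk F0|/minm F0].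
  by rewrite F0 eqxx in Fm.
by rewrite F0 eqxx in Fk.
Qed.

Lemma vcompM_ord F G : F != 0 -> G != 0 ->
  vcomp (F * G) (vord F + vord G) = vcomp F (vord F) * vcomp G (vord G) /\
  forall k, (k < vord F + vord G)%N -> vcomp (F * G) k = 0.
Proof.
move=> /vordP[_ F0] /vordP[_ G0]; split=> [|k lt_k] /=.
  have lt_F : (vord F < (vord F + vord G).+1)%N by rewrite ltnS leq_addr.
  rewrite (bigD1 (Ordinal lt_F)) //= addKn big1 ?addr0 // => i ineq.
  case: (ltngtP i (vord F)) => [/F0->|ltF|ieq]; first by rewrite mul0r.
    by rewrite G0 ?mulr0 // ltn_subLR ?ltn_add2r // -ltnS.
  by case/eqP: ineq; apply: val_inj.
rewrite big1 // => i _; have [/F0->|leF] := ltnP i (vord F).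
  by rewrite mul0r.
have le_ik : (i <= k)%N by rewrite -ltnS.
rewrite G0 ?mulr0 // ltn_subLR //.
by apply: leq_trans lt_k _; rewrite leq_add2r.
Qed.

Fact vhat_integral F G : F * G = 0 -> (F == 0) || (G == 0).
Proof.
move=> FG; apply/norP => -[F0 G0]; have [FGord _] := vcompM_ord F0 G0.
have [nF _] := vordP F0; have [nG _] := vordP G0.
by have := mulf_neq0 nF nG; rewrite -FGord FG vcomp0 eqxx.
Qed.

HB.instance Definition _ :=
  GRing.ComUnitRing_isIntegral.Build vhat vhat_integral.

Lemma vordM F G : F != 0 -> G != 0 -> vord (F * G) = (vord F + vord G)%N.
Proof.
move=> F0 G0; have [FG ltFG] := vcompM_ord F0 G0.
apply: vord_uniq => //; rewrite FG.
by apply: mulf_neq0; [case: (vordP F0) | case: (vordP G0)].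
Qed.

Definition vhat_of_mseries (f : mseries n C) : vhat :=
  Vhat (fun k => homfrac_mpoly (mhcomp_homog k f)).

Lemma vcomp_of_mseries f k : vcomp (vhat_of_mseries f) k = (mhcomp k f)%:F.
Proof. by []. Qed.

Lemma vhat_of_mseries_is_zmod : zmod_morphism vhat_of_mseries.
Proof.
move=> f g; apply/eqP; rewrite eq_sym subr_eq; apply/eqP/vhat_eq => k /=.
by rewrite -[in LHS](subrK g f) mhcompD rmorphD.
Qed.

Lemma vhat_of_mseries_is_monoid : monoid_morphism vhat_of_mseries.
Proof.
split=> [|f g]; apply: vhat_eq => k.
  by rewrite vcomp_of_mseries vcomp1 mhcomp1 rmorph_nat.
rewrite vcomp_of_mseries vcompM mhcompM rmorph_sum; apply: eq_bigr => i _.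
by rewrite !vcomp_of_mseries rmorphM.
Qed.

HB.instance Definition _ := GRing.isZmodMorphism.Build _ _
  vhat_of_mseries vhat_of_mseries_is_zmod.
HB.instance Definition _ := GRing.isMonoidMorphism.Build _ _
  vhat_of_mseries vhat_of_mseries_is_monoid.

Lemma vhat_of_mseries_inj : injective vhat_of_mseries.
Proof.
move=> f g fg; apply: mseriesP => m; have := congr1 (fun F => vcomp F (mdeg m)) fg.
move=> /= /eqP; rewrite tofrac_eq => /eqP/(congr1 (mcoeff m)).
by rewrite !mcoeff_mhcomp eqxx.
Qed.

End CompletedValuationRing.

Section Fractions.

Lemma frac_numden (R : idomainType) (x : {fraction R}) :
  x = (\n_(repr x))%:F / (\d_(repr x))%:F.
Proof.
have d0 : (\d_(repr x))%:F != 0 by rewrite tofrac_eq0 denom_ratioP.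
apply: (mulIf d0); rewrite divfK //; move: (repr x) (reprK x) d0 => r <- d0.
unlock FracField.tofrac; rewrite -[LHS]FracField.pi_mul.
apply/eqmodP; rewrite /= FracField.equivfE.
by rewrite /FracField.mulf !numden_Ratio ?oner_eq0 ?mulr1 ?denom_ratioP // mulrC.
Qed.

Lemma eq_frac (R : idomainType) (a b c d : R) : b != 0 -> d != 0 ->
  (a%:F / b%:F == c%:F / d%:F) = (a * d == c * b).
Proof. by move=> b0 d0; rewrite eqr_div ?tofrac_eq0 // -!tofracM tofrac_eq. Qed.

Variables (A B : idomainType) (phi : {rmorphism A -> B}).

(* The extension of an injective phi to fields of fractions. *)
Definition fracmap (x : {fraction A}) : {fraction B} :=
  (phi \n_(repr x))%:F / (phi \d_(repr x))%:F.

Hypothesis phi_inj : injective phi.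

Let phi_neq0 a : a != 0 -> phi a != 0.
Proof. by apply: contraNneq => /eqP; rewrite -(rmorph0 phi) (inj_eq phi_inj). Qed.

Lemma fracmapE (a b : A) : b != 0 ->
  fracmap (a%:F / b%:F) = (phi a)%:F / (phi b)%:F.
Proof.
move=> b0; have /esym/eqP := frac_numden (a%:F / b%:F).
have D0 := denom_ratioP (repr (a%:F / b%:F)).
rewrite eq_frac // => /eqP E; apply/eqP; rewrite /fracmap eq_frac ?phi_neq0 //.
by rewrite -!rmorphM E.
Qed.

Lemma fracmap_is_zmod : zmod_morphism fracmap.
Proof.
move=> x y; rewrite [x]frac_numden [y]frac_numden.
move: (denom_ratioP (repr x)) (denom_ratioP (repr y)).
move: (\n_(repr x)) (\d_(repr x)) (\n_(repr y)) (\d_(repr y)) => a b c d b0 d0.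
have subE (R : idomainType) (a' b' c' d' : R) : b' != 0 -> d' != 0 ->
    a'%:F / b'%:F - c'%:F / d'%:F = (a' * d' - c' * b')%:F / (b' * d')%:F.
  move=> ? ?; rewrite -mulNr addf_div ?tofrac_eq0 //.
  by rewrite tofracD tofracN !tofracM mulNr.
rewrite subE // !fracmapE ?mulf_neq0 // subE ?phi_neq0 //.
by rewrite rmorphB !rmorphM.
Qed.

Lemma fracmap_is_monoid : monoid_morphism fracmap.
Proof.
split=> [|x y].
  have := @fracmapE 1 1 (oner_neq0 _).
  by rewrite rmorph1 !tofrac1 !divr1.
rewrite [x]frac_numden [y]frac_numden.
move: (denom_ratioP (repr x)) (denom_ratioP (repr y)).
move: (\n_(repr x)) (\d_(repr x)) (\n_(repr y)) (\d_(repr y)) => a b c d b0 d0.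
have mulE (R : idomainType) (a' b' c' d' : R) :
    a'%:F / b'%:F * (c'%:F / d'%:F) = (a' * c')%:F / (b' * d')%:F.
  by rewrite mulf_div -!tofracM.
by rewrite mulE !fracmapE ?mulf_neq0 // mulE !rmorphM.
Qed.

End Fractions.

Section FracVhat.
Variables (n : nat) (C : fieldType).

Local Notation Cx := {fraction {mpoly C[n]}}.
Local Notation K := {fraction (vhat n C)}.

(* nu(F / G) = vord F - vord G for nonzero F, G, see nuE. *)
Definition nu (A : K) : int :=
  (vord \n_(repr A))%:Z - (vord \d_(repr A))%:Z.

(* q <= nu(A), with nu(0) = +oo. *)
Definition nu_ge (q : rat) (A : K) : Prop := A != 0 -> q <= (nu A)%:~R.

Lemma nuE (F G : vhat n C) : F != 0 -> G != 0 ->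
  nu (F%:F / G%:F) = (vord F)%:Z - (vord G)%:Z.
Proof.
move=> F0 G0; rewrite /nu; have := frac_numden (F%:F / G%:F).
move: (denom_ratioP (repr (F%:F / G%:F))).
move: (\n_(repr (F%:F / G%:F))) (\d_(repr (F%:F / G%:F))) => N D D0.
move=> FG; have /esym := eq_frac F N G0 D0; rewrite FG eqxx => /eqP E.
have N0 : N != 0.
  by apply: contraTneq (mulf_neq0 F0 D0) => N0; rewrite E N0 mul0r negbK.
have := congr1 (fun H => (vord H)%:Z) E.
rewrite (vordM F0 D0) (vordM N0 G0) !PoszD => EZ.
by apply/eqP; rewrite subr_eq addrAC eq_sym subr_eq EZ.
Qed.

Definition vhat_of_mpoly : {mpoly C[n]} -> vhat n C :=
  @vhat_of_mseries n C \o @mseries_of_mpoly n C.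

HB.instance Definition _ := GRing.RMorphism.on vhat_of_mpoly.

Lemma vhat_of_mpoly_inj : injective vhat_of_mpoly.
Proof. by move=> p q /vhat_of_mseries_inj/mseries_of_mpoly_inj. Qed.

Definition K_of_Cx : Cx -> K := fracmap vhat_of_mpoly.

HB.instance Definition _ := GRing.isZmodMorphism.Build Cx K
  K_of_Cx (fracmap_is_zmod vhat_of_mpoly_inj).
HB.instance Definition _ := GRing.isMonoidMorphism.Build Cx K
  K_of_Cx (fracmap_is_monoid vhat_of_mpoly_inj).

(* A = \sum_(k >= k0) c k, the sum being taken in the nu-adic topology. *)
Definition nu_sum (A : K) (k0 : int) (c : int -> Cx) : Prop :=
  forall N : nat,
    nu_ge (k0 + N%:Z)%:~R (A - \sum_(i < N) K_of_Cx (c (k0 + i%:Z))).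

(* The degree of a nonzero polynomial. *)
Definition mpdeg (p : {mpoly C[n]}) : nat := (msize p).-1.

(* Membership in P_h((x)). The exponent alpha * k + beta is an integer, which
   may be negative for finitely many k. *)
Definition Ph_laurent (h : {mpoly C[n]}) (A : K) : Prop :=
  exists (k0 : int) (alpha beta : nat) (a : int -> {mpoly C[n]}),
    (forall k, k0 <= k -> a k \is homog mdeg /\
      (a k != 0 ->
       (mpdeg (a k))%:Z - (alpha%:Z * k + beta%:Z) * (mpdeg h)%:Z = k)) /\
    nu_sum A k0 (fun k => (a k)%:F / h%:F ^ (alpha%:Z * k + beta%:Z)).

(* Gamma(x, z ^ w) is homogeneous: x ^ m * z ^ j is given degree |m| + w j. *)
Definition weighted_homog (w : rat) (Gamma : {poly {mpoly C[n]}}) : Prop :=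
  exists D : rat, forall (j : nat) (m : 'X_{1..n}),
    m \in msupp Gamma`_j -> (mdeg m)%:R + w * j%:R = D.

End FracVhat.

Section SimpleExtension.
Variables (F L : fieldType) (f : F -> L).

(* Membership in F(g). *)
Definition in_adjoin (g y : L) : Prop :=
  exists p q : {poly F}, (map_poly f q).[g] != 0 /\
    y = (map_poly f p).[g] / (map_poly f q).[g].

(* [E : F] = d, where E is a set of elements of L. *)
Definition has_degree (E : L -> Prop) (d : nat) : Prop :=
  exists b : 'I_d -> L,
    [/\ forall i, E (b i),
        forall c : 'I_d -> F, \sum_i f (c i) * b i = 0 -> forall i, c i = 0
      & forall y, E y -> exists c : 'I_d -> F, y = \sum_i f (c i) * b i].

End SimpleExtension.

Section HomogeneousElements.
Variables (n : nat) (C : fieldType) (L : fieldType).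

(* L is meant to be an algebraic closure of Frac(vhat). *)
Variable iota : {rmorphism {fraction (vhat n C)} -> L}.

Definition L_of_Cx : {fraction {mpoly C[n]}} -> L := iota \o @K_of_Cx n C.
Definition L_of_mpoly : {mpoly C[n]} -> L := L_of_Cx \o @FracField.tofrac _.
Definition L_of_mseries : mseries n C -> L :=
  iota \o @FracField.tofrac _ \o @vhat_of_mseries n C.

HB.instance Definition _ := GRing.RMorphism.on L_of_Cx.
HB.instance Definition _ := GRing.RMorphism.on L_of_mpoly.
HB.instance Definition _ := GRing.RMorphism.on L_of_mseries.

Definition integral_homogeneous (w : rat) (g : L) : Prop :=
  algebraicOver L_of_Cx g /\
  exists Gamma : {poly {mpoly C[n]}},
    [/\ weighted_homog w Gamma, Gamma \is monic
      & root (map_poly L_of_mpoly Gamma) g].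

(* Membership in P_h[[x, g]], where g is homogeneous of degree w; the degree
   d = [C(x)(g) : C(x)] is determined by g. *)
Definition Ph_series (h : {mpoly C[n]}) (w : rat) (g y : L) : Prop :=
  exists (d : nat) (A : 'I_d -> {fraction (vhat n C)}),
    [/\ has_degree L_of_Cx (in_adjoin L_of_Cx g) d,
        forall k, Ph_laurent h (A k),
        (* nu(A_k g^k) = nu(A_k) + k w >= 0 *)
        forall k : 'I_d, nu_ge (- ((k : nat)%:R * w)) (A k)
      & y = \sum_(k < d) iota (A k) * g ^+ k].

End HomogeneousElements.

(* Main.v *)
Require Import Defs.
From HB Require Import structures.
From mathcomp Require Import all_boot all_order all_algebra all_field.
From mathcomp Require Import boolp reals complex.
From mathcomp Require Import mpoly.
From mathcomp Require Import zify ring.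

(* Let n > 0 and t = x_1. Elements of the completed valuation ring are series
   \sum_k f_k t^k with f_k in the field K0 of homogeneous fractions of degree 0,
   so P becomes a polynomial over K0[[T]] and Newton-Puiseux gives
   P(T^M, y) = \prod (y - x_i) with x_i in E[[T]], E an algebraic closure of K0.
   (For n = 0 the polynomial P already splits over C.)

   The denominators are controlled along the way: E is filtered by sets B j,
   where B j consists, over K0, of the fractions a / h^j with a homogeneous, and
   where an algebraic element z is adjoined with weight 1. All the steps of the
   algorithm (Tschirnhausen transformation, change of slope, Hensel's lemma)
   preserve the series whose j-th coefficient lies in B (N (j + 1)) for some N,
   after enlarging h and adjoining finitely many z. Reducing the powers of these
   z modulo their equations leaves finitely many elements w_l of E such that the
   coefficients of the x_i are combinations of the w_l with coefficients in
   h^(- N (j + 1)) C[x].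

   There is s in E such that K0(s^M) contains s and all the w_l. After scaling s
   by an element of K0, the series s T^c, with c = 1 mod M, is a root of a
   weighted homogeneous Gamma in C[x][z] which is monic of degree
   d = M [K0(s^M) : K0]; looking at the exponents of T modulo M and at the powers
   of s^M, one sees that 1, s T^c, ..., (s T^c)^(d - 1) are independent over the
   completed valuation ring and that every x_i is a combination of them with
   coefficients in P_h((x)). If gamma in L is any root of Gamma, independence
   makes s T^c |-> gamma well defined, and it transports the factorization
   to L. *)

Set Implicit Arguments.
Unset Strict Implicit.
Unset Printing Implicit Defensive.

Import Order.TTheory GRing.Theory Num.Theory.
Local Open Scope ring_scope.

(** * Power series in one variable $T$ *)

Section UnivariateSeries.
Variable A : comNzRingType.

Record pser := PSer { pcoef : nat -> A }.

HB.instance Definition _ := gen_eqMixin pser.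
HB.instance Definition _ := gen_choiceMixin pser.

Implicit Types f g h : pser.

Lemma pserP f g : pcoef f =1 pcoef g -> f = g.
Proof. by case: f g => [u] [v] /= /funext ->. Qed.

Definition psadd f g := PSer (fun j => pcoef f j + pcoef g j).
Definition psopp f := PSer (fun j => - pcoef f j).
Definition psmul f g :=
  PSer (fun j => \sum_(i < j.+1) pcoef f i * pcoef g (j - i)).

Fact psaddA : associative psadd.
Proof. by move=> f g h; apply: pserP => j /=; rewrite addrA. Qed.
Fact psaddC : commutative psadd.
Proof. by move=> f g; apply: pserP => j /=; rewrite addrC. Qed.
Fact psadd0 : left_id (PSer (fun=> 0)) psadd.
Proof. by move=> f; apply: pserP => j /=; rewrite add0r. Qed.
Fact psaddN : left_inverse (PSer (fun=> 0)) psopp psadd.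
Proof. by move=> f; apply: pserP => j /=; rewrite addNr. Qed.

HB.instance Definition _ :=
  GRing.isZmodule.Build pser psaddA psaddC psadd0 psaddN.

Definition pagree K f (p : {poly A}) :=
  forall j, (j < K)%N -> pcoef f j = p`_j.

Lemma pagree_trunc K f : pagree K f (\poly_(j < K) pcoef f j).
Proof. by move=> j ltjK; rewrite coef_poly ltjK. Qed.

Lemma pagreeM K f g p q :
  pagree K f p -> pagree K g q -> pagree K (psmul f g) (p * q).
Proof.
move=> fp gq j ltjK; rewrite coefM; apply: eq_bigr => i _.
have leij : (i <= j)%N by rewrite -ltnS.
rewrite fp ?gq //; first exact: leq_ltn_trans (leq_subr _ _) ltjK.
exact: leq_ltn_trans ltjK.
Qed.

(** Reduces an identity between series to identities between polynomials, one for each truncation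
    order; associativity, commutativity and the multiplicativity of substitutions are obtained in
    this way. *)
Lemma pagree_eq f g :
  (forall K, exists2 p, pagree K f p & pagree K g p) -> f = g.
Proof.
by move=> fg; apply: pserP => j; have [p fp gp] := fg j.+1; rewrite fp ?gp.
Qed.

Fact psmulA : associative psmul.
Proof.
move=> f g h; apply: pagree_eq => K.
pose tr (x : pser) := \poly_(j < K) pcoef x j.
exists (tr f * (tr g * tr h)); last rewrite mulrA;
  by do ?[apply: pagreeM | apply: pagree_trunc].
Qed.

Fact psmulC : commutative psmul.
Proof.
move=> f g; apply: pagree_eq => K.
pose tr (x : pser) := \poly_(j < K) pcoef x j.
exists (tr f * tr g); last rewrite mulrC; apply: pagreeM; exact: pagree_trunc.
Qed.

Fact psmul1 : left_id (PSer (fun j => (j == 0%N)%:R)) psmul.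
Proof.
move=> f; apply: pserP => j /=.
by rewrite big_ord_recl /= mul1r subn0 big1 ?addr0 // => i _; rewrite mul0r.
Qed.

Fact psmulDl : left_distributive psmul psadd.
Proof.
move=> f g h; apply: pserP => j /=; rewrite -big_split /=.
by apply: eq_bigr => i _; rewrite mulrDl.
Qed.

Fact ps1_neq0 : PSer (fun j => (j == 0%N)%:R) != 0 :> pser.
Proof.
by apply/eqP => /(congr1 (fun f => pcoef f 0))/eqP; rewrite /= oner_eq0.
Qed.

HB.instance Definition _ := GRing.Zmodule_isComNzRing.Build pser
  psmulA psmulC psmul1 psmulDl ps1_neq0.

Lemma pcoef0 j : pcoef 0 j = 0. Proof. by []. Qed.
Lemma pcoefM f g j :
  pcoef (f * g) j = \sum_(i < j.+1) pcoef f i * pcoef g (j - i).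
Proof. by []. Qed.

Definition pscoef j f := pcoef f j.

Fact pscoef_is_zmod j : zmod_morphism (pscoef j).
Proof. by []. Qed.
HB.instance Definition _ j :=
  GRing.isZmodMorphism.Build pser A (pscoef j) (pscoef_is_zmod j).

Lemma pcoef_sum (I : Type) (r : seq I) (P : pred I) (F : I -> pser) j :
  pcoef (\sum_(i <- r | P i) F i) j = \sum_(i <- r | P i) pcoef (F i) j.
Proof. exact: (raddf_sum (pscoef j)). Qed.

Definition psmon (a : A) k := PSer (fun j => a *+ (j == k)).

Lemma pcoefM_mon f a k j :
  pcoef (f * psmon a k) j = if (k <= j)%N then pcoef f (j - k) * a else 0.
Proof.
rewrite mulrC pcoefM /=; case: leqP => [lekj | ltjk].
  have ltkj : (k < j.+1)%N by [].
  rewrite (bigD1 (Ordinal ltkj)) //= eqxx mulr1n mulrC big1 ?addr0 // => i ik.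
  by rewrite (_ : (i == k :> nat) = false) ?mul0r //; apply: contraNF ik.
rewrite big1 // => i _; rewrite ltn_eqF ?mul0r //.
by apply: leq_trans ltjk; apply: ltn_ord.
Qed.

Lemma psmonM a b k l : psmon a k * psmon b l = psmon (a * b) (k + l)%N.
Proof.
apply: pserP => j; rewrite pcoefM_mon /=.
have [lelj | ltjl] := leqP l j.
  by rewrite -(eqn_add2r l) subnK // -mulrnAl.
by rewrite ltn_eqF // (leq_trans ltjl) ?leq_addl.
Qed.

Lemma psmonX a k r : psmon a k ^+ r = psmon (a ^+ r) (k * r)%N.
Proof.
elim: r => [|r IHr]; first by rewrite !expr0 muln0; apply: pserP.
by rewrite !exprS IHr psmonM mulnS.
Qed.

Definition psdiv k f := PSer (fun j => pcoef f (j + k)).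

Lemma psdivK k f : (forall j, (j < k)%N -> pcoef f j = 0) ->
  psdiv k f * psmon 1 k = f.
Proof.
move=> f0; apply: pserP => j; rewrite pcoefM_mon /= mulr1.
by case: leqP => [/subnK-> | /f0].
Qed.

(** The substitution of $T^m$ for $T$. *)
Definition pssub m f :=
  PSer (fun j => if (m %| j)%N then pcoef f (j %/ m) else 0).

Fact pssub_is_zmod m : zmod_morphism (pssub m).
Proof.
move=> f g; apply: pserP => j /=.
by case: ifP => _ //; rewrite subr0.
Qed.

Lemma pagree_sub m K f p : (0 < m)%N -> pagree K f p ->
  pagree K (pssub m f) (p \Po 'X^m).
Proof.
move=> m0 fp j ltjK /=; rewrite coef_comp_poly_Xn //; case: ifP => // _.
exact/fp/(leq_ltn_trans (leq_div _ _)).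
Qed.

Lemma pssub_is_monoid m : (0 < m)%N -> monoid_morphism (pssub m).
Proof.
move=> m0; split=> [|f g].
  apply: pserP => j /=.
  case: ifP => [/dvdnP[k ->] | mj]; first by rewrite mulnK // muln_eq0 [m == _]gtn_eqF ?orbF.
  by case: eqP mj => // ->; rewrite dvdn0.
apply: pagree_eq => K; pose tr (x : pser) := \poly_(j < K) pcoef x j.
exists ((tr f * tr g) \Po 'X^m).
  by apply: pagree_sub => //; apply: pagreeM; apply: pagree_trunc.
by rewrite comp_polyM; apply: pagreeM; apply: pagree_sub => //;
  apply: pagree_trunc.
Qed.

Lemma pssub_comp m k f : (0 < m)%N -> pssub m (pssub k f) = pssub (k * m)%N f.
Proof.
move=> m0; apply: pserP => j /=; case: (boolP (m %| j)%N) => [/dvdnP[l ->] | mj].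
  by rewrite mulnK // dvdn_pmul2r // divnMr.
by case: ifP => // kmj; case/negP: mj; apply: dvdn_trans kmj; apply: dvdn_mull.
Qed.

End UnivariateSeries.

Section SubstMorphism.
Variables (A : comNzRingType) (m : nat).

(* m.+1, because pssub 0 is not multiplicative. *)
Definition pssubS : pser A -> pser A := pssub m.+1.

HB.instance Definition _ := GRing.isZmodMorphism.Build (pser A) (pser A)
  pssubS (@pssub_is_zmod A m.+1).
HB.instance Definition _ := GRing.isMonoidMorphism.Build (pser A) (pser A)
  pssubS (@pssub_is_monoid A m.+1 isT).

End SubstMorphism.

Section SeriesDomain.
Variable A : idomainType.

Lemma pser_order (f : pser A) : f != 0 ->
  exists2 k, pcoef f k != 0 & forall j, (j < k)%N -> pcoef f j = 0.
Proof.
move=> f0; have [e|nF] := pselect (exists k, pcoef f k != 0).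
  case: (ex_minnP e) => k fk mink; exists k => // j.
  by rewrite ltnNge => /negP lekj; apply/eqP; apply: contraPT (lekj) => /mink ->.
case/eqP: f0; apply: pserP => k; apply/eqP; apply: contrapT => /negP fk.
by apply: nF; exists k.
Qed.

Lemma pser_mul_eq0 (f g : pser A) : f * g = 0 -> (f == 0) || (g == 0).
Proof.
move=> fg0; apply/norP => -[/pser_order[k fk f0] /pser_order[l gl g0]].
have := congr1 (fun h => pcoef h (k + l)) fg0; rewrite pcoefM pcoef0.
have ltk : (k < (k + l).+1)%N by rewrite ltnS leq_addr.
rewrite (bigD1 (Ordinal ltk)) //= addKn big1 ?addr0 => [/eqP|i ik].
  by rewrite mulf_eq0 (negbTE fk) (negbTE gl).
have [/f0->|leki] := ltnP i k; first by rewrite mul0r.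
have neik : (i : nat) != k by apply: contra ik => /eqP ik; apply/eqP/val_inj.
by rewrite g0 ?mulr0 //; have := ltn_ord i; lia.
Qed.

End SeriesDomain.

(** * Filtrations of a field that measure denominators *)

Section Filtrations.
Variable F : fieldType.
Implicit Types (B : nat -> F -> Prop) (p q : {poly F}).

(** An element of [B j] is to be thought of as having a denominator of order at most [j]. Inverses
    of positive integers get weight 0, so that Tschirnhausen transformations preserve tame
    series. *)
Record filtration B : Prop := Filtration {
  filt0 : forall j, B j 0;
  filt1 : B 0%N 1;
  filt_invn : forall d, B 0%N (d.+1%:R^-1);
  filtB : forall j x y, B j x -> B j y -> B j (x - y);
  filtM : forall i j x y, B i x -> B j y -> B (i + j)%N (x * y);
  filt_le : forall i j x, (i <= j)%N -> B i x -> B j x }.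

Lemma filtN B j x : filtration B -> B j x -> B j (- x).
Proof. by move=> FB Bx; rewrite -sub0r; apply: filtB => //; apply: filt0. Qed.

Lemma filtD B j x y : filtration B -> B j x -> B j y -> B j (x + y).
Proof.
by move=> FB Bx By; rewrite -[y]opprK; apply: filtB => //; apply: filtN.
Qed.

Lemma filt_sum B j (I : Type) (r : seq I) (P : pred I) (x : I -> F) :
  filtration B -> (forall i, P i -> B j (x i)) -> B j (\sum_(i <- r | P i) x i).
Proof.
move=> FB Bx; apply: big_ind => //; first exact: filt0.
by move=> y z; apply: filtD.
Qed.

(* Giving the variable weight 1 makes this a filtration of F[X] which is
   stable under reduction modulo a monic polynomial with coefficients in B 1. *)
Definition wpoly B c p :=
  forall i, if (i <= c)%N then B (c - i)%N p`_i else p`_i = 0.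

Variable B : nat -> F -> Prop.
Hypothesis FB : filtration B.

Lemma wpoly0 c : wpoly B c 0.
Proof. by move=> i; rewrite coef0; case: ifP => // _; apply: filt0. Qed.

Lemma wpolyB c p q : wpoly B c p -> wpoly B c q -> wpoly B c (p - q).
Proof.
move=> wp wq i; move: (wp i) (wq i); rewrite coefB.
by case: ifP => _; [apply: filtB | move=> -> ->; rewrite subr0].
Qed.

Lemma wpolyD c p q : wpoly B c p -> wpoly B c q -> wpoly B c (p + q).
Proof.
move=> wp wq; rewrite -[q]opprK -[- q]sub0r; apply: wpolyB => //.
by apply: wpolyB => //; apply: wpoly0.
Qed.

Lemma wpoly_sum c (I : Type) (r : seq I) (P : pred I) (p : I -> {poly F}) :
  (forall i, P i -> wpoly B c (p i)) -> wpoly B c (\sum_(i <- r | P i) p i).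
Proof.
move=> wp; apply: big_ind => //; first exact: wpoly0.
by move=> y z; apply: wpolyD.
Qed.

Lemma wpolyM c d p q :
  wpoly B c p -> wpoly B d q -> wpoly B (c + d) (p * q).
Proof.
move=> wp wq i; rewrite coefM; case: leqP => icd.
  apply: filt_sum => // k _; have := ltn_ord k; rewrite ltnS => lek.
  move: (wp k) (wq (i - k)%N); case: leqP => kc; last first.
    by move=> -> _; rewrite mul0r; apply: filt0.
  case: leqP => ikd Bp; last by move=> ->; rewrite mulr0; apply: filt0.
  by move=> /(filtM FB Bp); apply: filt_le => //; lia.
rewrite big1 // => k _; have := ltn_ord k; rewrite ltnS => lek.
move: (wp k) (wq (i - k)%N); case: leqP => kc; last by move=> ->; rewrite mul0r.
by case: leqP => ikd; [lia | move=> _ ->; rewrite mulr0].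
Qed.

Lemma wpoly_le c d p : (c <= d)%N -> wpoly B c p -> wpoly B d p.
Proof.
move=> cd wp i; move: (wp i); have [ic | ci] := leqP i c.
  by rewrite (leq_trans ic cd); apply: filt_le => //; apply: leq_sub2r.
by case: ifP => // _ ->; apply: filt0.
Qed.

Lemma wpoly_size N S p : (forall i, B N p`_i) -> (size p <= S)%N ->
  wpoly B (N + S) p.
Proof.
move=> Bp sp i; have [ip | pi] := ltnP i (size p).
  have iS := leq_trans (ltnW ip) sp; rewrite (leq_trans iS (leq_addl _ _)).
  by apply: filt_le (Bp i) => //; lia.
by rewrite nth_default //; case: ifP => // _; apply: filt0.
Qed.

Lemma wpoly_coef c p i : wpoly B c p -> B c p`_i.
Proof.
move=> /(_ i); case: ifP => _; last by move=> ->; apply: filt0.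
by apply: filt_le => //; apply: leq_subr.
Qed.

Lemma wpolyXn c a k : B c a -> wpoly B (c + k) (a *: 'X^k).
Proof.
move=> Ba i; rewrite coefZ coefXn; case: eqP => [->|ik].
  by rewrite leq_addl mulr1 addnK.
by rewrite mulr0; case: ifP => // _; apply: filt0.
Qed.

Lemma wpoly_monic f : f \is monic -> (forall i, B 1%N f`_i) ->
  wpoly B (size f).-1 f.
Proof.
move=> f1 Bf i; have [ltif | leif] := ltnP i (size f).-1.
  by rewrite ltnW //; apply: filt_le (Bf i) => //; rewrite subn_gt0.
have [->|neif] := eqVneq i (size f).-1.
  by rewrite leqnn subnn -lead_coefE (monicP f1); apply: filt1.
have fi : (size f <= i)%N by lia.
by rewrite (nth_default _ fi) leqNgt ltn_neqAle eq_sym neif leif.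
Qed.

(** A step of the division subtracts $a X^e f$, where $a$ is the leading coefficient of $p$. Here
    $a$ lies in level $c - \deg p$, $f$ has weight $\deg f$ and $e + \deg f = \deg p$, so the weight
    stays at most $c$. *)
Lemma wpoly_mod c f p : f \is monic -> (forall i, B 1%N f`_i) ->
  wpoly B c p -> wpoly B c (p %% f).
Proof.
move=> f1 Bf; have wf := wpoly_monic f1 Bf; have f0 := monic_neq0 f1.
have [k] := ubnP (size p); elim: k p => // k IHk p /ltnSE sp wp.
have [/modp_small -> // | le_fp] := ltnP (size p) (size f).
set a := lead_coef p; set e := (size p - size f)%N.
have sf : (0 < size f)%N by rewrite size_poly_gt0.
have sp0 : (0 < size p)%N by apply: leq_trans le_fp.
pose p' := p - a *: 'X^e * f.
have -> : p %% f = p' %% f.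
  by rewrite /p' -mulNr modpD modp_mull addr0.
have [ltcp | lepc] := ltnP c (size p).-1.
  have := wp (size p).-1; rewrite leqNgt ltcp /= -lead_coefE => /eqP.
  by rewrite lead_coef_eq0 => p0; rewrite (eqP p0) size_poly0 in sp0.
apply: IHk.
  apply: leq_trans sp; rewrite -(prednK sp0) ltnS; apply/leq_sizeP => i lei.
  have [->|/eqP nei] := eqVneq i (size p).-1.
    rewrite coefB -mul_polyC -mulrA coefCM coefXnM.
    rewrite ifN -?leqNgt; last by rewrite /e; lia.
    rewrite (_ : (_ - e)%N = (size f).-1); last by rewrite /e; lia.
    by rewrite -[f`_ _]lead_coefE (monicP f1) mulr1 subrr.
  rewrite coefB -mul_polyC -mulrA coefCM coefXnM.
  have pi : (size p <= i)%N by lia.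
  rewrite (nth_default _ pi) sub0r; case: ltnP => ie; first by rewrite mulr0 oppr0.
  have fi : (size f <= i - e)%N by rewrite /e; lia.
  by rewrite (nth_default _ fi) mulr0 oppr0.
apply: wpolyB => //.
have Ba : B (c - (size p).-1)%N a by have := wp (size p).-1; rewrite lepc.
by apply: (wpoly_le _ (wpolyM (wpolyXn e Ba) wf)); rewrite /e; lia.
Qed.

End Filtrations.

(** * Hensel's lemma with control of denominators *)

Lemma size_mul_leq (R : nzRingType) (p q : {poly R}) a b :
  (size p <= a)%N -> (size q <= b)%N -> (size (p * q)%R <= (a + b).-1)%N.
Proof.
move=> pa qb; apply: leq_trans (size_polyMleq p q) _.
by rewrite -!subn1 leq_sub2r // leq_add.
Qed.

Section Slices.
Variable A : idomainType.

(** The coefficient of $T^j$ when $A[[T]][y]$ is read inside $A[y][[T]]$. *)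
Definition slice j (q : {poly pser A}) : {poly A} := map_poly (pscoef j) q.

Lemma coef_slice j q i : (slice j q)`_i = pcoef q`_i j.
Proof. exact: coef_map. Qed.

Lemma slice_inj q r : (forall j, slice j q = slice j r) -> q = r.
Proof.
move=> qr; apply/polyP => i; apply: pserP => j.
by rewrite -!coef_slice qr.
Qed.

Lemma sliceM j q r :
  slice j (q * r) = \sum_(i < j.+1) slice i q * slice (j - i) r.
Proof.
apply/polyP => i; rewrite coef_slice coefM pcoef_sum coef_sum.
under eq_bigr do rewrite pcoefM; rewrite exchange_big; apply: eq_bigr => k _.
by rewrite coefM; apply: eq_bigr => l _; rewrite !coef_slice.
Qed.

Lemma size_slice j q : (size (slice j q) <= size q)%N.
Proof. exact: size_poly. Qed.

Lemma slice0_monic q : q \is monic ->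
  slice 0 q \is monic /\ size (slice 0 q) = size q.
Proof.
move=> q1; have q0 := monic_neq0 q1.
have sq : (0 < size q)%N by rewrite size_poly_gt0.
have lq : (slice 0 q)`_(size q).-1 = 1.
  by rewrite coef_slice -lead_coefE (monicP q1).
have sl : size (slice 0 q) = size q.
  apply/eqP; rewrite eqn_leq size_slice -(prednK sq) /=.
  apply: contraT; rewrite -leqNgt => /(nth_default 0); rewrite lq.
  by move/eqP; rewrite oner_eq0.
by split=> //; rewrite monicE lead_coefE sl lq.
Qed.

Lemma size_sliceS j q : q \is monic -> (size (slice j.+1 q) < size q)%N.
Proof.
move=> q1; have sq : (0 < size q)%N by rewrite size_poly_gt0 monic_neq0.
rewrite -(prednK sq) ltnS; apply/leq_sizeP => i; rewrite leq_eqVlt coef_slice.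
case/predU1P => [<-|lti]; first by rewrite -lead_coefE (monicP q1).
by rewrite nth_default // -(prednK sq).
Qed.

End Slices.

(** [X k] tabulates the values of index below [k]; by hypothesis [step k] consults no others, so
    later tables never change an earlier value. *)
Lemma course_of_values (T : Type) (x0 : T) (step : nat -> (nat -> T) -> T) :
  (forall j a b, (forall i, (i < j)%N -> a i = b i) -> step j a = step j b) ->
  exists x : nat -> T, forall j, x j = step j x.
Proof.
move=> stepP.
pose fix X k : nat -> T := if k is k'.+1 then
  fun i => if i == k' then step k' (X k') else X k' i else fun=> x0.
have Xle k i : (i < k)%N -> X k i = X i.+1 i.
  elim: k => // k IHk; rewrite ltnS leq_eqVlt => /predU1P[->//|ltik].
  by rewrite /= (ltn_eqF ltik) IHk.
exists (fun j => X j.+1 j) => j; rewrite /= eqxx; apply: stepP => i /Xle.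
by rewrite /= eqxx.
Qed.

Section Hensel.
Variable F : fieldType.

(* In the application B j consists of the combinations of finitely many elements
   whose coefficients have denominator h ^ j, so tame series are those whose
   denominators grow linearly. *)
Definition tame (B : nat -> F -> Prop) (f : pser F) :=
  exists N, forall j, B (N * j.+1)%N (pcoef f j).

Definition tame_poly (B : nat -> F -> Prop) (q : {poly pser F}) :=
  exists N, forall i j, B (N * j.+1)%N (pcoef q`_i j).

Variable B : nat -> F -> Prop.
Hypothesis FB : filtration B.

(** For $j > 0$ the slices $a_j$, $b_j$ of the two factors must satisfy $f b_j + a_j g = r_j$, where
    $r_j$ involves earlier slices only; Bezout's relation solves this with $\deg a_j < \deg f$ and
    $\deg b_j < \deg g$. The weights grow linearly, because the bound for each slice keeps a margin
    [k] that pays for the multiplication by [u] or [v]. *)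
Lemma hensel (q : {poly pser F}) (f g u v : {poly F}) :
    q \is monic -> tame_poly B q -> f \is monic -> g \is monic ->
    slice 0 q = f * g -> u * f + v * g = 1 ->
    (forall i, [/\ B 1%N f`_i, B 1%N g`_i, B 1%N u`_i & B 1%N v`_i]) ->
  exists q1 q2, [/\ q = q1 * q2, [/\ q1 \is monic & size q1 = size f],
    [/\ q2 \is monic & size q2 = size g], tame_poly B q1 & tame_poly B q2].
Proof.
move=> q_mon [N Bq] f_mon g_mon q0fg uvfg B1.
have [_ sq] := slice0_monic q_mon; rewrite q0fg in sq.
have [f0 g0] := (monic_neq0 f_mon, monic_neq0 g_mon).
have sfg : size (f * g) = (size f + size g).-1 by rewrite size_mul.
have [sf sg] : (0 < size f /\ 0 < size g)%N by rewrite !size_poly_gt0.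
have sfg0 : (0 < size (f * g)%R)%N by rewrite sfg; lia.
pose rest (x : nat -> {poly F} * {poly F}) j :=
  slice j q - \sum_(1 <= i < j) (x i).1 * (x (j - i)%N).2.
pose step j x := if j is 0 then (f, g) else
  ((v * rest x j) %% f, (u * rest x j) %% g).
have [|x xE] := @course_of_values _ (f, g) step.
  case=> // j a b ab; rewrite /step; congr (_ * _ %% _, _ * _ %% _); congr (_ - _);
  by apply: eq_big_nat => i /andP[i0 ij]; rewrite !ab //; lia.
have x0 : x 0%N = (f, g) by rewrite xE.
have xS j : x j.+1 = ((v * rest x j.+1) %% f, (u * rest x j.+1) %% g).
  by rewrite xE.
have sxS j : (size (x j.+1).1 < size f)%N /\ (size (x j.+1).2 < size g)%N.
  by rewrite xS /= !ltn_modp.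
have sx j : (size (x j).1 <= size f)%N /\ (size (x j).2 <= size g)%N.
  case: j => [|j]; first by rewrite x0.
  by have [/ltnW ? /ltnW] := sxS j.
have srest j : (size (rest x j.+1) < size (f * g)%R)%N.
  rewrite -(prednK sfg0).
  rewrite ltnS; apply: leq_trans (size_polyD _ _) _; rewrite size_polyN geq_max.
  apply/andP; split; first by rewrite -ltnS prednK // sq size_sliceS.
  apply: leq_trans (size_sum _ _ _) _; apply/bigmax_leqP_seq => i.
  rewrite mem_index_iota => /andP[i0 ij] _.
  case: i i0 ij => // i _ ij.
  have [s1 _] := sxS i; have [_] := sxS (j - i.+1)%N; rewrite -subSn // => s2.
  have s1' : (size (x i.+1).1 <= (size f).-1)%N by rewrite -ltnS prednK.
  by apply: leq_trans (size_mul_leq s1' (ltnW s2)) _; rewrite sfg; lia.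
have restE j : f * (x j.+1).2 + (x j.+1).1 * g = rest x j.+1.
  rewrite xS /=; set s := rest x j.+1.
  set a := (v * s) %/ f; set b := (u * s) %/ g.
  have /eqP := divp_eq (v * s) f; rewrite -/a addrC -subr_eq => /eqP Ef.
  have /eqP := divp_eq (u * s) g; rewrite -/b addrC -subr_eq => /eqP Eg.
  have E : f * ((u * s) %% g) + (v * s) %% f * g = s - (a + b) * (f * g).
    by rewrite -Ef -Eg -[s in RHS]mul1r -uvfg; ring.
  (* The left side of [E] and [s] both have degree less than that of $f g$, so the multiple $(a + b)
     f g$ has to vanish. *)
  have [ab0 | ab0] := eqVneq (a + b) 0; first by rewrite E ab0 mul0r subr0.
  have s1 : (size (f * ((u * s) %% g) + (v * s) %% f * g)%R < size (f * g)%R)%N.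
    have m1 : (size ((u * s) %% g)%R <= (size g).-1)%N.
      by rewrite -ltnS prednK ?ltn_modp.
    have m2 : (size ((v * s) %% f)%R <= (size f).-1)%N.
      by rewrite -ltnS prednK ?ltn_modp.
    apply: leq_ltn_trans (size_polyD _ _) _; rewrite gtn_max sfg.
    apply/andP; split.
      by apply: leq_ltn_trans (size_mul_leq (leqnn (size f)) m1) _; lia.
      by apply: leq_ltn_trans (size_mul_leq m2 (leqnn (size g))) _; lia.
  have : (size (f * g)%R <= size ((a + b) * (f * g))%R)%N.
    by apply: dvdp_leq; [rewrite !mulf_neq0 | apply: dvdp_mull].
  move/eqP: E; rewrite eq_sym subr_eq addrC -subr_eq => /eqP <-.
  rewrite leqNgt => /negP[]; apply: leq_ltn_trans (size_polyD _ _) _.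
  by rewrite size_polyN gtn_max srest s1.
pose q1 := \poly_(i < size f) PSer (fun j => (x j).1`_i).
pose q2 := \poly_(i < size g) PSer (fun j => (x j).2`_i).
have q1E j : slice j q1 = (x j).1.
  apply/polyP => i; rewrite coef_slice coef_poly; case: ltnP => //= fi.
  by rewrite nth_default //; apply: leq_trans fi; case: (sx j).
have q2E j : slice j q2 = (x j).2.
  apply/polyP => i; rewrite coef_slice coef_poly; case: ltnP => //= fi.
  by rewrite nth_default //; apply: leq_trans fi; case: (sx j).
have top (h : {poly F}) (y : nat -> {poly F}) : h \is monic -> y 0%N = h ->
    (forall j, size (y j.+1) < size h)%N ->
    PSer (fun j => (y j)`_(size h).-1) = 1.
  move=> h1 y0 yS; apply: pserP => -[|j] /=.
    by rewrite y0 -lead_coefE (monicP h1).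
  by rewrite nth_default // -ltnS prednK ?yS // size_poly_gt0 monic_neq0.
have top1 : PSer (fun j => (x j).1`_(size f).-1) = 1.
  by apply: (top f (fun j => (x j).1)) => // [|j]; [rewrite x0 | case: (sxS j)].
have top2 : PSer (fun j => (x j).2`_(size g).-1) = 1.
  by apply: (top g (fun j => (x j).2)) => // [|j]; [rewrite x0 | case: (sxS j)].
have sq1 : size q1 = size f.
  by rewrite size_poly_eq // top1 oner_neq0.
have sq2 : size q2 = size g.
  by rewrite size_poly_eq // top2 oner_neq0.
set k := (size u + size v + 1)%N.
have wk (p : {poly F}) : (forall i, B 1%N p`_i) -> (size p < k)%N -> wpoly B k p.
  by move=> Bp sp; apply: (wpoly_le FB sp); rewrite -add1n; apply: wpoly_size.
have wu : wpoly B k u by apply: wk => [i|]; [case: (B1 i) | rewrite /k; lia].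
have wv : wpoly B k v by apply: wk => [i|]; [case: (B1 i) | rewrite /k; lia].
(* $M (j + 1)$ has to absorb the weight $N (j + 2)$ plus [size q] of the slice of index $j + 1$ of
   [q], and twice the margin. *)
pose M := (2 * N + size q + 2 * k)%N.
have wx j : wpoly B (M * j.+1 - k) (x j.+1).1 /\ wpoly B (M * j.+1 - k) (x j.+1).2.
  have [l] := ubnP j; elim: l j => // l IHl j /ltnSE lejl.
  (* Two earlier slices bring a margin [k] each: one is spent on [u] or [v], the other restores the
     induction hypothesis. *)
  have wr : wpoly B (M * j.+1 - 2 * k) (rest x j.+1).
    apply: wpolyB => //.
      apply: (@wpoly_le _ _ FB (N * j.+2 + size q)); first by rewrite /M; nia.
      by apply: wpoly_size => // [i|]; rewrite ?coef_slice ?size_slice.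
    rewrite big_nat_cond; apply: wpoly_sum => // i; rewrite andbT => /andP[i0 ij].
    case: i i0 ij => // i _ ij; have [|w _] := IHl i; first by lia.
    have [|_ w'] := IHl (j - i.+1)%N; first by lia.
    rewrite -subSn // in w'.
    apply: (wpoly_le FB _ (wpolyM FB w w')); rewrite /M; nia.
  by rewrite xS; split; apply: wpoly_mod => //; try (by move=> i; case: (B1 i));
    [apply: (wpoly_le FB _ (wpolyM FB wv wr)) | apply: (wpoly_le FB _ (wpolyM FB wu wr))];
    rewrite /M; nia.
have tm (y : nat -> {poly F}) S : (forall i, B 1%N (y 0%N)`_i) ->
    (forall j, wpoly B (M * j.+1 - k) (y j.+1)) ->
    tame_poly B (\poly_(i < S) PSer (fun j => (y j)`_i)).
  move=> By0 wy; exists M => i j; rewrite coef_poly; case: ltnP => _; last first.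
    exact: filt0.
  case: j => [|j] /=; first by apply: filt_le (By0 i) => //; rewrite /M /k; lia.
  by apply: filt_le (wpoly_coef FB i (wy j)) => //; nia.
exists q1, q2; split.
- apply: slice_inj => j; rewrite sliceM; under eq_bigr do rewrite q1E q2E.
  case: j => [|j]; first by rewrite big_ord1 x0 q0fg.
  rewrite -(big_mkord xpredT (fun i => (x i).1 * (x (j.+1 - i)%N).2)).
  rewrite big_ltn // big_nat_recr //= subnn subn0 x0 addrCA restE.
  by rewrite addrC subrK.
- by split=> //; rewrite monicE lead_coefE sq1 coef_poly prednK // leqnn top1.
- by split=> //; rewrite monicE lead_coefE sq2 coef_poly prednK // leqnn top2.
- apply: (tm (fun j => (x j).1)) => [i|j]; last by case: (wx j).
  by rewrite x0; case: (B1 i).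
- apply: (tm (fun j => (x j).2)) => [i|j]; last by case: (wx j).
  by rewrite x0; case: (B1 i).
Qed.

End Hensel.

(** * Stability of tame series and tame polynomials *)

Section TamePolynomials.
Variables (F : fieldType) (B : nat -> F -> Prop).
Hypothesis FB : filtration B.

Lemma tame_psmon a k : B 0%N a -> tame B (psmon a k).
Proof.
move=> Ba; exists 0%N => j; rewrite mul0n /=.
by case: eqP => _; [rewrite mulr1n | rewrite mulr0n; apply: filt0].
Qed.

Lemma tame_div k f : tame B f -> tame B (psdiv k f).
Proof.
case=> N Bf; exists (N * k.+1)%N => j; apply: filt_le (Bf (j + k)%N) => //.
by nia.
Qed.

Lemma tame_sub m f : tame B f -> tame B (pssub m f).
Proof.
case=> N Bf; exists N => j /=; case: ifP => _; last exact: filt0.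
by apply: filt_le (Bf (j %/ m)%N) => //; rewrite leq_mul // ltnS leq_div.
Qed.

Definition tamep : {pred pser F} := fun f => `[< tame B f >].

Fact tamep_subring : subring_closed tamep.
Proof.
split=> [|f g /asboolP[N Bf] /asboolP[M Bg] | f g /asboolP[N Bf] /asboolP[M Bg]];
  apply/asboolP.
- by apply: (tame_psmon (a := 1) 0); apply: filt1.
- exists (N + M)%N => j; apply: filtB => //.
    by apply: filt_le (Bf j) => //; rewrite mulnDl leq_addr.
  by apply: filt_le (Bg j) => //; rewrite mulnDl leq_addl.
- exists (N + M)%N => j; rewrite pcoefM; apply: filt_sum => // i _.
  apply: filt_le (filtM FB (Bf i) (Bg (j - i)%N)) => //.
  by have := ltn_ord i; nia.
Qed.

HB.instance Definition _ :=
  GRing.isSubringClosed.Build (pser F) tamep tamep_subring.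

Lemma tameE f : tame B f <-> f \in tamep.
Proof. by split=> /asboolP. Qed.

Lemma tameD f g : tame B f -> tame B g -> tame B (f + g).
Proof. by rewrite !tameE; apply: rpredD. Qed.

Lemma tameN f : tame B f -> tame B (- f).
Proof. by rewrite !tameE; apply: rpredNr. Qed.

Lemma tameM f g : tame B f -> tame B g -> tame B (f * g).
Proof. by rewrite !tameE; apply: rpredM. Qed.

Lemma tame_coef (q : {poly pser F}) i : tame_poly B q -> tame B q`_i.
Proof. by case=> N Bq; exists N. Qed.

Lemma tame_polyI (q : {poly pser F}) : (forall i, tame B q`_i) -> tame_poly B q.
Proof.
move=> Bq; suff [N BN] : exists N, forall i j, (i < size q)%N -> B (N * j.+1)%N (pcoef q`_i j).
  exists N => i j; have [/BN // | leqi] := ltnP i (size q).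
  by rewrite nth_default // pcoef0; apply: filt0.
elim: (size q) => [|d [N BN]]; first by exists 0%N.
have [M BM] := Bq d; exists (maxn M N) => i j.
rewrite ltnS leq_eqVlt => /predU1P[->|/(BN _ j)].
  by apply: filt_le (BM j) => //; rewrite leq_mul // leq_maxl.
by apply: filt_le => //; rewrite leq_mul // leq_maxr.
Qed.

Lemma tame_poly_shift (q : {poly pser F}) a : tame_poly B q -> tame B a ->
  tame_poly B (q \Po ('X + a%:P)).
Proof.
move=> Bq Ba; apply: tame_polyI => i; apply/tameE.
have /polyOverP : q \Po ('X + a%:P) \is a polyOver tamep; last exact.
apply: polyOver_comp; first by apply/polyOverP => k; apply/tameE/tame_coef.
by rewrite rpredD ?polyOverX // polyOverC; apply/tameE.
Qed.

End TamePolynomials.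

Lemma tame_mono (F : fieldType) (B B' : nat -> F -> Prop) f :
  (forall j x, B j x -> B' j x) -> tame B f -> tame B' f.
Proof. by move=> BB' [N Bf]; exists N => j; apply: BB'. Qed.

(** * Translation and scaling of the variable of a polynomial *)

Section PolynomialShift.
Variable R : comNzRingType.
Implicit Types (p q : {poly R}) (a : R).

Lemma coef_XaddC_exp a k i :
  (('X + a%:P) ^+ k)`_i = a ^+ (k - i) *+ 'C(k, i).
Proof.
elim: k i => [|k IHk] i; first by rewrite expr0 coef1 bin0n sub0n; case: i.
rewrite exprS mulrDl coefD coefXM coefCM !IHk; case: i => [|i] /=.
  by rewrite add0r !subn0 !bin0 !mulr1n exprS.
rewrite subSS binS mulrnDr addrC; congr (_ + _).
have [ltik | leki] := ltnP i k; last by rewrite bin_small ?mulr0n ?mulr0.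
by rewrite mulrnAr -exprS subnSK.
Qed.

Lemma coef_shift q a i : (q \Po ('X + a%:P))`_i =
  \sum_(k < size q) q`_k * (a ^+ (k - i) *+ 'C(k, i)).
Proof.
by rewrite coef_comp_poly; apply: eq_bigr => k _; rewrite coef_XaddC_exp.
Qed.

Lemma shift_monic q a d : q \is monic -> size q = d.+1 ->
  q \Po ('X + a%:P) \is monic /\ size (q \Po ('X + a%:P)) = d.+1.
Proof.
move=> q1 sq; set p := _ \Po _.
have pd : p`_d = 1.
  rewrite coef_shift sq big_ord_recr /= subnn binn mulr1n mulr1.
  rewrite big1 => [|k _]; last by rewrite bin_small ?mulr0n ?mulr0.
  by rewrite add0r -(monicP q1) lead_coefE sq.
have sp : size p = d.+1.
  apply/eqP; rewrite eqn_leq; apply/andP; split.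
    apply/leq_sizeP => i ltdi; rewrite coef_shift big1 // => k _.
    by rewrite bin_small ?mulr0n ?mulr0 //; apply: leq_trans ltdi; rewrite -sq.
  by rewrite ltnNge; apply/negP => /(nth_default 0)/eqP; rewrite pd oner_eq0.
by split=> //; rewrite monicE lead_coefE sp pd.
Qed.

Lemma shift_subleading q a d : q \is monic -> size q = d.+2 ->
  (q \Po ('X + a%:P))`_d = q`_d + a *+ d.+1.
Proof.
move=> q1 sq; rewrite coef_shift sq !big_ord_recr /=.
rewrite big1 => [|k _]; last by rewrite bin_small ?mulr0n ?mulr0.
have -> : q`_d.+1 = 1 by rewrite -(monicP q1) lead_coefE sq.
by rewrite add0r subnn binn mulr1n mulr1 mul1r subSnn expr1 binSn.
Qed.

(** Multiplies the roots by [t] without ever dividing by it; this undoes the change of slope in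
    [puiseux]. *)
Lemma prod_XsubC_scale (t : R) (s : seq R) :
  \prod_(f <- s) ('X - (t * f)%:P) = \poly_(i < (size s).+1)
    ((\prod_(f <- s) ('X - f%:P))`_i * t ^+ (size s - i)).
Proof.
elim: s => [|f s IHs].
  apply/polyP => i; rewrite !big_nil coef1 coef_poly coef1.
  by case: i => //=; rewrite mulr1.
rewrite !big_cons IHs; set r := \prod_(_ <- _) _.
have sr : size r = (size s).+1 by rewrite size_prod_XsubC.
apply/polyP => i; rewrite coef_poly !mulrBl !coefB !coefXM !coefCM !coef_poly /=.
case: i => [|i] /=.
  by rewrite !subn0 exprS !sub0r; ring.
rewrite !ltnS subSS; case: ltngtP => [ltis | ltsi | ->].
- by rewrite -(subnSK ltis) exprS; ring.
- by rewrite mulr0 subr0.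
- by rewrite [r`_(size s).+1]nth_default ?sr // !mulr0 !subr0.
Qed.

End PolynomialShift.

(** * The Newton-Puiseux theorem for tame polynomials *)

Lemma monic_size1 (R : nzRingType) (p : {poly R}) :
  p \is monic -> (size p <= 1)%N -> p = 1.
Proof.
by move=> /monicP p1 /size1_polyC pE; rewrite pE lead_coefC in p1; rewrite pE p1.
Qed.

Section Puiseux.
Variable F : fieldType.
Hypothesis F_closed :
  forall p : {poly F}, (1 < size p)%N -> exists x, root p x.
Hypothesis F_char0 : [pchar F] =i pred0.

(** Every residual factorization brings new elements of [F], so the filtration grows along the
    induction; [good] stands for a class of filtrations within which it can grow. *)
Variable good : (nat -> F -> Prop) -> Prop.
Hypothesis good_filt : forall B, good B -> filtration B.
Hypothesis good_ext : forall B x, good B ->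
  exists B', [/\ good B', forall j y, B j y -> B' j y & B' 1%N x].

Lemma good_ext_seq B (xs : seq F) : good B ->
  exists B', [/\ good B', forall j y, B j y -> B' j y &
    forall x, x \in xs -> B' 1%N x].
Proof.
elim: xs B => [|x xs IHxs] B gB; first by exists B.
have [B1 [gB1 BB1 B1x]] := good_ext x gB.
have [B2 [gB2 B12 B2xs]] := IHxs B1 gB1.
exists B2; split=> // [j y /BB1/B12 // | y].
by rewrite inE => /predU1P[-> | /B2xs //]; apply: B12.
Qed.

(** For a root $c$ of multiplicity $m$, the factor $(X - c)^m$ is coprime to its cofactor. If the
    cofactor were 1, the subleading coefficient would be $-(d + 1) c$; its vanishing gives $c = 0$
    in characteristic 0, hence $p = X^{d+1}$. *)
Lemma coprime_split (p : {poly F}) d : p \is monic -> size p = d.+2 ->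
    p`_d = 0 -> p != 'X^(d.+1) ->
  exists f g u v : {poly F}, [/\ f \is monic, g \is monic, p = f * g,
    u * f + v * g = 1 & (1 < size f)%N && (1 < size g)%N].
Proof.
move=> p1 sp pd pX; have [|c pc] := F_closed (p := p); first by rewrite sp.
have [m [g ngc pE]] := multiplicity_XsubC p c.
rewrite (monic_neq0 p1) /= in ngc.
have f1 : ('X - c%:P) ^+ m \is monic by rewrite monic_exp ?monicXsubC.
have g1 : g \is monic by move: p1; rewrite pE monicMr.
have m0 : (0 < m)%N.
  by rewrite lt0n; apply: contraNneq ngc => m0; rewrite pE m0 mulr1 in pc.
have sg : (1 < size g)%N.
  rewrite ltnNge; apply: contraNN pX => sg.
  move: pE; rewrite (monic_size1 g1 sg) mul1r => pE.
  have mE : m = d.+1 by move: sp; rewrite pE size_exp_XsubC => -[].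
  move: pd; rewrite pE mE -polyCN coef_XaddC_exp subSnn expr1 binSn => /eqP.
  rewrite -mulr_natr mulf_eq0 oppr_eq0 ((pcharf0P F).1 F_char0) // orbF => /eqP c0.
  by rewrite c0 oppr0 polyC0 addr0.
have : coprimep (('X - c%:P) ^+ m) g by rewrite coprimep_expl // coprimep_sym coprimep_XsubC.
move=> /Bezout_eq1_coprimepP[[u v] /= uv].
exists (('X - c%:P) ^+ m), g, u, v; split=> //; first by rewrite pE mulrC.
by rewrite size_exp_XsubC ltnS m0.
Qed.

(** The index [i] minimizes $\mathrm{ord}(p_k) / (d - k)$ and [u] is the order of $p_i$. After $T
    \mapsto T^{d-i}$ the order of $p_k$ becomes $(d - i)\,\mathrm{ord}(p_k) \ge u (d - k)$, so the
    slope is the integer [u]. *)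
Lemma newton_slope d (p : {poly pser F}) :
    (exists i, (i < d)%N && (p`_i != 0)) ->
  exists i u, [/\ (i < d)%N, pcoef p`_i u != 0 & forall k j, (k < d)%N ->
    (j < u * (d - k))%N -> pcoef (pssub (d - i) p`_k) j = 0].
Proof.
move=> [i0 /andP[ltid pi0]].
have [|ord ordP] := @choice nat nat (fun k o => p`_k != 0 ->
    pcoef p`_k o != 0 /\ forall j, (j < o)%N -> pcoef p`_k j = 0).
  move=> k; have [->|/pser_order[o ? ?]] := eqVneq p`_k 0; last by exists o.
  by exists 0%N; rewrite eqxx.
pose P (k : 'I_d) := p`_k != 0.
case: (@Order.TotalTheory.arg_minP _ rat _ (Ordinal ltid) P
  (fun k => (ord k)%:R / (d - k)%:R)) => //= i Pi imin.
exists i, (ord i); split=> //; first by case: (ordP _ Pi).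
move=> k j ltkd ltj /=; case: ifP => // /dvdnP[l jE].
have [->|pk] := eqVneq p`_k 0; first by rewrite pcoef0.
have [_] := ordP k pk; apply.
have di : (0 < d - i)%N by rewrite subn_gt0.
have := imin (Ordinal ltkd) pk; rewrite /= ler_pdivlMr ?ltr0n ?subn_gt0 //.
rewrite mulrAC ler_pdivrMr ?ltr0n // -!natrM ler_nat => le.
rewrite jE mulnK // -(ltn_pmul2r di); apply: leq_trans le.
by rewrite -jE.
Qed.

Lemma pssubS_comp m k (f : pser F) :
  pssubS m (pssubS k f) = pssubS (k.+1 * m.+1)%N.-1 f.
Proof. by rewrite /pssubS pssub_comp. Qed.

(** Induction on the degree: the Tschirnhausen transformation and the change of slope lead to a
    residual polynomial that [coprime_split] factors, and Hensel's lemma lifts this to two factors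
    of smaller degree. *)
Theorem puiseux B (q : {poly pser F}) :
    good B -> q \is monic -> tame_poly B q ->
  exists m B' (s : seq (pser F)), [/\ good B', forall j x, B j x -> B' j x,
    forall f, f \in s -> tame B' f &
    map_poly (pssubS m) q = \prod_(f <- s) ('X - f%:P)].
Proof.
have [d] := ubnP (size q); elim: d => // d IHd in B q *.
move=> /ltnSE sq gB q1 Bq; have FB := good_filt gB.
case Esq: (size q) sq => [|[|e]] sqd.
- by have := monic_neq0 q1; rewrite -size_poly_eq0 Esq.
- have -> : q = 1 by apply: monic_size1; rewrite ?Esq.
  by exists 0%N, B, [::]; split=> //; rewrite big_nil rmorph1.
have e1 : e.+1%:R != 0 :> F by rewrite ((pcharf0P F).1 F_char0).
pose a := - (q`_e * psmon (e.+1%:R^-1) 0).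
have Ba : tame B a.
  apply: tameN => //; apply: tameM => //; first exact: tame_coef.
  by apply: tame_psmon => //; apply: filt_invn.
set p := q \Po ('X + a%:P).
have [p1 sp] : p \is monic /\ size p = e.+2 by apply: shift_monic.
have pe : p`_e = 0.
  rewrite shift_subleading // /a mulNrn -mulrnAr.
  rewrite (_ : _ *+ e.+1 = 1) ?mulr1 ?subrr //; apply: pserP => j.
  rewrite -[LHS]/(pscoef j _) raddfMn /= /pscoef /=.
  by case: eqP => _; rewrite ?mul0rn // -[RHS](mulVf e1) mulr_natr.
have Bp : tame_poly B p by apply: tame_poly_shift.
have qE : q = p \Po ('X - a%:P) by rewrite comp_polyXaddC_K.
suff [m [B' [s [gB' BB' Bs pE]]]] : exists m B' (s : seq (pser F)),
    [/\ good B', forall j x, B j x -> B' j x,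
    forall f, f \in s -> tame B' f &
    map_poly (pssubS m) p = \prod_(f <- s) ('X - f%:P)].
  have FB' := good_filt gB'.
  exists m, B', [seq pssubS m a + f | f <- s]; split=> //.
    move=> _ /mapP[f /Bs Bf ->]; apply: tameD => //.
    by apply: tame_sub => //; apply: tame_mono Ba.
  rewrite qE map_comp_poly pE rmorphB /= map_polyX map_polyC big_map rmorph_prod.
  apply: eq_bigr => f _.
  by rewrite rmorphB /= comp_polyX comp_polyC rmorphD opprD addrA.
have [pX | /eqP pX] := eqVneq p 'X^(e.+1).
  exists 0%N, B, (nseq e.+1 0); split=> //.
    move=> f /nseqP[-> _]; exists 0%N => j; rewrite pcoef0; exact: filt0.
  by rewrite pX map_polyXn big_nseq subr0 iter_mulr_1.
have [i [u [ltie piu below]]] : exists i u, [/\ (i < e.+1)%N, pcoef p`_i u != 0 &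
    forall k j, (k < e.+1)%N -> (j < u * (e.+1 - k))%N ->
      pcoef (pssub (e.+1 - i) p`_k) j = 0].
  apply: newton_slope; apply: contrapT => nex; apply: pX; apply/polyP => k.
  rewrite coefXn; have [ltke | ltek | ->] := ltngtP k e.+1.
  - by apply/eqP; apply: contrapT => /negP pk; apply: nex; exists k; rewrite ltke.
  - by rewrite nth_default // sp.
  - by rewrite -(monicP p1) lead_coefE sp.
set v := (e.+1 - i)%N in below.
have v0 : (0 < v)%N by rewrite subn_gt0.
(* Formally $r(T, y) = T^{-u (e+1)} p(T^v, T^u y)$; the divisions by powers of $T$ are exact by
   [below]. *)
pose r := \poly_(k < e.+2) psdiv (u * (e.+1 - k)) (pssub v p`_k).
have rE k : (k <= e.+1)%N -> r`_k * psmon 1 (u * (e.+1 - k))%N = pssub v p`_k.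
  move=> leke; rewrite coef_poly ltnS leke psdivK // => j ltj.
  move: leke; rewrite leq_eqVlt => /predU1P[ke|]; last by move/below->.
  by rewrite ke subnn muln0 in ltj.
have re1 : r`_e.+1 = 1.
  have := rE e.+1 (leqnn _); rewrite subnn muln0.
  rewrite (_ : psmon 1 0 = 1) ?mulr1 => [->|]; last exact: pserP.
  rewrite (_ : p`_e.+1 = 1) ?(pssub_is_monoid _ v0).1 //.
  by rewrite -(monicP p1) lead_coefE sp.
have sr : size r = e.+2.
  apply/eqP; rewrite eqn_leq size_poly ltnNge.
  by apply/negP => /(nth_default 0)/eqP; rewrite re1 oner_eq0.
have r1 : r \is monic by rewrite monicE lead_coefE sr re1.
have [r01 sr0] := slice0_monic r1.
have [|||f [g [x [y [f1 g1 fg xyfg /andP[sf sg]]]]]] := coprime_split (d := e) r01.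
- by rewrite sr0.
- by rewrite coef_slice coef_poly ltnS leqnSn pe /= dvdn_addr // if_same.
(* The coefficient of index [i] of the residual polynomial is the coefficient of $T^u$ in $p_i$,
   which is not 0. *)
- apply: contraNneq piu => /(congr1 (fun h : {poly F} => h`_i)).
  rewrite coefXn (ltn_eqF ltie) coef_slice coef_poly ltnS (ltnW ltie) /= add0n.
  by rewrite dvdn_mull // mulnK // => ->.
have [B1 [gB1 BB1 B1xs]] := good_ext_seq (f ++ g ++ x ++ y : seq F) gB.
have FB1 := good_filt gB1.
have B1c (h : {poly F}) k : (forall z, z \in (h : seq F) -> z \in (f ++ g ++ x ++ y : seq F)) ->
    B1 1%N h`_k.
  move=> hin; have [/(mem_nth 0)/hin/B1xs // | lekh] := ltnP k (size h).
  by rewrite nth_default //; apply: filt0.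
have Br : tame_poly B1 r.
  apply: tame_polyI => // k; rewrite coef_poly; case: ifP => _.
    apply: tame_div => //; apply: tame_sub => //; apply: (tame_mono BB1).
    exact: tame_coef.
  by exists 0%N => j; rewrite pcoef0; apply: filt0.
have [|q1' [q2' [rqq [q1'1 sq1] [q2'1 sq2] Bq1 Bq2]]] :=
    hensel FB1 r1 Br f1 g1 fg xyfg.
  by move=> k; split; apply: B1c => z zin; rewrite !mem_cat zin ?orbT.
have sfg : (size f + size g = e.+3)%N.
  have sfg0 : (0 < size f + size g)%N by lia.
  by rewrite -(prednK sfg0) -size_mul ?monic_neq0 // -fg sr0 sr.
have [|m1 [B2 [s1 [gB2 B12 Bs1 q1E]]]] := IHd B1 q1' _ gB1 q1'1 Bq1.
  by rewrite sq1; lia.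
have FB2 := good_filt gB2.
(* The second factor is split over the filtration produced by the first, after the same
   substitution, so that the two lists of roots can be joined. *)
have [|||m2 [B3 [s2 [gB3 B23 Bs2 q2E]]]] := IHd B2 (map_poly (pssubS m1) q2') _ gB2.
- by apply: leq_ltn_trans (size_poly _ _) _; rewrite sq2; lia.
- exact: monic_map.
- apply: tame_polyI => // k; rewrite coef_map; apply: tame_sub => //.
  by apply: (tame_mono B12); apply: tame_coef.
have FB3 := good_filt gB3.
(* Since [pssubS m] substitutes $T^{m+1}$, composing two substitutions gives the predecessor of the
   product. *)
pose M := (m1.+1 * m2.+1)%N.-1; pose s := ([seq pssubS m2 f | f <- s1] ++ s2)%SEQ.
have rs : map_poly (pssubS M) r = \prod_(f <- s) ('X - f%:P).
  have -> : map_poly (pssubS M) r = map_poly (pssubS m2) (map_poly (pssubS m1) r).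
    by rewrite -map_poly_comp; apply: eq_map_poly => h /=; rewrite pssubS_comp.
  rewrite rqq !rmorphM /= q1E q2E big_cat /= big_map rmorph_prod; congr (_ * _).
  by apply: eq_bigr => h _; rewrite rmorphB /= map_polyX map_polyC.
have ss : size s = e.+1.
  apply: succn_inj; rewrite -(size_prod_XsubC s id) /= -rs size_map_poly_id0 ?sr //.
  by rewrite (monicP r1) rmorph1 oner_neq0.
(* The roots of $p(T^{v (M+1)}, y)$ are those of $r(T^{M+1}, y)$ multiplied by $T^{u (M+1)}$. *)
pose t : pser F := pssubS M (psmon 1 u).
exists (v * M.+1)%N.-1, B3, [seq t * f | f <- s]; split=> //.
- by move=> j z /BB1/B12/B23.
- move=> _ /mapP[h hs ->]; apply: tameM => //.
    by apply: tame_sub => //; apply: tame_psmon => //; apply: filt1.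
  move: hs; rewrite mem_cat => /orP[/mapP[h' /Bs1 Bh' ->] | /Bs2 //].
  by apply: tame_sub => //; apply: tame_mono Bh'.
rewrite big_map prod_XsubC_scale -rs ss; apply/polyP => k.
rewrite coef_map coef_poly coef_map /=; case: ltnP => [|ltek]; last first.
  by rewrite nth_default ?sp // raddf0.
rewrite ltnS => /rE; rewrite /pssubS prednK ?muln_gt0 ?v0 // -pssub_comp //.
by move=> <-; rewrite -/(pssubS M _) rmorphM /t -rmorphXn psmonX expr1n.
Qed.

End Puiseux.

(** * Adjoining elements of weight 1 to a filtration *)

Section Adjunction.
Variable F : fieldType.
Implicit Types B : nat -> F -> Prop.

Definition adjoin B z : nat -> F -> Prop :=
  fun j x => exists2 p, wpoly B j p & x = p.[z].

Lemma adjoin_sub B z j x : filtration B -> B j x -> adjoin B z j x.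
Proof.
move=> FB Bx; exists x%:P; last by rewrite hornerC.
move=> i; rewrite coefC; case: eqP => [->|_]; first by rewrite subn0.
by case: ifP => // _; apply: filt0.
Qed.

Lemma adjoin_gen B z : filtration B -> adjoin B z 1%N z.
Proof.
move=> FB; exists 'X; last by rewrite hornerX.
rewrite -['X]expr1 -[_ ^+ 1]scale1r -[X in wpoly _ X]add0n.
by apply: wpolyXn => //; apply: filt1.
Qed.

Lemma adjoin_filtration B z : filtration B -> filtration (adjoin B z).
Proof.
move=> FB; split.
- by move=> j; apply: adjoin_sub => //; apply: filt0.
- by apply: adjoin_sub => //; apply: filt1.
- by move=> d; apply: adjoin_sub => //; apply: filt_invn.
- move=> j _ _ [p wp ->] [q wq ->]; exists (p - q); first exact: wpolyB.
  by rewrite hornerD hornerN.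
- move=> i j _ _ [p wp ->] [q wq ->]; exists (p * q); first exact: wpolyM.
  by rewrite hornerM.
- by move=> i j _ leij [p wp ->]; exists p => //; apply: wpoly_le wp.
Qed.

Lemma adjoin_mono B B' z : (forall j x, B j x -> B' j x) ->
  forall j x, adjoin B z j x -> adjoin B' z j x.
Proof.
move=> BB' j _ [p wp ->]; exists p => // i; move: (wp i).
by case: ifP => // _; apply: BB'.
Qed.

Lemma adjoin_span B z (f : {poly F}) j x : filtration B ->
    f \is monic -> root f z -> (forall i, B 1%N f`_i) -> adjoin B z j x ->
  exists2 c : nat -> F, forall l, B j (c l) &
    x = \sum_(l < (size f).-1) c l * z ^+ l.
Proof.
move=> FB f1 fz Bf [p wp ->]; have wr := wpoly_mod FB f1 Bf wp.
exists (fun l => (p %% f)`_l) => [l|]; first exact: wpoly_coef wr.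
rewrite {1}(divp_eq p f) hornerD hornerM (rootP fz) mulr0 add0r.
apply: horner_coef_wide; rewrite -ltnS prednK ?ltn_modp ?monic_neq0 //.
by rewrite size_poly_gt0 monic_neq0.
Qed.

Definition adjoins B zs := foldr (fun z B' => adjoin B' z) B zs.

Lemma adjoins_filtration B zs : filtration B -> filtration (adjoins B zs).
Proof. by move=> FB; elim: zs => //= z zs; apply: adjoin_filtration. Qed.

Lemma adjoins_sub B zs j x : filtration B -> B j x -> adjoins B zs j x.
Proof.
move=> FB; elim: zs => //= z zs IHzs /IHzs.
by apply: adjoin_sub; apply: adjoins_filtration.
Qed.

Lemma adjoins_mono B B' zs : (forall j x, B j x -> B' j x) ->
  forall j x, adjoins B zs j x -> adjoins B' zs j x.
Proof. by move=> BB'; elim: zs => //= z zs; apply: adjoin_mono. Qed.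

End Adjunction.

(** * Subfields, and the relative algebraic closure in an algebraically closed field *)

Section Subfield.
Variables (K : fieldType) (S : divringClosed K).

Record subfld := Subfld { subfldval : K; subfldvalP : subfldval \in S }.

HB.instance Definition _ := [isSub for subfldval].
HB.instance Definition _ := [Choice of subfld by <:].
HB.instance Definition _ := [SubChoice_isSubIntegralDomain of subfld by <:].
HB.instance Definition _ := [SubIntegralDomain_isSubField of subfld by <:].

End Subfield.

Section AlgebraicElements.
Variables (F : fieldType) (L : closedFieldType) (j : {rmorphism F -> L}).

Definition algp : {pred L} := fun z => `[< algebraicOver j z >].

Fact algp_divring : divring_closed algp.
Proof.
split=> [|x y /asboolP ax /asboolP ay|x y /asboolP ax /asboolP ay]; apply/asboolP.
- exact: algebraic1.
- exact: algebraic_sub.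
- exact: algebraic_div.
Qed.

HB.instance Definition _ := GRing.isDivringClosed.Build L algp algp_divring.

Definition algsub : fieldType := subfld algp.

Definition algval : {rmorphism algsub -> L} := val.

Fact alg_in_subproof x : j x \in algp.
Proof. exact/asboolP/algebraic_id. Qed.

Definition alg_in x : algsub := Subfld (alg_in_subproof x).

Fact alg_in_is_zmod : zmod_morphism alg_in.
Proof. by move=> x y; apply: val_inj; rewrite /= rmorphB. Qed.
Fact alg_in_is_monoid : monoid_morphism alg_in.
Proof.
by split=> [|x y]; apply: val_inj; rewrite /= ?rmorph1 ?rmorphM.
Qed.
HB.instance Definition _ :=
  GRing.isZmodMorphism.Build F algsub alg_in alg_in_is_zmod.
HB.instance Definition _ :=
  GRing.isMonoidMorphism.Build F algsub alg_in alg_in_is_monoid.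

Lemma map_alg_in (p : {poly F}) :
  map_poly algval (map_poly alg_in p) = map_poly j p.
Proof. by rewrite -map_poly_comp; apply: eq_map_poly. Qed.

Lemma algsub_algebraic (z : algsub) : algebraicOver alg_in z.
Proof.
have /asboolP[p p0 pz] := subfldvalP z; exists p => //.
by rewrite -(fmorph_root algval) map_alg_in.
Qed.

(** A root in [L] of a polynomial with algebraic coefficients is itself algebraic over [F], by
    transitivity of integrality. *)
Lemma algsub_closed (p : {poly algsub}) : (1 < size p)%N -> exists x, root p x.
Proof.
move=> sp; have [|x px] := closed_rootP (map_poly algval p) _.
  by rewrite size_map_poly neq_ltn sp orbT.
suff ax : x \in algp by exists (Subfld ax : algsub); rewrite -(fmorph_root algval).
apply/asboolP/integral_algebraic; apply: (integral_root _ px).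
  by rewrite map_poly_eq0 -size_poly_gt0 ltnW.
move=> _ /(nthP 0)[i _ <-]; rewrite coef_map.
by have /asboolP := subfldvalP p`_i => /integral_algebraic.
Qed.

End AlgebraicElements.

(** * Primitive elements of finite extensions *)

Section PowerGenerator.
Variables (F E : fieldType) (j : {rmorphism F -> E}).
Hypothesis E_alg : forall z, algebraicOver j z.
Hypothesis E_closed :
  forall p : {poly E}, (1 < size p)%N -> exists x, root p x.
Hypothesis F_char0 : [pchar F] =i pred0.

(** Membership in $F[z]$, which is the field $F(z)$ when $z$ is algebraic. *)
Definition in_gen z w := exists q, (map_poly j q).[z] = w.

Lemma in_gen_trans x y z : in_gen z y -> in_gen y x -> in_gen z x.
Proof.
move=> [q <-] [p <-]; exists (p \Po q).
by rewrite map_comp_poly horner_comp.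
Qed.

(** Realizes $F(z)$ as a field type, so that the gcd in [power_generator] can be taken with
    coefficients in it. *)
Lemma in_genP z : exists (K : fieldType) (k : {rmorphism K -> E})
  (k' : {rmorphism F -> K}), k \o k' =1 j /\ forall w, in_gen z w <-> exists y, w = k y.
Proof.
have [p p0 pz] := E_alg z.
exists (subFExtend j z p), (subfx_inj : {rmorphism subFExtend j z p -> E}).
exists (inj_subfx j z p : {rmorphism F -> subFExtend j z p}); split=> [x | w].
  by rewrite /= subfx_inj_eval // map_polyC hornerC.
split=> [[q <-] | [y ->]]; first by exists (subfx_eval j z p q); rewrite /= subfx_inj_eval.
by have [q ->] := subfxE y; exists q; rewrite /= subfx_inj_eval.
Qed.

Lemma minimal_poly z : exists f : {poly F}, [/\ f \is monic, root (map_poly j f) z &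
  forall q, root (map_poly j q) z -> (size q < size f)%N -> q = 0].
Proof.
pose P d := `[< exists2 f : {poly F}, f \is monic /\ root (map_poly j f) z & size f = d >].
have exP : exists d, P d.
  have [f f1 fz] := (integral_algebraic j z).1 (E_alg z).
  by exists (size f); apply/asboolP; exists f.
case: (ex_minnP exP) => d /asboolP[f [f1 fz] <-] dmin; exists f; split=> // q qz.
apply: contraTeq => q0; rewrite -leqNgt; apply: dmin; apply/asboolP.
exists ((lead_coef q)^-1 *: q); last by rewrite size_scale ?invr_eq0 ?lead_coef_eq0.
split; first by rewrite monicE lead_coefZ mulVf ?lead_coef_eq0.
by rewrite linearZ rootE hornerZ (rootP qz) mulr0.
Qed.

Lemma finite_roots (p : {poly E}) : p != 0 ->
  exists rs : seq E, forall x, root p x -> x \in rs.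
Proof.
have [d] := ubnP (size p); elim: d p => // d IHd p /ltnSE sp p0.
have [[x px] | nx] := pselect (exists x, root p x); last first.
  by exists [::] => x px; case: nx; exists x.
have /factor_theorem[q pE] := px.
have q0 : q != 0 by apply: contraNneq p0 => q0; rewrite pE q0 mul0r.
have [|rs rsP] := IHd q _ q0.
  by move: sp; rewrite pE size_Mmonic ?monicXsubC // size_XsubC addn2.
exists (x :: rs) => y; rewrite pE rootM root_XsubC inE orbC => /orP[-> //|/rsP->].
by rewrite orbT.
Qed.

Lemma E_natr_eq0 k : (k%:R == 0 :> E) = (k == 0)%N.
Proof. by rewrite -(rmorph_nat j) fmorph_eq0 ((pcharf0P F).1 F_char0). Qed.

Lemma natr_nonroot (p : {poly E}) : p != 0 -> exists k : nat, ~~ root p k%:R.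
Proof.
move=> p0; apply: contrapT => nk.
have := max_poly_roots p0 (rs := mkseq (fun k => k%:R) (size p)).
rewrite size_mkseq ltnn => H; suff : false by []; apply: H.
  apply/allP => _ /mapP[k _ ->]; apply: contrapT => /negP pk.
  by apply: nk; exists k.
rewrite mkseq_uniq // => k l /eqP kl; apply/eqP.
wlog lekl : k l kl / (k <= l)%N.
  by move=> W; case: (leqP k l) => [|/ltnW] le; [|rewrite eq_sym]; apply: W;
    rewrite // eq_sym.
move: kl; rewrite eq_sym -subr_eq0 -natrB // E_natr_eq0 subn_eq0 => lelk.
by rewrite eqn_leq lekl.
Qed.

(** The primitive element theorem in characteristic 0, adding one element at a time. *)
Lemma generator (ws : seq E) : exists z, forall w, w \in ws -> in_gen z w.
Proof.
elim: ws => [|w ws [z zP]]; first by exists 0.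
have [p p0 pw] := E_alg w; have [q q0 qz] := E_alg z.
have [k [zw zz]] := pchar0_PET p0 pw q0 qz F_char0.
exists (z *+ k - w) => x; rewrite inE => /predU1P[->//|/zP].
exact: in_gen_trans.
Qed.

(* For all but finitely many c, the element (z + c) ^ m differs from (r + c) ^ m
   for the other conjugates r of z; then z is the only common root of its minimal
   polynomial and of (X + c) ^ m - (z + c) ^ m, hence is rational over
   F((z + c) ^ m). *)
Lemma power_generator (ws : seq E) m : (0 < m)%N ->
  exists2 s, s != 0 & in_gen (s ^+ m) s^-1 /\
    forall w, w \in ws -> in_gen (s ^+ m) w.
Proof.
move=> m0; have [z zP] := generator ws.
have [f [f1 fz fmin]] := minimal_poly z; set fE := map_poly j f in fz.
have fE0 : fE != 0 by rewrite map_poly_eq0 monic_neq0.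
(* Separability: in characteristic 0 the derivative of [f] is non-zero, and its degree is too small
   for it to vanish at [z]. *)
have f'z : ~~ root fE^`() z.
  rewrite /fE deriv_map; apply: contraTN isT => /fmin f'0.
  have sf : (1 < size f)%N.
    rewrite ltnNge; apply: contraL fz => sf.
    by rewrite /fE (monic_size1 f1 sf) rmorph1 root1.
  have {}f'0 := f'0 (lt_size_deriv (monic_neq0 f1)).
  have := congr1 (fun p : {poly F} => p`_(size f).-2) f'0.
  rewrite coef_deriv coef0 -[_.-2.+1](_ : (size f).-1 = _); last by case: (size f) sf => [|[]].
  rewrite -lead_coefE (monicP f1) => /eqP; rewrite ((pcharf0P F).1 F_char0).
  by case: (size f) sf => [|[]].
have [rs rsP] := finite_roots fE0.
(* The variable plays the role of $c$. The coefficient of index $m - 1$ of [G r] is $m (r - z)$; a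
   natural number that is not a root of [H] below separates the powers and keeps $z + c$
   non-zero. *)
pose G r : {poly E} := ('X + r%:P) ^+ m - ('X + z%:P) ^+ m.
have G0 r : r != z -> G r != 0.
  apply: contraNneq => /(congr1 (fun p : {poly E} => p`_m.-1)).
  rewrite coefB !coef_XaddC_exp coef0 -(prednK m0) /= subSnn !expr1 binSn.
  rewrite -mulrnBl -mulr_natr => /eqP; rewrite mulf_eq0 E_natr_eq0 orbF.
  by rewrite subr_eq0.
pose H : {poly E} := ('X + z%:P) * \prod_(r <- rs | r != z) G r.
have H0 : H != 0.
  apply: mulf_neq0; first by rewrite monic_neq0 ?monicXaddC.
  by rewrite prodf_seq_neq0; apply/allP => r _; apply/implyP/G0.
have [c] := natr_nonroot H0.
rewrite rootM negb_or -[z%:P]opprK -polyCN root_XsubC => /andP[cz cG].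
have {cG}Gc r : root fE r -> (r + c%:R) ^+ m = (z + c%:R) ^+ m -> r = z.
  move=> /rsP rrs rc; apply/eqP; apply: contraTT cG => rz.
  rewrite negbK rootE horner_prod prodf_seq_eq0; apply/hasP; exists r => //=.
  by rewrite rz /G !hornerE [c%:R + r]addrC [c%:R + z]addrC rc subrr.
pose s := z + c%:R; have s0 : s != 0 by rewrite /s addrC addr_eq0.
exists s => //; have [K [k [k' [kk' inK]]]] := in_genP (s ^+ m).
have [y0 y0E] : exists y, s ^+ m = k y.
  by apply/inK; exists 'X; rewrite map_polyX hornerX.
pose g := gcdp (map_poly k' f) (('X + c%:R%:P) ^+ m - y0%:P).
have gE : map_poly k g = gcdp fE (('X + c%:R%:P) ^+ m - (s ^+ m)%:P).
  rewrite gcdp_map rmorphB rmorphXn rmorphD /= map_polyX !map_polyC /= -y0E.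
  by rewrite rmorph_nat -map_poly_comp (eq_map_poly kk').
have gz : root (map_poly k g) z.
  by rewrite gE root_gcd fz rootE !hornerE /s subrr.
have g0 : map_poly k g != 0.
  by rewrite gE gcdp_eq0 (negbTE fE0).
have gr r : root (map_poly k g) r -> r = z.
  rewrite gE root_gcd => /andP[/Gc + ]; rewrite rootE !hornerE /= subr_eq0 => H1 /eqP H2.
  exact: H1.
(* A further root of [g] would again be [z], making it a double root of [fE], against [f'z]. Being
   linear over [K], [g] has its root in [K]. *)
have sg : size g = 2%N.
  rewrite -(size_map_poly k); have /factor_theorem[h hE] := gz.
  have h0 : h != 0 by apply: contraNneq g0 => h0; rewrite hE h0 mul0r.
  rewrite hE size_Mmonic ?monicXsubC // size_XsubC addn2 /=.
  have [lesh | ltsh] := leqP (size h) 1.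
    by apply/eqP; rewrite eqSS eqn_leq lesh size_poly_gt0.
  have [r hr] := E_closed ltsh.
  have rz : r = z by apply: gr; rewrite hE rootM hr.
  case/negP: f'z; have : map_poly k g %| fE by rewrite gE dvdp_gcdl.
  move: hr; rewrite hE rz => /factor_theorem[h' ->] /dvdpP[h'' ->].
  by rewrite !derivM derivXsubC rootE !hornerE subrr /= !(mulr0, mul0r, addr0).
have imz : exists y, z = k y.
  have := rootP gz; rewrite (@horner_coef_wide _ 2) ?size_map_poly ?sg //.
  rewrite big_ord_recl big_ord1 /= expr0 mulr1 expr1 !coef_map => /eqP.
  have g1 : k g`_1 != 0.
    by rewrite fmorph_eq0 -[1%N]/(2.-1) -sg -lead_coefE lead_coef_eq0 -size_poly_eq0 sg.
  rewrite addr_eq0 => /eqP g0E; exists (- (g`_0 / g`_1)).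
  by rewrite rmorphN fmorph_div g0E mulNr opprK mulrAC mulfV ?mul1r.
have [y zE] := imz.
split; first by apply/inK; exists (y + c%:R)^-1; rewrite fmorphV rmorphD rmorph_nat -zE.
by move=> w /zP; apply: in_gen_trans; apply/inK; exists y.
Qed.

End PowerGenerator.

(** * The field of homogeneous fractions of degree 0 *)

Lemma divf_expand (K : fieldType) (x y z : K) : z != 0 -> x / y = x * z / (y * z).
Proof. by move=> z0; rewrite -mulf_div divff ?mulr1. Qed.

Section DegreeZero.
Variables (n : nat) (C : fieldType).
Local Notation Cx := {fraction {mpoly C[n]}}.

Lemma homfrac_div k l (F G : Cx) : homfrac (k + l) F -> homfrac l G -> G != 0 ->
  homfrac k (F / G).
Proof.
case=> j [a] [b] [ha hb b0 ->] [j'] [a'] [b'] [ha' hb' b'0 ->] G0.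
have a'0 : a' != 0.
  by apply: contraNneq G0 => ->; rewrite rmorph0 mul0r.
exists (j + (j' + l))%N, (a * b'), (b * a'); split.
- have -> : (j + (j' + l) + k = j + (k + l) + j')%N by lia.
  exact: dhomogM.
- exact: dhomogM.
- by rewrite mulf_neq0.
- by rewrite invf_div mulf_div !rmorphM.
Qed.

Definition deg0p : {pred Cx} := fun F => `[< homfrac 0 F >].

Fact deg0p_divring : divring_closed deg0p.
Proof.
split=> [|F G /asboolP hF /asboolP hG|F G /asboolP hF /asboolP hG]; apply/asboolP.
- by have := v1_subproof n C 0; rewrite eqxx.
- by apply: homfracD => //; apply: homfracN.
- have [->|G0] := eqVneq G 0; first by rewrite invr0 mulr0; apply: homfrac0.
  exact: (@homfrac_div 0 0).
Qed.

HB.instance Definition _ := GRing.isDivringClosed.Build Cx deg0p deg0p_divring.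

Definition deg0 : fieldType := subfld deg0p.

Definition deg0val : {rmorphism deg0 -> Cx} := val.

Lemma homfrac_deg0 (x : deg0) : homfrac 0 (deg0val x).
Proof. by have /asboolP := subfldvalP x. Qed.

Lemma deg0_char0 : [pchar C] =i pred0 -> [pchar deg0] =i pred0.
Proof.
move=> C0 p; rewrite -(fmorph_pchar deg0val).
by rewrite (fmorph_pchar (@FracField.tofrac _ \o @mpolyC n C)) C0.
Qed.

(* d is meant to be the degree of h. *)
Definition hden (h : {mpoly C[n]}) d j (x : deg0) :=
  exists2 a : {mpoly C[n]}, a \is (j * d).-homog & deg0val x = a%:F / h%:F ^+ j.

Section FixedDenominator.
Variables (h : {mpoly C[n]}) (d : nat).
Hypotheses (h0 : h != 0) (hh : h \is d.-homog).

Let hF0 : h%:F != 0. Proof. by rewrite tofrac_eq0. Qed.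

Lemma hden_le i j x : (i <= j)%N -> hden h d i x -> hden h d j x.
Proof.
move=> leij [a ha xE]; exists (a * h ^+ (j - i)).
  by rewrite -(subnKC leij) mulnDl addKn; apply: dhomogM => //; rewrite mulnC dhomogMn.
rewrite xE -{2}(subnKC leij) exprD rmorphM rmorphXn.
exact/divf_expand/expf_neq0.
Qed.

Lemma hdenB j x y : hden h d j x -> hden h d j y -> hden h d j (x - y).
Proof.
move=> [a ha xE] [b hb yE]; exists (a - b); first exact: rpredB.
by rewrite rmorphB xE yE rmorphB mulrBl.
Qed.

Lemma hdenM i j x y : hden h d i x -> hden h d j y -> hden h d (i + j)%N (x * y).
Proof.
move=> [a ha xE] [b hb yE]; exists (a * b).
  by rewrite mulnDl; apply: dhomogM.
by rewrite rmorphM xE yE mulf_div rmorphM exprD.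
Qed.

Lemma hden_filtration : filtration (hden h d).
Proof.
split; [| | | exact: hdenB | exact: hdenM | exact: hden_le].
- by move=> j; exists 0; rewrite ?dhomog0 // !rmorph0 mul0r.
- by exists 1; rewrite ?mul0n ?dhomog1 // !rmorph1 expr0 divr1.
- move=> k; exists (k.+1%:R^-1)%:MP.
    by rewrite mul0n -[_%:MP]mulr1 mul_mpolyC dhomogZ // dhomog1.
  rewrite expr0 divr1 fmorphV rmorph_nat /=.
  by rewrite -[RHS]/((@FracField.tofrac _ \o @mpolyC n C) _) fmorphV rmorph_nat.
Qed.

Lemma hden_mulr g e j x : g != 0 -> g \is e.-homog ->
  hden h d j x -> hden (h * g) (d + e) j x.
Proof.
move=> g0 hg [a ha xE]; exists (a * g ^+ j).
  by rewrite mulnDr; apply: dhomogM => //; rewrite mulnC dhomogMn.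
rewrite xE rmorphM rmorphXn rmorphM exprMn; apply: divf_expand.
by apply: expf_neq0; rewrite tofrac_eq0.
Qed.

End FixedDenominator.

Lemma common_denominator (xs : seq deg0) : exists g e,
  [/\ g != 0, g \is e.-homog & forall x, x \in xs -> hden g e 1 x].
Proof.
elim: xs => [|x xs [g [e [g0 hg gxs]]]].
  by exists 1, 0%N; rewrite oner_neq0 dhomog1.
have [j [a [b [ha hb b0 xE]]]] := homfrac_deg0 x.
exists (b * g), (j + e)%N; split; [by rewrite mulf_neq0 | exact: dhomogM |].
move=> y; rewrite inE => /predU1P[->|/gxs]; last first.
  by rewrite mulrC addnC; apply: hden_mulr.
apply: hden_mulr => //; exists a; first by rewrite mul1n -[j]addn0.
by rewrite expr1.
Qed.

End DegreeZero.

Arguments deg0val {n C}.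

(** * Filtrations of algebraic extensions of the field of degree 0 fractions *)

Section GoodFiltrations.
Variables (n : nat) (C : fieldType) (E : fieldType).
Variable f : {rmorphism deg0 n C -> E}.
Hypothesis E_alg : forall z, algebraicOver f z.

Definition base h d : nat -> E -> Prop :=
  fun j x => exists2 y, hden h d j y & x = f y.

Lemma base_filtration h d : h != 0 -> h \is d.-homog -> filtration (base h d).
Proof.
move=> h0 hh; have FB := hden_filtration h0 hh; split.
- by move=> j; exists 0; [exact: filt0 | rewrite rmorph0].
- by exists 1; [exact: filt1 | rewrite rmorph1].
- by move=> k; exists k.+1%:R^-1; [exact: filt_invn | rewrite fmorphV rmorph_nat].
- by move=> j _ _ [x hx ->] [y hy ->]; exists (x - y); [exact: filtB|rewrite rmorphB].
- by move=> i j _ _ [x hx ->] [y hy ->]; exists (x * y); [exact: filtM|rewrite rmorphM].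
- by move=> i j _ le [x hx ->]; exists x => //; apply: filt_le hx.
Qed.

(** Coefficients of weight 1 are what [adjoin_span] needs in order to reduce the powers of [z]. *)
Definition integral_den h d (z : E) := exists p : {poly deg0 n C},
  [/\ p \is monic, root (map_poly f p) z & forall i, hden h d 1 p`_i].

Definition good (B : nat -> E -> Prop) := exists h d zs,
  [/\ h != 0, h \is d.-homog, forall z, z \in zs -> integral_den h d z &
      B = adjoins (base h d) zs].

Lemma good_filtration B : good B -> filtration B.
Proof.
by move=> [h [d [zs [h0 hh _ ->]]]]; apply/adjoins_filtration/base_filtration.
Qed.

(** If [g] is a common denominator of the coefficients of an equation of [x], replacing [h] by
    [h * g] gives these coefficients weight 1 and preserves the earlier equations. *)
Lemma good_extension B x : good B ->
  exists B', [/\ good B', forall j y, B j y -> B' j y & B' 1%N x].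
Proof.
move=> [h [d [zs [h0 hh zsP BE]]]].
have [p p1 px] := (integral_algebraic f x).1 (E_alg x).
have [g [e [g0 hg gp]]] := common_denominator p.
have hg0 : h * g != 0 by rewrite mulf_neq0.
have hhg : h * g \is (d + e).-homog by apply: dhomogM.
have FB := base_filtration hg0 hhg.
exists (adjoins (base (h * g) (d + e)) (x :: zs)); split.
- exists (h * g), (d + e)%N, (x :: zs); split=> // z.
  rewrite inE => /predU1P[->|/zsP[q [q1 qz hq]]]; last first.
    by exists q; split=> // i; apply: hden_mulr.
  exists p; split=> // i; have [/(mem_nth 0)/gp|leip] := ltnP i (size p).
    by rewrite mulrC addnC; apply: hden_mulr.
  by rewrite nth_default //; apply: (filt0 (hden_filtration hg0 hhg) 1).
- move=> j y; rewrite BE => By /=; apply: adjoin_sub; first exact: adjoins_filtration.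
  apply: adjoins_mono By => {y}i y [u hu ->]; exists u => //.
  exact: hden_mulr.
- by apply: adjoin_gen; apply: adjoins_filtration.
Qed.

(* Reducing the powers of the generators modulo their equations does not raise
   the exponent of h, thanks to the weights in wpoly. *)
Lemma good_span B : good B -> exists h d (I : finType) (w : I -> E),
  [/\ h != 0, h \is d.-homog & forall j x, B j x ->
    exists2 c : I -> deg0 n C, forall l, hden h d j (c l) &
      x = \sum_l f (c l) * w l].
Proof.
move=> [h [d [zs [h0 hh zsP ->]]]]; exists h, d.
have FB := base_filtration h0 hh.
elim: zs zsP => [|z zs IHzs] zsP.
  exists unit, (fun=> 1); split=> // j _ [y hy ->]; exists (fun=> y) => //.
  by rewrite (big_pred1 tt) ?mulr1 // => -[].
have [|I [w [_ _ wP]]] := IHzs.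
  by move=> y yzs; apply: zsP; rewrite inE yzs orbT.
have [p [p1 pz hp]] := zsP z (mem_head _ _).
pose e := (size (map_poly f p)).-1.
exists (I * 'I_e)%type, (fun u : I * 'I_e => w u.1 * z ^+ u.2).
split=> // j x /= /(adjoin_span (f := map_poly f p)) [||||c Bc ->].
- exact: adjoins_filtration.
- exact: monic_map.
- exact: pz.
- by move=> i; apply: adjoins_sub => //; exists p`_i; rewrite ?coef_map.
have [|b bP] := @choice nat (I -> deg0 n C) (fun l b => (forall i, hden h d j (b i)) /\
  c l = \sum_i f (b i) * w i).
  by move=> l; have [b hb bE] := wP _ _ (Bc l); exists b.
exists (fun u : I * 'I_e => b u.2 u.1) => [[i l]|]; first by case: (bP l).
rewrite -(pair_bigA _ (fun i (l : 'I_e) => f (b l i) * (w i * z ^+ l))) exchange_big /=.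
apply: eq_bigr => l _; have [_ ->] := bP l; rewrite mulr_suml.
by apply: eq_bigr => i _; rewrite mulrA.
Qed.

End GoodFiltrations.

(** * Dehomogenization of the completed valuation ring *)

Lemma deg0val_inj n (C : fieldType) : injective (@deg0val n C).
Proof. exact: val_inj. Qed.

Lemma mhcomp_dhomog n (C : fieldType) k l (a : {mpoly C[n]}) : a \is k.-homog ->
  mhcomp l (mseries_of_mpoly a) = a *+ (l == k).
Proof.
move=> ha; apply/mpolyP => u; rewrite mcoeff_mhcomp mcoeffMn /=.
have [ulk|ne] := eqVneq (mdeg u) k.
  by rewrite ulk eq_sym; case: eqP; rewrite ?mulr1n ?mulr0n.
by rewrite (dhomog_nemf_coeff ha) // mul0rn if_same.
Qed.

Section Dehomogenization.
Variables (n : nat) (C : fieldType).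
Local Notation Cx := {fraction {mpoly C[n.+1]}}.

Definition tvar : {mpoly C[n.+1]} := 'X_ord0.

Lemma tvar_homog : tvar \is 1.-homog.
Proof. by rewrite dhomogX; apply/eqP/mdeg1. Qed.

Lemma tvar_neq0 : tvar != 0.
Proof. by rewrite -msupp_eq0 msuppX. Qed.

Lemma tvarF_neq0 : tvar%:F != 0. Proof. by rewrite tofrac_eq0 tvar_neq0. Qed.

Lemma homfrac_tvar k : homfrac k (tvar%:F ^+ k : Cx).
Proof.
rewrite -rmorphXn; apply: homfrac_mpoly; rewrite -[k in X in X.-homog]mul1n.
exact: dhomogMn tvar_homog.
Qed.

(* insubd 0 is harmless: this is only used for x homogeneous of degree k. *)
Definition dehom k (x : Cx) : deg0 n.+1 C :=
  insubd (0 : deg0 n.+1 C) (x / tvar%:F ^+ k).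

Lemma val_dehom k x : homfrac k x -> deg0val (dehom k x) = x / tvar%:F ^+ k.
Proof.
move=> hx; rewrite /deg0val /= insubdK //; apply/asboolP.
apply: (homfrac_div _ (homfrac_tvar k)); first by rewrite add0n.
exact/expf_neq0/tvarF_neq0.
Qed.

Lemma homfrac_rehom k (x : deg0 n.+1 C) : homfrac k (deg0val x * tvar%:F ^+ k).
Proof. by rewrite -[k in homfrac k]add0n; apply: homfracM (homfrac_deg0 x) (homfrac_tvar k). Qed.

Lemma dehomK k x : dehom k (deg0val x * tvar%:F ^+ k) = x.
Proof.
apply: deg0val_inj; rewrite val_dehom ?mulfK //; last exact: homfrac_rehom.
exact/expf_neq0/tvarF_neq0.
Qed.

Lemma dehom_eq0 k x : homfrac k x -> dehom k x = 0 -> x = 0.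
Proof.
move=> hx /(congr1 deg0val); rewrite val_dehom // rmorph0 => /eqP.
by rewrite mulf_eq0 invr_eq0 expf_eq0 (negbTE tvarF_neq0) andbF orbF => /eqP.
Qed.

Lemma dehomB k x y : homfrac k x -> homfrac k y ->
  dehom k (x - y) = dehom k x - dehom k y.
Proof.
move=> hx hy; apply: deg0val_inj; rewrite rmorphB !val_dehom ?mulrBl //.
by apply: homfracD => //; apply: homfracN.
Qed.

Lemma dehomM k l x y : homfrac k x -> homfrac l y ->
  dehom (k + l) (x * y) = dehom k x * dehom l y.
Proof.
move=> hx hy; apply: deg0val_inj; rewrite rmorphM !val_dehom ?mulf_div ?exprD //.
exact: homfracM.
Qed.

Lemma dehom0 k : dehom k 0 = 0.
Proof.
apply: deg0val_inj; rewrite val_dehom ?mul0r ?rmorph0 //; exact: homfrac0.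
Qed.

Lemma dehom_sum k (I : Type) (r : seq I) (P : pred I) (x : I -> Cx) :
    (forall i, P i -> homfrac k (x i)) ->
  dehom k (\sum_(i <- r | P i) x i) = \sum_(i <- r | P i) dehom k (x i).
Proof.
move=> hx; have hs : homfrac k (\sum_(i <- r | P i) x i).
  by apply: big_ind => //; [apply: homfrac0 | move=> ? ?; apply: homfracD].
apply: deg0val_inj; rewrite val_dehom // rmorph_sum mulr_suml.
by apply: eq_bigr => i Pi; rewrite val_dehom //; apply: hx.
Qed.

Section SeriesOfVhat.
Variables (E : fieldType) (f : {rmorphism deg0 n.+1 C -> E}).

(** Sends $\sum_k F_k$ to $\sum_k (F_k / t^k) T^k$, so that the degree of a component becomes the
    exponent of $T$. *)
Definition vhat_series (A : vhat n.+1 C) : pser E :=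
  PSer (fun k => f (dehom k (vcomp A k))).

Fact vhat_series_is_zmod : zmod_morphism vhat_series.
Proof.
move=> A B; apply: pserP => k /=.
by rewrite -rmorphB -dehomB //; apply: vcompP.
Qed.

Fact vhat_series_is_monoid : monoid_morphism vhat_series.
Proof.
split=> [|A B]; apply: pserP => k.
  rewrite /= -(rmorph_nat f); congr (f _); apply: deg0val_inj.
  rewrite val_dehom; last exact: v1_subproof.
  by rewrite rmorph_nat; case: k => [|k]; rewrite ?divr1 // mul0r.
rewrite pcoefM /= dehom_sum => [|i _]; last first.
  by have := homfracM (vcompP A i) (vcompP B (k - i)); rewrite subnKC // -ltnS.
rewrite rmorph_sum; apply: eq_bigr => i _; rewrite -rmorphM -dehomM; try exact: vcompP.
by rewrite subnKC // -ltnS.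
Qed.

HB.instance Definition _ := GRing.isZmodMorphism.Build (vhat n.+1 C) (pser E)
  vhat_series vhat_series_is_zmod.
HB.instance Definition _ := GRing.isMonoidMorphism.Build (vhat n.+1 C) (pser E)
  vhat_series vhat_series_is_monoid.

Lemma vhat_series_homog k (a : {mpoly C[n.+1]}) : a \is k.-homog ->
  vhat_series (vhat_of_mpoly a) = psmon (f (dehom k a%:F)) k.
Proof.
move=> ha; apply: pserP => l; rewrite /= (mhcomp_dhomog l ha).
have [->|_] := eqVneq l k; first by rewrite !mulr1n.
by rewrite !mulr0n rmorph0 dehom0 rmorph0.
Qed.

End SeriesOfVhat.

End Dehomogenization.

(** * Construction of the homogeneous generator *)

(** Integrality in [homogeneous_generator] rests on this: one factor $y$ of $(y / t^e)^{m k}$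
    cancels the denominator, and $t^{(m e + 1) k}$ cancels $t^{e m k}$, leaving $t^k$. *)
Lemma clear_denominator (K : fieldType) (x y t : K) m e k :
    y != 0 -> t != 0 -> (0 < m * k)%N ->
  x / y * (y / t ^+ e) ^+ (m * k) * t ^+ ((m * e).+1 * k) =
  x * y ^+ (m * k).-1 * t ^+ k.
Proof.
move=> y0 t0 mk0; rewrite -{1}(prednK mk0) exprS expr_div_n -!exprM mulSn exprD.
have -> : (m * e * k = e * (m * k).-1 + e)%N.
  by rewrite -[X in (_ + X)%N]muln1 -mulnDr addn1 prednK // mulnAC mulnC.
rewrite !exprD; have := expf_neq0 e t0; have := expf_neq0 (e * (m * k).-1) t0.
move: (t ^+ e) (t ^+ (e * _)) (t ^+ k) (y ^+ _) => t1 t2 t3 y1 t20 t10.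
by field; rewrite t20 t10 y0.
Qed.

Section HomogeneousGenerator.
Variables (n : nat) (C E : fieldType) (f : {rmorphism deg0 n.+1 C -> E}).
Hypothesis C_char0 : [pchar C] =i pred0.
Hypothesis E_alg : forall z, algebraicOver f z.
Hypothesis E_closed :
  forall p : {poly E}, (1 < size p)%N -> exists x, root p x.

Lemma in_gen_scale z x (a b : deg0 n.+1 C) : b != 0 -> in_gen f z x ->
  in_gen f (f b * z) (f a * x).
Proof.
move=> b0 [q <-]; exists (a *: (q \Po (b^-1 *: 'X))).
rewrite map_polyZ map_comp_poly map_polyZ map_polyX hornerZ horner_comp hornerZ.
by rewrite hornerX fmorphV mulKf ?fmorph_eq0.
Qed.

(* After multiplication by b / t ^ e, where b is a common denominator of degree
   e of the coefficients of the minimal equation of s ^ m over C(x)_0, the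
   element s T ^ (m e + 1) with T ^ m = t becomes integral over C[x]. *)
Lemma homogeneous_generator (ws : seq E) m : (0 < m)%N ->
  exists s e (D : {poly deg0 n.+1 C}),
    [/\ s != 0, in_gen f (s ^+ m) s^-1 & forall w, w \in ws -> in_gen f (s ^+ m) w] /\
    [/\ D \is monic, root (map_poly f D) (s ^+ m),
      forall q, root (map_poly f q) (s ^+ m) -> (size q < size D)%N -> q = 0 &
      forall i, exists2 a : {mpoly C[n.+1]},
        a \is ((m * e).+1 * ((size D).-1 - i)).-homog &
        deg0val D`_i * (tvar n C)%:F ^+ ((m * e).+1 * ((size D).-1 - i)) = a%:F].
Proof.
move=> m0; have K_char0 := @deg0_char0 n.+1 C C_char0.
have [s0 s00 [s0V wsP]] := power_generator E_alg E_closed K_char0 ws m0.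
have [D0 [D01 D0s D0min]] := minimal_poly E_alg (s0 ^+ m).
have [b [e [b0 hb bD]]] := common_denominator D0.
pose beta := dehom e b%:F.
have betaE : deg0val beta = b%:F / (tvar n C)%:F ^+ e by rewrite val_dehom //; apply: homfrac_mpoly.
have beta0 : beta != 0.
  apply/eqP => /(dehom_eq0 (homfrac_mpoly hb))/eqP.
  by rewrite tofrac_eq0 (negbTE b0).
pose s := f beta * s0; pose d := (size D0).-1.
have sm : s ^+ m = f (beta ^+ m) * s0 ^+ m by rewrite exprMn rmorphXn.
have betam0 : beta ^+ m != 0 by apply: expf_neq0.
(* The roots of [D0] are multiplied by $\beta^m$, because $s^m = \beta^m s_0^m$. *)
pose D : {poly deg0 n.+1 C} := \poly_(i < size D0) (D0`_i * beta ^+ (m * (d - i))).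
have sD0 : (0 < size D0)%N by rewrite size_poly_gt0 monic_neq0.
have Dd : D`_d = 1.
  by rewrite coef_poly prednK // leqnn -lead_coefE (monicP D01) subnn muln0 mulr1.
have sD : size D = size D0.
  apply: size_poly_eq; rewrite -/d subnn muln0 mulr1 -lead_coefE (monicP D01).
  exact: oner_neq0.
exists s, e, D; split; split.
- by rewrite mulf_neq0 // fmorph_eq0.
- rewrite sm invfM -fmorphV; exact: in_gen_scale.
- move=> w /wsP /(in_gen_scale 1 betam0); rewrite rmorph1 mul1r sm; exact.
- by apply/monicP; rewrite lead_coefE sD -/d Dd.
- apply/rootP; rewrite (@horner_coef_wide _ (size D0)) ?size_map_poly ?sD //.
  have := rootP D0s; rewrite horner_coef size_map_poly => D00.
  rewrite -[RHS](mulr0 (f (beta ^+ (m * d)))) -[X in _ * X]D00 mulr_sumr.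
  apply: eq_bigr => i _; rewrite !coef_map coef_poly ltn_ord /= sm rmorphM.
  rewrite exprMn -rmorphXn mulrA [RHS]mulrCA [RHS]mulrA; congr (_ * _).
  rewrite -mulrA -rmorphM -exprM -exprD -mulnDr subnK //.
  by rewrite -ltnS prednK.
- move=> q qs; rewrite sD => sq.
  have sX : size (beta ^+ m *: 'X : {poly deg0 n.+1 C}) = 2%N.
    by rewrite size_scale ?size_polyX.
  have q0 : q \Po (beta ^+ m *: 'X) = 0.
    apply: D0min; last by rewrite size_comp_poly2.
    rewrite map_comp_poly map_polyZ map_polyX rootE horner_comp hornerZ hornerX.
    by rewrite -sm.
  by apply/eqP; rewrite -size_poly_eq0 -(size_comp_poly2 q sX) q0 size_poly0.
move=> i; rewrite sD -/d.
have [lti | lei] := ltnP i d; last first.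
  exists (if i == d then 1 else 0).
    have -> : (d - i = 0)%N by lia.
    by rewrite muln0; case: ifP => _; rewrite ?dhomog1 ?dhomog0.
  have [->|ne] := eqVneq i d.
    by rewrite subnn muln0 Dd expr0 mulr1 !rmorph1.
  rewrite nth_default ?rmorph0 ?mul0r // sD -(prednK sD0) -/d.
  by rewrite ltn_neqAle eq_sym ne.
have iD0 : (i < size D0)%N by rewrite -(prednK sD0) ltnW.
have [a] := bD _ (mem_nth 0 iD0); rewrite mul1n expr1 => ha aE.
set k := (d - i)%N; have k0 : (0 < k)%N by rewrite subn_gt0.
have mk0 : (0 < m * k)%N by rewrite muln_gt0 m0.
(* The degrees add up: $e + e (m k - 1) + k = (m e + 1) k$. *)
exists (a * b ^+ (m * k).-1 * tvar n C ^+ k).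
  have -> : ((m * e).+1 * k = e + e * (m * k).-1 + 1 * k)%N.
    rewrite mul1n -[X in (X + _ + k)%N]muln1 -mulnDr add1n prednK // mulSn addnC.
    by congr (_ + _)%N; rewrite mulnAC mulnC.
  apply: dhomogM; last exact: dhomogMn (tvar_homog _ _).
  by apply: dhomogM => //; apply: dhomogMn.
rewrite coef_poly iD0 rmorphM rmorphXn aE betaE !rmorphM !rmorphXn.
by apply: clear_denominator; [rewrite tofrac_eq0 | exact: tvarF_neq0 |].
Qed.

End HomogeneousGenerator.

(** * Transfer of a factorization from one ring to another *)

Section Transfer.
Variables (V A : comNzRingType) (L : fieldType).
Variables (phi : {rmorphism V -> A}) (psi : {rmorphism V -> L}).
Variables (tau : V) (g : A) (gamma : L).
Hypothesis tau0 : psi tau != 0.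
Hypothesis g_gamma : forall q : {poly V},
  (map_poly phi q).[g] = 0 -> (map_poly psi q).[gamma] = 0.

(* The graph of the morphism V[1/tau][g] -> L extending psi and mapping g to
   gamma. *)
Definition transfer x y := exists N (q : {poly V}),
  phi tau ^+ N * x = (map_poly phi q).[g] /\
  psi tau ^+ N * y = (map_poly psi q).[gamma].

Lemma transferB x y x' y' :
  transfer x y -> transfer x' y' -> transfer (x - x') (y - y').
Proof.
move=> [N [q [xq yq]]] [N' [q' [xq' yq']]].
exists (N + N')%N, (tau ^+ N' *: q - tau ^+ N *: q').
rewrite !rmorphB /= !map_polyZ !hornerD !hornerN !hornerZ -xq -yq -xq' -yq'.
by rewrite !rmorphXn !exprD; split; ring.
Qed.

Lemma transferM x y x' y' :
  transfer x y -> transfer x' y' -> transfer (x * x') (y * y').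
Proof.
move=> [N [q [xq yq]]] [N' [q' [xq' yq']]]; exists (N + N')%N, (q * q').
by rewrite !rmorphM !hornerM -xq -yq -xq' -yq' !exprD; split; ring.
Qed.

Lemma transfer_base F : transfer (phi F) (psi F).
Proof. by exists 0%N, F%:P; rewrite !map_polyC !hornerC !expr0 !mul1r. Qed.

Lemma transferD x y x' y' :
  transfer x y -> transfer x' y' -> transfer (x + x') (y + y').
Proof.
move=> xy x'y'; rewrite -[x']opprK -[y']opprK; apply: transferB => //.
rewrite -[- x']sub0r -[- y']sub0r; apply: transferB => //.
by have := transfer_base 0; rewrite !rmorph0.
Qed.

Lemma transfer_sum (I : Type) (r : seq I) (x : I -> A) (y : I -> L) :
  (forall i, transfer (x i) (y i)) ->
  transfer (\sum_(i <- r) x i) (\sum_(i <- r) y i).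
Proof.
move=> xy; elim: r => [|i r IHr]; last by rewrite !big_cons; apply: transferD.
by rewrite !big_nil; have := transfer_base 0; rewrite !rmorph0.
Qed.

(** By [g_gamma] every relation satisfied by [g] over [V] holds for [gamma], and [psi tau] can be
    cancelled in [L]. *)
Lemma transfer_uniq x y y' : transfer x y -> transfer x y' -> y = y'.
Proof.
move=> xy xy'; apply/eqP; rewrite -subr_eq0; apply/eqP.
have [N [q]] := transferB xy xy'; rewrite subrr mulr0 => -[/esym/g_gamma ->].
by move/eqP; rewrite mulf_eq0 expf_eq0 (negbTE tau0) andbF => /eqP.
Qed.

(** The coefficients of the two products correspond under [transfer]; those of the first come from
    [V], where [transfer] is given by [phi] and [psi], and uniqueness concludes. *)
Lemma transfer_split (p : {poly V}) (s : seq (A * L)) :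
    (forall u, u \in s -> transfer u.1 u.2) ->
    map_poly phi p = \prod_(u <- s) ('X - u.1%:P) ->
  map_poly psi p = \prod_(u <- s) ('X - u.2%:P).
Proof.
move=> sP pE.
have tr k : transfer (\prod_(u <- s) ('X - u.1%:P))`_k (\prod_(u <- s) ('X - u.2%:P))`_k.
  have t0 := transfer_base 0; rewrite !rmorph0 in t0.
  elim: s sP {pE} k => [|u s IHs] sP k.
    rewrite !big_nil !coef1; case: eqP => _ //.
    by have := transfer_base 1; rewrite !rmorph1.
  have us v : v \in s -> transfer v.1 v.2 by move=> vs; apply: sP; rewrite inE vs orbT.
  rewrite !big_cons !mulrBl !coefB !coefXM !coefCM.
  apply: transferB; first by case: eqP => _ //; apply: IHs.
  by apply: transferM; [apply: sP; rewrite mem_head | apply: IHs].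
apply/polyP => k; apply: transfer_uniq (tr k).
by rewrite -pE !coef_map; apply: transfer_base.
Qed.

End Transfer.

(** * Clearing denominators, and membership in $\mathbb{P}_h((\mathbf{x}))$ *)

Lemma scale_polyC (R : nzRingType) (a b : R) : a *: b%:P = (a * b)%:P.
Proof. by rewrite -mul_polyC -polyCM. Qed.

Lemma poly_denominator (R : idomainType) (q : {poly {fraction R}}) :
  exists2 c : R, c != 0 & exists q' : {poly R},
    map_poly (@FracField.tofrac R) q' = c%:F *: q.
Proof.
elim/poly_ind: q => [|q x [c c0 [q' q'E]]].
  by exists 1; [exact: oner_neq0 | exists 0; rewrite rmorph0 scaler0].
have d0 := denom_ratioP (repr x).
exists (\d_(repr x) * c); first exact: mulf_neq0.
exists (\d_(repr x) *: q' * 'X + (c * \n_(repr x))%:P).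
rewrite rmorphD rmorphM /= map_polyX map_polyZ map_polyC q'E /=.
rewrite scalerDr -!scalerAl scalerA; congr (_ + _); first by rewrite tofracM.
rewrite scale_polyC; congr (_%:P).
have dF0 : (\d_(repr x))%:F != 0 by rewrite tofrac_eq0.
by rewrite !tofracM {3}[x]frac_numden [_%:F * c%:F]mulrC -mulrA [X in _ = _ * X]mulrC (divfK dF0).
Qed.

Section LaurentSeries.
Variables (n : nat) (C : fieldType).
Local Notation Cx := {fraction {mpoly C[n]}}.

Fact vmon_subproof k (x : Cx) : homfrac k x ->
  forall l, homfrac l (if l == k then x else 0).
Proof. by move=> hx l; case: eqP => [->|_] //; apply: homfrac0. Qed.

Definition vmon k (x : Cx) (hx : homfrac k x) : vhat n C := Vhat (vmon_subproof hx).

Lemma vcompM_vmon (F : vhat n C) k x (hx : homfrac k x) l :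
  vcomp (vmon hx * F) l = if (k <= l)%N then x * vcomp F (l - k) else 0.
Proof.
rewrite vcompM; case: leqP => [lekl|ltlk].
  have ltk : (k < l.+1)%N by [].
  rewrite (bigD1 (Ordinal ltk)) //= eqxx big1 ?addr0 // => i ik.
  by rewrite (_ : (i == k :> nat) = false) ?mul0r //; apply: contraNF ik.
rewrite big1 // => i _ /=; rewrite ltn_eqF ?mul0r //.
by apply: leq_trans ltlk; apply: ltn_ord.
Qed.

(** Brings the partial sums of [nu_sum] into the completed valuation ring, where orders can be read
    off. *)
Lemma K_of_Cx_homfrac k x (hx : homfrac k x) : K_of_Cx x = (vmon hx)%:F.
Proof.
have [j [a [b [ha hb b0 xE]]]] := hx; rewrite {1}xE /K_of_Cx.
have bF0 : b%:F != 0 by rewrite tofrac_eq0.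
rewrite (fracmapE (@vhat_of_mpoly_inj n C)) //.
have vb0 : (vhat_of_mpoly b)%:F != 0.
  by rewrite tofrac_eq0 -(rmorph0 (@vhat_of_mpoly n C)) (inj_eq (@vhat_of_mpoly_inj n C)).
apply: (canLR (mulfK vb0)); rewrite -tofracM; congr (_%:F); apply: vhat_eq => l.
rewrite vcompM_vmon !vcomp_of_mseries (mhcomp_dhomog _ ha) (mhcomp_dhomog _ hb).
case: leqP => [lekl | ltlk]; last by rewrite ltn_eqF ?rmorph0 // (leq_trans ltlk) ?leq_addl.
rewrite -[in RHS](eqn_add2r k) subnK //; case: eqP => _; last by rewrite !rmorph0 mulr0.
by rewrite !mulr1n xE divfK.
Qed.

Lemma vord_exp (F : vhat n C) k : F != 0 -> vord (F ^+ k) = (k * vord F)%N.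
Proof.
move=> F0; elim: k => [|k IHk].
  by apply: vord_uniq => //; rewrite expr0 vcomp1; apply: oner_neq0.
by rewrite exprS vordM ?expf_neq0 // IHk mulSn.
Qed.

(** Division by $t^\kappa$ moves the component of index $p$ to index $k = p - \kappa$, and the
    exponent of $h$ becomes $\alpha p + \beta = \alpha k + (\beta + \alpha \kappa)$. *)
Lemma Ph_laurentI (h t : {mpoly C[n]}) d (B : vhat n C) kappa alpha beta
    (deg : nat -> nat) (a : nat -> {mpoly C[n]}) :
    h != 0 -> h \is d.-homog -> t != 0 -> t \is 1.-homog ->
    (forall p, a p \is (deg p).-homog) ->
    (forall p, deg p + kappa = p + (alpha * p + beta) * d)%N ->
    (forall p, vcomp B p * h%:F ^+ (alpha * p + beta) = (a p)%:F * t%:F ^+ kappa) ->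
  Ph_laurent h (B%:F / (vhat_of_mpoly t)%:F ^+ kappa).
Proof.
move=> h0 hh t0 ht ha degE BE.
have hd : mpdeg h = d.
  by rewrite /mpdeg; apply: (dhomog_uniq h0 _ hh); apply: dhomog_msize hh.
have hF0 : h%:F != 0 by rewrite tofrac_eq0.
have tF0 : t%:F != 0 by rewrite tofrac_eq0.
have vt0 : vhat_of_mpoly t != 0.
  by rewrite -(rmorph0 (@vhat_of_mpoly n C)) (inj_eq (@vhat_of_mpoly_inj n C)).
have vtk0 : vhat_of_mpoly t ^+ kappa != 0 by apply: expf_neq0.
have vtkF0 : (vhat_of_mpoly t ^+ kappa)%:F != 0 by rewrite tofrac_eq0.
have tK : K_of_Cx (t%:F ^+ kappa) = (vhat_of_mpoly t ^+ kappa)%:F.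
  rewrite rmorphXn tofracXn; congr (_ ^+ _).
  have := fracmapE (@vhat_of_mpoly_inj n C) t (oner_neq0 _).
  by rewrite !rmorph1 !divr1.
have KK x : K_of_Cx (x * t%:F ^+ kappa) / (vhat_of_mpoly t ^+ kappa)%:F = K_of_Cx x.
  have KM : {morph @K_of_Cx n C : y z / y * z} := rmorphM _.
  by rewrite KM tK (mulfK vtkF0).
have BE' p : vcomp B p = (a p)%:F / h%:F ^+ (alpha * p + beta) * t%:F ^+ kappa.
  by rewrite mulrAC -BE (mulfK (expf_neq0 _ hF0)).
have expE (p : nat) : alpha%:Z * (- kappa%:Z + p%:Z) + (beta + alpha * kappa)%N%:Z =
    (alpha * p + beta)%N%:Z.
  by rewrite !PoszD !PoszM; ring.
exists (- kappa%:Z), alpha, (beta + alpha * kappa)%N.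
exists (fun k : int => a (absz (k + kappa%:Z))); split.
  move=> k lek; have [p kE] : exists p : nat, k = - kappa%:Z + p%:Z.
    by exists (absz (k + kappa%:Z)); lia.
  rewrite kE addrAC addNr add0r absz_nat; split=> [|ap0].
    by apply/homogP; exists (deg p).
  have -> : mpdeg (a p) = deg p.
    by rewrite /mpdeg; apply: (dhomog_uniq ap0 _ (ha p)); apply: dhomog_msize (ha p).
  by rewrite expE hd; have := degE p; lia.
move=> N; have sumE : \sum_(i < N) K_of_Cx
     ((a (absz (- kappa%:Z + i%:Z + kappa%:Z)))%:F /
      h%:F ^ (alpha%:Z * (- kappa%:Z + i%:Z) + (beta + alpha * kappa)%N%:Z)) =
    (\sum_(i < N) vmon (vcompP B i))%:F / (vhat_of_mpoly t ^+ kappa)%:F.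
  rewrite rmorph_sum mulr_suml; apply: eq_bigr => i _.
  rewrite addrAC addNr add0r absz_nat expE -exprnP.
  rewrite -[X in _ = X / _](K_of_Cx_homfrac (vcompP B i)).
  by rewrite BE' KK.
rewrite -tofracXn sumE -mulrBl -tofracB => G0.
have {}G0 : B - \sum_(i < N) vmon (vcompP B i) != 0.
  by apply: contraNneq G0 => ->; rewrite tofrac0 mul0r.
rewrite nuE // vord_exp // (_ : vord (vhat_of_mpoly t) = 1%N); last first.
  apply: vord_uniq => [|i].
    by rewrite vcomp_of_mseries (mhcomp_dhomog _ ht) mulr1n.
  by rewrite ltnS leqn0 => /eqP->; rewrite vcomp_of_mseries (mhcomp_dhomog _ ht) mulr0n rmorph0.
(* The partial sum removes the components of index less than [N], so an order less than [N] is
   contradictory. *)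
rewrite muln1 ler_int addrC lerD2r lez_nat leqNgt; apply/negP => lt.
have [nz _] := vordP G0; move: lt nz; move: (vord _) => v ltvN /eqP[].
have vcomp_sum (I : Type) (r : seq I) (X : I -> vhat n C) l :
  vcomp (\sum_(i <- r) X i) l = \sum_(i <- r) vcomp (X i) l.
  by elim/big_rec2: _ => // i x y _ <-.
rewrite -[vcomp _ _]/(vcomp B v - vcomp (\sum_(i < N) vmon (vcompP B i)) v).
rewrite vcomp_sum (bigD1 (Ordinal ltvN)) //= eqxx big1 ?addr0 ?subrr // => i.
by rewrite eq_sym -val_eqE /= => /negbTE ->.
Qed.

End LaurentSeries.

(** * The extension generated by the homogeneous element *)

Lemma sum_residue (V : nmodType) M a d (G : nat -> V) : (a < M)%N ->
    (forall k, (k < M * d)%N -> (k %% M)%N != a -> G k = 0) ->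
  \sum_(k < M * d) G k = \sum_(i < d) G (M * i + a)%N.
Proof.
move=> ltaM G0; elim: d G0 => [|d IHd] G0; first by rewrite muln0 !big_ord0.
rewrite big_ord_recr /= -IHd => [|k ltk]; last first.
  by apply: G0; apply: leq_trans ltk _; rewrite leq_mul2l leqnSn orbT.
rewrite -!(big_mkord xpredT G) (big_cat_nat (n := (M * d)%N)) //=; last first.
  by rewrite leq_mul2l leqnSn orbT.
congr (_ + _); rewrite -{1}[(M * d)%N]add0n big_addn mulnS addnK big_mkord.
rewrite (bigD1 (Ordinal ltaM)) //= addnC big1 ?addr0 // => i ia.
apply: G0; first by rewrite mulnS ltn_add2r.
by rewrite addnC mulnC modnMDl modn_small.
Qed.

Lemma clear_power (K : fieldType) (a t x : K) i j : x != 0 ->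
  a / x ^+ i * t * x ^+ (i + j) = a * t * x ^+ j.
Proof.
move=> x0; rewrite exprD; have := expf_neq0 i x0.
by move: (x ^+ i) (x ^+ j) => y z y0; field; rewrite y0.
Qed.

Section HomogeneousExtension.
Variables (n : nat) (C E : fieldType) (f : {rmorphism deg0 n.+1 C -> E}).
Variables (m : nat) (s : E) (e : nat) (D : {poly deg0 n.+1 C}).
Local Notation M := m.+1.
Local Notation V := (vhat n.+1 C).
Local Notation Cx := {fraction {mpoly C[n.+1]}}.
Local Notation t := (tvar n C).
Let c := (M * e).+1.
Let dd := (size D).-1.
Hypothesis s0 : s != 0.
Hypothesis D1 : D \is monic.
Hypothesis Ds : root (map_poly f D) (s ^+ M).
Hypothesis Dmin :
  forall q, root (map_poly f q) (s ^+ M) -> (size q < size D)%N -> q = 0.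
Hypothesis D_homog : forall i, exists2 a : {mpoly C[n.+1]},
  a \is (c * (dd - i)).-homog & deg0val D`_i * t%:F ^+ (c * (dd - i)) = a%:F.

(** Here $t$ becomes $T^M$, so $T$ plays the role of an $M$-th root of $t$. *)
Definition ramified_series : V -> pser E := pssubS m \o vhat_series f.
HB.instance Definition _ := GRing.RMorphism.on ramified_series.
Local Notation Phi := ramified_series.

Definition homog_gen : pser E := psmon s c.
Local Notation gt := homog_gen.

Lemma size_D : size D = dd.+1.
Proof. by rewrite prednK // size_poly_gt0 monic_neq0. Qed.

Lemma mulc k : (c * k = M * (e * k) + k)%N.
Proof. by rewrite /c mulSn mulnA addnC. Qed.

Lemma modc k : (c * k = k %[mod M])%N.
Proof. by rewrite mulc mulnC modnMDl. Qed.

Lemma coef_Phi_gt (F : V) k J : pcoef (Phi F * gt ^+ k) J =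
  if (c * k <= J)%N && (M %| J - c * k)%N then
    f (dehom ((J - c * k) %/ M) (vcomp F ((J - c * k) %/ M))) * s ^+ k else 0.
Proof.
rewrite psmonX pcoefM_mon; case: leqP => //= _.
by case: ifP => // _; rewrite mul0r.
Qed.

(** To isolate the component $p$ of the coefficient $k_0$, take the coefficient of $T^J$ with $J = M
    p + c k_0$. As $c = 1$ modulo $M$, only the indices $k = M i + a$ with $a = k_0 \bmod M$
    contribute; they add up to $s^a$ times a polynomial in $s^M$ of degree less than that of [D],
    whose coefficients vanish by minimality. *)
Lemma gt_free (r : {poly V}) : (size r <= M * dd)%N ->
  (map_poly Phi r).[gt] = 0 -> r = 0.
Proof.
move=> sr r0; apply/polyP => k0; rewrite coef0.
have [ltk0 | lek0] := ltnP k0 (M * dd); last first.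
  by apply: nth_default; apply: leq_trans lek0.
apply: vhat_eq => p; rewrite vcomp0.
pose J := (M * p + c * k0)%N; pose a := (k0 %% M)%N.
have ltaM : (a < M)%N by rewrite ltn_mod.
have Mia i : ((M * i + a) %% M = a)%N by rewrite mulnC modnMDl modn_small.
have JM : (J = k0 %[mod M])%N by rewrite /J mulnC modnMDl modc.
pose G k := pcoef (Phi r`_k * gt ^+ k) J.
have G0 : \sum_(k < M * dd) G k = 0.
  have r0J : pcoef (map_poly Phi r).[gt] J = 0 by rewrite r0.
  rewrite -[RHS]r0J (horner_coef_wide _ (leq_trans (size_poly _ _) sr)) pcoef_sum.
  by apply: eq_bigr => k _; rewrite coef_map.
have Gk k : (c * k <= J)%N -> (M %| J - c * k)%N = (k %% M == a)%N.
  by move=> le; rewrite -eqn_mod_dvd // JM modc eq_sym.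
rewrite (sum_residue ltaM) in G0; last first.
  move=> k _ ka; rewrite /G coef_Phi_gt; case: leqP => //= le.
  by rewrite Gk // (negbTE ka).
pose x i : deg0 n.+1 C := let k := (M * i + a)%N in
  if (c * k <= J)%N then dehom ((J - c * k) %/ M) (vcomp r`_k ((J - c * k) %/ M)) else 0.
have q0 : \poly_(i < dd) x i = 0.
  apply: Dmin; last by rewrite size_D ltnS size_poly.
  apply/rootP; rewrite (horner_coef_wide _ (leq_trans (size_poly _ _) (size_poly _ _))).
  apply: (mulIf (expf_neq0 a s0)); rewrite mul0r -[RHS]G0 mulr_suml.
  apply: eq_bigr => i _; rewrite coef_map coef_poly ltn_ord /G coef_Phi_gt /x.
  case: leqP => /= [le|_]; last by rewrite rmorph0 !mul0r.
  by rewrite Gk // Mia eqxx -mulrA -exprM -exprD.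
have kE : (M * (k0 %/ M) + a = k0)%N by rewrite mulnC -divn_eq.
have lti : (k0 %/ M < dd)%N by rewrite ltn_divLR // mulnC.
have := congr1 (fun q : {poly _} => q`_(k0 %/ M)) q0.
rewrite coef_poly lti coef0 /x kE leq_addl /J addnK mulKn //.
exact/dehom_eq0/vcompP.
Qed.


Lemma dehom_tvar : dehom 1 t%:F = 1.
Proof. by rewrite -[1 in RHS](dehomK 1) rmorph1 mul1r expr1. Qed.

Lemma Phi_homog k (a : {mpoly C[n.+1]}) : a \is k.-homog ->
  Phi (vhat_of_mpoly a) = psmon (f (dehom k a%:F)) (M * k)%N.
Proof.
move=> ha; rewrite /ramified_series /= (vhat_series_homog f ha); apply: pserP => j /=.
case: (boolP (M %| j)%N) => [/dvdnP[l ->]|Mj].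
  by rewrite mulnK // [(M * k)%N]mulnC eqn_pmul2r.
by case: eqP Mj => // ->; rewrite dvdn_mulr.
Qed.

(** $\Gamma = \sum_i D_i t^{c (\delta - i)} z^{M i}$ with $\delta = \deg D$. Giving $z$ the weight
    $c / M$, every term has degree $c (\delta - i) + c i = c \delta$; and $z = s T^c$, $t = T^M$
    turn $\Gamma$ into $T^{M c \delta} D(s^M) = 0$. *)
Lemma exists_Gamma : exists Gamma : {poly {mpoly C[n.+1]}},
  [/\ Gamma \is monic, size Gamma = (M * dd).+1,
    weighted_homog (c%:R / M%:R) Gamma &
    (map_poly (Phi \o @vhat_of_mpoly n.+1 C) Gamma).[gt] = 0].
Proof.
have [|A AP] := @choice nat {mpoly C[n.+1]} (fun i a => a \is (c * (dd - i)).-homog /\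
    deg0val D`_i * t%:F ^+ (c * (dd - i)) = a%:F).
  by move=> i; have [a ha aE] := D_homog i; exists a.
have Add : A dd = 1.
  have [_] := AP dd; rewrite subnn muln0 expr0 mulr1 -lead_coefE (monicP D1).
  by rewrite rmorph1 -tofrac1 => /eqP; rewrite tofrac_eq => /eqP.
pose GA := \poly_(i < dd.+1) A i.
have sGA : size GA = dd.+1 by rewrite size_poly_eq // Add oner_neq0.
have GA1 : GA \is monic by rewrite monicE lead_coefE sGA coef_poly ltnSn Add.
have sX : size ('X^M : {poly {mpoly C[n.+1]}}) = M.+1 by rewrite size_polyXn.
exists (GA \Po 'X^M); have G1 : GA \Po 'X^M \is monic.
  rewrite monicE lead_coef_comp ?sX // lead_coefXn expr1n mulr1.
  exact: GA1.
split=> //.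
- have := size_comp_poly GA ('X^M); rewrite sGA sX /= mulnC => <-.
  by rewrite prednK // size_poly_gt0 monic_neq0.
- exists (c * dd)%:R => j u; rewrite coef_comp_poly_Xn //; case: ifP; last first.
    by rewrite msupp0 in_nil.
  move=> /dvdnP[i ->]; rewrite mulnK // coef_poly; case: ltnP; last first.
    by rewrite msupp0 in_nil.
  rewrite ltnS => lei /(dhomogP _ _ _ (AP i).1) -> .
  rewrite [(i * M)%N]mulnC [(M * i)%:R]natrM mulrA divfK ?pnatr_eq0 //.
  by rewrite -natrM -natrD -mulnDr subnK.
rewrite map_comp_poly map_polyXn horner_comp hornerXn.
rewrite (@horner_coef_wide _ dd.+1) ?(leq_trans (size_poly _ _)) ?sGA //.
rewrite (eq_bigr (fun i : 'I_dd.+1 => psmon (f D`_i * (s ^+ M) ^+ i) (M * (c * dd))%N)).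
  apply: pserP => j; rewrite pcoef_sum /= sumrMnl -size_D.
  have := rootP Ds; rewrite horner_coef size_map_poly => DE.
  rewrite (eq_bigr (fun i : 'I_(size D) => (map_poly f D)`_i * (s ^+ M) ^+ i)).
    by rewrite DE mul0rn.
  by move=> i _; rewrite coef_map.
move=> i _; have [hA AE] := AP i; have lei : (i <= dd)%N by rewrite -ltnS.
rewrite coef_map /= coef_poly ltn_ord (Phi_homog hA) -AE dehomK.
rewrite -exprM psmonX psmonM exprM; congr (psmon _ _).
by rewrite [(c * (M * i))%N]mulnCA -!mulnDr subnK.
Qed.

Section Roots.
Variables (L : closedFieldType) (iota : {rmorphism {fraction V} -> L}).

Definition L_of_vhat : V -> L := iota \o @FracField.tofrac _.
HB.instance Definition _ := GRing.RMorphism.on L_of_vhat.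
Local Notation psi := L_of_vhat.

Lemma L_of_mpolyE (a : {mpoly C[n.+1]}) : L_of_mpoly iota a = psi (vhat_of_mpoly a).
Proof.
congr (iota _); rewrite /= /K_of_Cx -[a%:F]divr1 -tofrac1.
by rewrite (fracmapE (@vhat_of_mpoly_inj n.+1 C)) ?oner_neq0 // !rmorph1 divr1.
Qed.

Variables (Gamma : {poly {mpoly C[n.+1]}}) (gamma : L).
Hypothesis Gamma1 : Gamma \is monic.
Hypothesis size_Gamma : size Gamma = (M * dd).+1.
Hypothesis Gamma_gt : (map_poly (Phi \o @vhat_of_mpoly n.+1 C) Gamma).[gt] = 0.
Hypothesis Gamma_gamma : root (map_poly (L_of_mpoly iota) Gamma) gamma.

(** The remainder of [q] modulo the monic [Gamma] vanishes at [gt], so it is zero by [gt_free]; thus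
    [q] is a multiple of [Gamma], which vanishes at [gamma]. *)
Lemma gt_gamma (q : {poly V}) : (map_poly Phi q).[gt] = 0 -> (map_poly psi q).[gamma] = 0.
Proof.
pose G := map_poly (@vhat_of_mpoly n.+1 C) Gamma => q0.
have G1 : G \is monic by apply: monic_map.
have Ggt : (map_poly Phi G).[gt] = 0 by rewrite -map_poly_comp.
have Ggamma : (map_poly psi G).[gamma] = 0.
  rewrite -map_poly_comp -(rootP Gamma_gamma); congr _.[_].
  by apply: eq_map_poly => a; rewrite L_of_mpolyE.
have qE := Pdiv.RingMonic.rdivp_eq G1 q.
have r0 : Pdiv.Ring.rmodp q G = 0.
  apply: gt_free.
    have := Pdiv.Ring.ltn_rmodpN0 q (monic_neq0 G1).
    by move=> /leq_trans/(_ (size_poly _ _)); rewrite size_Gamma.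
  move: q0; rewrite {1}qE rmorphD rmorphM hornerD hornerM Ggt mulr0 add0r; exact.
by rewrite qE r0 addr0 rmorphM hornerM Ggamma mulr0.
Qed.

(** After clearing denominators, one of the two factors vanishes at [gt] because $E[[T]]$ is a
    domain; [gt_free] then makes that factor zero. *)
Lemma Gamma_irreducible (a b : {poly Cx}) :
  a * b = map_poly (@FracField.tofrac _) Gamma ->
  (size a <= M * dd)%N -> (size b <= M * dd)%N -> False.
Proof.
move=> ab sa sb.
have [x x0 [a' aE]] := poly_denominator a; have [y y0 [b' bE]] := poly_denominator b.
have injF : injective (@FracField.tofrac {mpoly C[n.+1]}).
  by move=> u v /eqP; rewrite tofrac_eq => /eqP.
have abE : a' * b' = (x * y) *: Gamma.
  apply: (map_inj_poly injF); first exact: tofrac0.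
  rewrite rmorphM map_polyZ /= aE bE -ab tofracM -!mul_polyC polyCM.
  by rewrite mulrACA.
have sz (u : {mpoly C[n.+1]}) (p : {poly Cx}) p' : u != 0 ->
    map_poly (@FracField.tofrac _) p' = u%:F *: p -> (size p <= M * dd)%N ->
    (size (map_poly (@vhat_of_mpoly n.+1 C) p') <= M * dd)%N.
  move=> u0 pE; apply: leq_trans; apply: leq_trans (size_poly _ _) _.
  by rewrite -(size_map_inj_poly injF (tofrac0 _) p') pE size_scale ?tofrac_eq0.
have nz p' : map_poly (@vhat_of_mpoly n.+1 C) p' = 0 -> p' = 0.
  move=> p0; apply: (map_inj_poly (@vhat_of_mpoly_inj n.+1 C)); first exact: rmorph0.
  by rewrite p0 rmorph0.
have G0 : (x * y) *: Gamma != 0.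
  by rewrite -mul_polyC mulf_neq0 ?polyC_eq0 ?mulf_neq0 ?monic_neq0.
have : (map_poly Phi (map_poly (@vhat_of_mpoly n.+1 C) (a' * b'))).[gt] = 0.
  by rewrite -map_poly_comp abE map_polyZ hornerZ Gamma_gt mulr0.
rewrite !rmorphM hornerM => /pser_mul_eq0 => /orP[] /eqP.
  move/(gt_free (sz _ _ _ x0 aE sa))/nz => a0.
  by rewrite -abE a0 mul0r eqxx in G0.
move/(gt_free (sz _ _ _ y0 bE sb))/nz => b0.
by rewrite -abE b0 mulr0 eqxx in G0.
Qed.

Local Notation LC := (L_of_Cx iota).

Let GC := map_poly (@FracField.tofrac _) Gamma.

Lemma GC_gamma : root (map_poly LC GC) gamma.
Proof. by rewrite -map_poly_comp. Qed.

Lemma GC_monic : GC \is monic. Proof. exact: monic_map. Qed.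

Lemma size_GC : size GC = (M * dd).+1.
Proof.
rewrite -size_Gamma; apply: size_map_poly_id0.
by rewrite (monicP Gamma1) tofrac1 oner_neq0.
Qed.

(** If [q] were non-zero, its gcd with [Gamma] would have [gamma] as a root and be a proper factor
    of [Gamma]. *)
Lemma gamma_free (q : {poly Cx}) : (size q <= M * dd)%N ->
  (map_poly LC q).[gamma] = 0 -> q = 0.
Proof.
move=> sq q0; apply: contrapT => /eqP nq.
pose g := gcdp q GC.
have gg : root (map_poly LC g) gamma.
  by rewrite gcdp_map root_gcd GC_gamma andbT; apply/rootP.
have g0 : g != 0 by rewrite gcdp_eq0 negb_and nq.
have sg : (1 < size g)%N.
  rewrite ltnNge; apply: contraL gg => /size1_polyC gE.
  rewrite gE map_polyC /= rootC fmorph_eq0; apply: contraNN g0 => /eqP g00.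
  by rewrite gE g00.
have /dvdpP[a aE] := dvdp_gcdr q GC; rewrite -/g in aE.
have a0 : a != 0.
  by apply: contraNneq (monic_neq0 GC_monic) => a0; rewrite aE a0 mul0r.
apply: (Gamma_irreducible (esym aE)).
  have := size_GC; rewrite aE size_mul // => E'.
  by move: sg E'; case: (size g) => [|[|k]] // _; rewrite addnS /= addnS => -[<-]; apply: leq_addr.
exact: leq_trans (dvdp_leq nq (dvdp_gcdl _ _)) sq.
Qed.

(** Bezout's relation with [Gamma] gives the inverse. If the gcd [g] were not constant, it would not
    vanish at [gamma], so its cofactor in [Gamma] would, contradicting [gamma_free]. *)
Lemma gamma_inv (q : {poly Cx}) : (map_poly LC q).[gamma] != 0 ->
  exists u, (map_poly LC u).[gamma] * (map_poly LC q).[gamma] = 1.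
Proof.
move=> q0; suff /Bezout_eq1_coprimepP[[u v] /= uv] : coprimep q GC.
  exists u; have := congr1 (fun p => (map_poly LC p).[gamma]) uv.
  rewrite rmorphD !rmorphM rmorph1 hornerD !hornerM (rootP GC_gamma) mulr0 addr0.
  by rewrite hornerC.
apply: contrapT => /negP nco; pose g := gcdp q GC.
have GC0 := monic_neq0 GC_monic.
have /dvdpP[a aE] := dvdp_gcdr q GC; rewrite -/g in aE.
have a0 : a != 0 by apply: contraNneq GC0 => a0; rewrite aE a0 mul0r.
have g0 : g != 0 by apply: contraNneq GC0 => g0; rewrite aE g0 mulr0.
have gg : (map_poly LC g).[gamma] != 0.
  apply: contraNneq q0 => gg; have /dvdpP[b ->] := dvdp_gcdl q GC.
  by rewrite rmorphM hornerM gg mulr0.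
have sg : (1 < size g)%N.
  by move: nco; rewrite coprimep_def -/g neq_ltn ltnS leqn0 size_poly_eq0 (negbTE g0).
have /eqP[] := a0; apply: gamma_free.
  have := size_GC; rewrite aE size_mul // => E'.
  by move: sg E'; case: (size g) => [|[|k]] // _; rewrite addnS /= addnS => -[<-]; apply: leq_addr.
have := rootP GC_gamma; rewrite {1}aE rmorphM hornerM => /eqP.
by rewrite mulf_eq0 (negbTE gg) orbF => /eqP.
Qed.

Lemma gamma_degree : has_degree LC (in_adjoin LC gamma) (M * dd).
Proof.
have dgt (c' : 'I_(M * dd) -> Cx) : exists q : {poly Cx},
    [/\ (size q <= M * dd)%N, forall i : 'I_(M * dd), q`_i = c' i &
    \sum_i LC (c' i) * gamma ^+ i = (map_poly LC q).[gamma]].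
  pose q := \poly_(i < M * dd) oapp c' 0 (insub i).
  have qE (i : 'I_(M * dd)) : q`_i = c' i by rewrite coef_poly ltn_ord valK.
  exists q; split=> //; first exact: size_poly.
  rewrite (horner_coef_wide _ (leq_trans (size_poly _ _) (size_poly _ _))).
  by apply: eq_bigr => i _; rewrite coef_map qE.
exists (fun i => gamma ^+ i); split.
- move=> i; exists 'X^i, 1; rewrite rmorph1 hornerC oner_neq0; split=> //.
  by rewrite map_polyXn hornerXn divr1.
- move=> c' c0 i; have [q [sq qE qc]] := dgt c'.
  have q0 : q = 0 by apply: gamma_free; rewrite // -qc.
  by rewrite -qE q0 coef0.
- move=> _ [p [q [q0 ->]]]; have [u uq] := gamma_inv q0.
  have GC0 := monic_neq0 GC_monic.
  pose r := (p * u) %% GC.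
  have sr : (size r <= M * dd)%N by rewrite -ltnS -size_GC ltn_modp.
  exists (fun i : 'I_(M * dd) => r`_i).
  have -> : (map_poly LC p).[gamma] / (map_poly LC q).[gamma] = (map_poly LC r).[gamma].
    rewrite -[X in X / _]mulr1 -uq mulrA mulfK //.
    rewrite -hornerM -rmorphM {1}(divp_eq (p * u) GC) rmorphD rmorphM.
    by rewrite hornerD hornerM (rootP GC_gamma) mulr0 add0r.
  rewrite (horner_coef_wide _ (leq_trans (size_poly _ _) sr)).
  by apply: eq_bigr => i _; rewrite coef_map.
Qed.

Lemma vhat_tvar_neq0 : vhat_of_mpoly t != 0 :> V.
Proof.
by rewrite -(rmorph0 (@vhat_of_mpoly n.+1 C)) (inj_eq (@vhat_of_mpoly_inj n.+1 C)) tvar_neq0.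
Qed.

Lemma vord_tvarX k : vord (vhat_of_mpoly t ^+ k) = k.
Proof.
rewrite vord_exp ?vhat_tvar_neq0 // (_ : vord _ = 1%N) ?muln1 //.
have ht := tvar_homog n C; apply: vord_uniq => [|i].
  by rewrite vcomp_of_mseries (mhcomp_dhomog _ ht) mulr1n; apply: tvarF_neq0.
rewrite ltnS leqn0 => /eqP->.
by rewrite vcomp_of_mseries (mhcomp_dhomog _ ht) mulr0n; apply: tofrac0.
Qed.

(* c k = M kappa + k %% M with kappa = c k %/ M, so the terms of x of degree
   congruent to k mod M are T^(- M kappa) Phi(B) gt^k with B in the completed
   valuation ring. *)
Lemma series_transfer (h : {mpoly C[n.+1]}) d N (Y : nat -> nat -> deg0 n.+1 C) x :
    h != 0 -> h \is d.-homog ->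
    (forall j i, hden (h * t) (d + 1) (N * j.+1) (Y j i)) ->
    (forall j, pcoef x j = \sum_(i < dd) f (Y j i) * s ^+ (j %% M + M * i)) ->
  exists y, transfer Phi psi (vhat_of_mpoly t) gt gamma x y /\
    Ph_series iota (h * t) (c%:R / M%:R) gamma y.
Proof.
move=> h0 hh hY xE.
pose kap k := (c * k %/ M)%N.
have kapE k : (c * k = M * kap k + k %% M)%N.
  by rewrite {1}(divn_eq (c * k) M) modc mulnC.
pose B k : V := Vhat (fun p => homfrac_rehom p (Y (M * p + k %% M)%N (k %/ M)%N)).
pose A k := (B k)%:F / (vhat_of_mpoly t)%:F ^+ kap k.
have tX k : (vhat_of_mpoly t)%:F ^+ k != 0 :> {fraction V}.
  by rewrite -tofracXn tofrac_eq0 expf_neq0 // vhat_tvar_neq0.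
exists (\sum_(k < M * dd) iota (A k) * gamma ^+ k); split.
  (* The part of [x] carried by $\gamma^k$: it collects the terms with $j \bmod M + M i = k$. *)
  pose xk k := PSer (fun j => if (j %% M == k %% M)%N then f (Y j (k %/ M)%N) * s ^+ k else 0).
  have -> : x = \sum_(k < M * dd) xk k.
    apply: pserP => j; rewrite xE pcoef_sum.
    have ltjM : (j %% M < M)%N by rewrite ltn_mod.
    rewrite (sum_residue (G := fun k => pcoef (xk k) j) ltjM) => [|k _ kj]; last first.
      by rewrite /= eq_sym (negbTE kj).
    apply: eq_bigr => i _; rewrite /= [(M * i)%N]mulnC modnMDl modn_mod eqxx.
    by rewrite divnMDl // divn_small // addn0 addnC.
  (* As $t$ maps to $T^M$ and $M \kappa + (k \bmod M) = c k$, multiplication by $t^\kappa$ moves the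
     exponent $k \bmod M$ to the exponent $c k$ of $(s T^c)^k$. *)
  apply: transfer_sum => k; exists (kap k), (B k *: 'X^k); split; last first.
    rewrite map_polyZ hornerZ map_polyXn hornerXn mulrA; congr (_ * _).
    have -> : psi (vhat_of_mpoly t) ^+ kap k = iota ((vhat_of_mpoly t)%:F ^+ kap k).
      by rewrite [RHS]rmorphXn.
    by rewrite -rmorphM; congr (iota _); rewrite mulrC /A (divfK (tX _)).
  rewrite map_polyZ hornerZ map_polyXn hornerXn.
  rewrite -[LHS]/(Phi (vhat_of_mpoly t) ^+ kap k * xk k) -[RHS]/(Phi (B k) * gt ^+ k).
  rewrite (Phi_homog (tvar_homog n C)) dehom_tvar rmorph1 psmonX expr1n muln1.
  apply: pserP => J; rewrite mulrC pcoefM_mon coef_Phi_gt mulr1 /= dehomK kapE.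
  have ltkM : (k %% M < M)%N by rewrite ltn_mod.
  have [le1 | lt1] := leqP (M * kap k) J; last first.
    by rewrite leqNgt (leq_trans lt1 (leq_addr _ _)).
  have [J' ->] : exists J', J = (M * kap k + J')%N.
    by exists (J - M * kap k)%N; rewrite subnKC.
  rewrite addKn leq_add2l subnDl; have [le2 | lt2] := leqP (k %% M) J'; last first.
    by rewrite (modn_small (ltn_trans lt2 ltkM)) (ltn_eqF lt2).
  rewrite /= -(eqn_mod_dvd _ le2) modn_mod; case: eqP => // e2.
  have dv : (M %| J' - k %% M)%N by rewrite -(eqn_mod_dvd _ le2) modn_mod e2.
  by rewrite [(M * (_ %/ _))%N]mulnC divnK // subnK.
exists (M * dd)%N, (fun k => A k); split=> //.
- exact: gamma_degree.
- move=> k; pose r := (k %% M)%N; pose e' j := (N * j.+1)%N.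
  have [|a aP] := @choice nat {mpoly C[n.+1]} (fun j a => a \is (e' j * (d + 1)).-homog /\
      deg0val (Y j (k %/ M)%N) = a%:F / (h * t)%:F ^+ e' j).
    by move=> j; have [a ha aE] := hY j (k %/ M)%N; exists a.
  pose deg p := (e' (M * p + r) * (d + 1) + p + kap k * d)%N.
  (* The extra exponent [kap k] of $h t$ supplies the factor $t^\kappa$ that [Ph_laurentI] expects;
     the remaining $h^\kappa$ goes into the numerator. *)
  apply: (@Ph_laurentI _ _ _ t (d + 1) (B k) (kap k) (N * M) (N * r.+1 + kap k) deg
    (fun p => a (M * p + r)%N * t ^+ p * h ^+ kap k)).
  + by rewrite mulf_neq0 ?tvar_neq0.
  + by apply: dhomogM => //; apply: tvar_homog.
  + exact: tvar_neq0.
  + exact: tvar_homog.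
  + move=> p; apply: dhomogM; last by rewrite [(kap k * d)%N]mulnC dhomogMn.
    apply: dhomogM; first by case: (aP (M * p + r)%N).
    by rewrite -[p in X in X.-homog]mul1n dhomogMn ?tvar_homog.
  + by move=> p; rewrite /deg /e'; nia.
  + move=> p; have [_ aE] := aP (M * p + r)%N.
    rewrite -[vcomp (B k) p]/(deg0val (Y (M * p + r)%N (k %/ M)%N) * t%:F ^+ p) aE.
    rewrite (_ : (N * M * p + (N * r.+1 + kap k) = e' (M * p + r) + kap k)%N); last first.
      by rewrite /e'; nia.
    have htF0 : (h * t)%:F != 0 by rewrite tofrac_eq0 mulf_neq0 ?tvar_neq0.
    rewrite (clear_power _ _ _ _ htF0) [in RHS]tofracM [in RHS]tofracM !tofracXn.
    by rewrite -[RHS]mulrA -exprMn -tofracM.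
- move=> k A0; have B0 : B k != 0.
    by apply: contraNneq A0 => B0; rewrite /A B0 tofrac0 mul0r.
  rewrite /A -tofracXn nuE ?expf_neq0 ?vhat_tvar_neq0 // vord_tvarX.
  (* [B k] has order at least 0 and $\kappa$ is the integer part of $k c / M$. *)
  apply: (@le_trans _ _ (- (kap k)%:R)).
    rewrite lerN2 mulrA ler_pdivlMr ?ltr0n // -!natrM ler_nat.
    by rewrite [(k * c)%N]mulnC leq_trunc_div.
  by rewrite rmorphB /= -!pmulrn lerBrDl subrr ler0n.
Qed.

End Roots.

End HomogeneousExtension.

(** * The factorization when there is at least one variable *)

Section InGen.
Variables (F E : fieldType) (f : {rmorphism F -> E}) (z : E).

Lemma in_genM x y : in_gen f z x -> in_gen f z y -> in_gen f z (x * y).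
Proof. by move=> [p <-] [q <-]; exists (p * q); rewrite rmorphM hornerM. Qed.

Lemma in_genX x k : in_gen f z x -> in_gen f z (x ^+ k).
Proof. by move=> [p <-]; exists (p ^+ k); rewrite rmorphXn horner_exp. Qed.

Lemma in_gen_reduce (D : {poly F}) x : D \is monic -> root (map_poly f D) z ->
  in_gen f z x -> exists2 q : {poly F}, (size q < size D)%N &
    x = \sum_(i < (size D).-1) f q`_i * z ^+ i.
Proof.
move=> D1 Dz [p <-]; have D0 := monic_neq0 D1.
have sD : (0 < size D)%N by rewrite size_poly_gt0.
exists (p %% D); first by rewrite ltn_modp.
rewrite {1}(divp_eq p D) rmorphD rmorphM hornerD hornerM (rootP Dz) mulr0 add0r.
rewrite (@horner_coef_wide _ (size D).-1).
  by apply: eq_bigr => i _; rewrite coef_map.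
by apply: leq_trans (size_poly _ _) _; rewrite -ltnS prednK // ltn_modp.
Qed.

End InGen.

Section Factorization.
Variables (n : nat) (C : fieldType) (L : closedFieldType).
Variable iota : {rmorphism {fraction (vhat n.+1 C)} -> L}.
Hypothesis C_char0 : [pchar C] =i pred0.

Let jL : {rmorphism deg0 n.+1 C -> L} := L_of_Cx iota \o deg0val.
Let E := algsub jL.
Let f : {rmorphism deg0 n.+1 C -> E} := alg_in jL.
Local Notation t := (tvar n C).

(** The homogeneous component of degree $j$ of a power series is a polynomial, so its quotient by
    $t^j$ has denominator $t^j$: initially $h = t$. *)
Lemma tame_coefficients (P : {poly mseries n.+1 C}) :
  tame_poly (base f t 1) (map_poly (vhat_series f \o @vhat_of_mseries n.+1 C) P).
Proof.
have FB := base_filtration f (tvar_neq0 n C) (tvar_homog n C).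
apply: tame_polyI => // i; exists 1%N => j; rewrite coef_map mul1n.
apply: (filt_le FB (leqnSn j)); exists (dehom j (mhcomp j P`_i)%:F) => //.
exists (mhcomp j P`_i); first by rewrite muln1 mhcomp_homog.
by rewrite val_dehom //; apply/homfrac_mpoly/mhcomp_homog.
Qed.

Lemma puiseux_vhat (P : {poly mseries n.+1 C}) : P \is monic ->
  exists m B (s : seq (pser E)), [/\ good f B, forall x, x \in s -> tame B x &
    map_poly (ramified_series f m) (map_poly (@vhat_of_mseries n.+1 C) P) =
      \prod_(x <- s) ('X - x%:P)].
Proof.
move=> P1; have E_char0 : [pchar E] =i pred0.
  by move=> p; rewrite (fmorph_pchar f) (@deg0_char0 n.+1 C C_char0).
have gB : good f (base f t 1).
  by exists t, 1%N, [::]; split; [apply: tvar_neq0 | apply: tvar_homog | | ].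
have [m [B' [s [gB' _ Bs sE]]]] := puiseux (@algsub_closed _ _ jL) E_char0
  (@good_filtration _ _ _ f) (@good_extension _ _ _ f (@algsub_algebraic _ _ jL))
  gB (monic_map _ P1) (tame_coefficients P).
exists m, B', s; split=> //; rewrite -sE -!map_poly_comp; exact: eq_map_poly.
Qed.

Theorem homogeneous_factorization (P : {poly mseries n.+1 C}) : P \is monic ->
  exists (w : rat) (g : L) (h : {mpoly C[n.+1]}),
    [/\ 0 <= w, integral_homogeneous iota w g, h != 0 & h \is homog mdeg] /\
    exists s : seq {poly L},
      (forall q, q \in s ->
         [/\ q \is monic, size q = 2%N & forall i, Ph_series iota h w g q`_i]) /\
      map_poly (L_of_mseries iota) P = \prod_(q <- s) q.
Proof.
move=> P1; have [m [B [xs [gB Bxs PE]]]] := puiseux_vhat P1.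
have [h [d [I [w [h0 hh wP]]]]] := good_span gB.
have FB := good_filtration gB.
have [s [e [D [[s0 sV wsP] [D1 Ds Dmin Dhom]]]]] := homogeneous_generator C_char0
  (@algsub_algebraic _ _ jL) (@algsub_closed _ _ jL) [seq w i | i <- enum I] (ltn0Sn m).
have [Gam [G1 sG wG Ggt]] := exists_Gamma D1 Ds Dhom.
have sD : (1 < size D)%N.
  rewrite ltnNge; apply: contraL Ds => /(monic_size1 D1) ->.
  by rewrite rmorph1 root1.
have [|gamma Gg] := closed_rootP (map_poly (L_of_mpoly iota) Gam) _.
  rewrite size_map_poly_id0; last by rewrite (monicP G1) rmorph1 oner_neq0.
  by rewrite sG eqSS muln_eq0 negb_or /= -lt0n -ltnS prednK // ltnW.
(* A term of degree $j$ in $T$ has to become $s^{j \bmod M}$ times a polynomial in $s^M$, so each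
   [w i] is divided by $s^a$ for every residue [a]. *)
have [|X XP] := @choice (I * 'I_m.+1) {poly deg0 n.+1 C} (fun u q =>
    w u.1 / s ^+ u.2 = \sum_(l < (size D).-1) f q`_l * (s ^+ m.+1) ^+ l).
  move=> [i a] /=; have [|q _ qE] := in_gen_reduce (x := w i / s ^+ a) D1 Ds _.
    rewrite -exprVn; apply: in_genM; last exact: in_genX.
    by apply: wsP; apply: map_f; rewrite mem_enum.
  by exists q.
have [b [db [b0 hb bX]]] := common_denominator
  (flatten [seq polyseq (X u) | u <- enum {: I * 'I_m.+1}]).
have hb0 : h * b != 0 by rewrite mulf_neq0.
have hhb : h * b \is (d + db).-homog by apply: dhomogM.
have FH := hden_filtration hb0 hhb.
have ht0 : h * b * t != 0 by rewrite mulf_neq0 // tvar_neq0.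
have hht : h * b * t \is (d + db + 1).-homog by apply: dhomogM => //; apply: tvar_homog.
have FHt := hden_filtration ht0 hht.
have hX u l : hden (h * b) (d + db) 1 (X u)`_l.
  have [ltl | lel] := ltnP l (size (X u)).
    rewrite mulrC addnC; apply: hden_mulr => //; apply: bX; apply/flattenP.
    exists (polyseq (X u)); last exact: mem_nth.
    by apply: (map_f (fun v => polyseq (X v))); rewrite mem_enum.
  by rewrite nth_default //; apply: (filt0 FH 1).
pose tr := transfer (ramified_series f m) (L_of_vhat iota) (vhat_of_mpoly t)
  (homog_gen m s e) gamma.
have lift x : tame B x -> exists y, tr x y /\
    Ph_series iota (h * b * t) ((m.+1 * e).+1%:R / m.+1%:R) gamma y.
  move=> [N Bx].
  have [|cf cfP] := @choice nat (I -> deg0 n.+1 C) (fun j c =>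
    (forall i, hden h d (N * j.+1) (c i)) /\ pcoef x j = \sum_i f (c i) * w i).
    by move=> j; have [c ? ?] := wP _ _ (Bx j); exists c.
  pose Y j l := \sum_i cf j i * (X (i, inord (j %% m.+1)))`_l.
  apply: (series_transfer s0 D1 Ds Dmin G1 sG Ggt Gg (N := N.+1) (Y := Y) hb0 hhb).
    (* The coefficients of the polynomials [X u] add 1 to the weight. *)
    move=> j l; have leN : (N * j.+1 + 1 <= N.+1 * j.+1)%N by rewrite mulSnr leq_add2l.
    apply: (filt_le FHt leN).
    apply: hden_mulr (tvar_neq0 n C) (tvar_homog n C) _.
    apply: (filt_sum _ FH) => i _; apply: (filtM FH) => //.
    by apply: hden_mulr => //; case: (cfP j).
  move=> j; have [_ ->] := cfP j.
  pose a : 'I_m.+1 := inord (j %% m.+1).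
  have aE : a = (j %% m.+1)%N :> nat by rewrite inordK // ltn_mod.
  under eq_bigr => i _ do rewrite -(divfK (expf_neq0 a s0) (w i)) (XP (i, a))
    mulrA mulr_sumr mulr_suml.
  rewrite exchange_big; apply: eq_bigr => l _.
  rewrite /Y -/a -aE rmorph_sum mulr_suml; apply: eq_bigr => i _.
  by rewrite rmorphM exprD exprM; ring.
(* One function transfers all tame series; its value 0 elsewhere is a default. *)
have [|y yP] := @choice (pser E) L (fun x y => tame B x -> tr x y /\
    Ph_series iota (h * b * t) ((m.+1 * e).+1%:R / m.+1%:R) gamma y).
  move=> x; have [/lift[y yP] | nB] := pselect (tame B x); first by exists y.
  by exists 0.
have psit0 : L_of_vhat iota (vhat_of_mpoly t) != 0.
  by rewrite fmorph_eq0 tofrac_eq0 vhat_tvar_neq0.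
have kerP := gt_gamma s0 D1 Dmin G1 sG Ggt Gg.
exists ((m.+1 * e).+1%:R / m.+1%:R), gamma, (h * b * t); split.
  split=> //; first by rewrite divr_ge0 ?ler0n.
    split; last by exists Gam.
    exists (map_poly (@FracField.tofrac _) Gam); last exact: GC_gamma.
    by apply: monic_neq0; apply: monic_map.
  by apply/homogP; exists (d + db + 1)%N.
exists [seq 'X - (y x)%:P | x <- xs]; split; last first.
  have -> : map_poly (L_of_mseries iota) P =
      map_poly (L_of_vhat iota) (map_poly (@vhat_of_mseries n.+1 C) P).
    by rewrite -map_poly_comp; apply: eq_map_poly.
  rewrite big_map.
  have := transfer_split psit0 kerP (s := [seq (x, y x) | x <- xs]).
  rewrite !big_map; apply; last exact: PE.
  by move=> _ /mapP[x /Bxs Bx ->]; case: (yP x Bx).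
move=> _ /mapP[x /Bxs Bx ->]; rewrite monicXsubC size_XsubC; split=> // i.
have Bi : tame B ('X - x%:P)`_i.
  have t0 : tame B 0 by exists 0%N => j; rewrite pcoef0; apply: filt0.
  rewrite coefB coefX coefC; apply: tameD => //; last first.
    by apply: tameN => //; case: ifP.
  by case: eqP => _ //; apply: (tame_psmon FB (a := 1) 0); apply: filt1.
have [tri Phi] := yP _ Bi.
(* By uniqueness of transfers, the coefficients of the factor over [L] are the values of [y] at
   those of $X - x$, which are tame. *)
have -> : ('X - (y x)%:P)`_i = y ('X - x%:P)`_i; last by [].
apply: (transfer_uniq psit0 kerP _ tri); rewrite !coefB !coefX !coefC.
have t0 := transfer_base (ramified_series f m) (L_of_vhat iota) (vhat_of_mpoly t)
  (homog_gen m s e) gamma.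
apply: transferB.
  by case: eqP => _; [have := t0 1 | have := t0 0]; rewrite !(rmorph0, rmorph1).
case: eqP => _; first by case: (yP x Bx).
by have := t0 0; rewrite !rmorph0.
Qed.

End Factorization.

(** * The case without variables, and the conclusion *)

Section Constants.
Variables (n : nat) (C L : fieldType).
Variable iota : {rmorphism {fraction (vhat n C)} -> L}.

(** With $\gamma = 1$ the extension has degree 1, and the Laurent sum reduces to its term at $k =
    0$. *)
Lemma Ph_series_const (c : C) : Ph_series iota 1 0 1 (L_of_mpoly iota c%:MP).
Proof.
have K0 : K_of_Cx (0 : {fraction {mpoly C[n]}}) = 0 by exact: rmorph0.
have nuA q : q <= 0 -> nu_ge q (@K_of_Cx n C c%:MP%:F).
  move=> q0 A0; apply: le_trans q0 _.
  have hc : homfrac 0 (c%:MP%:F : {fraction {mpoly C[n]}}).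
    by apply: homfrac_mpoly; rewrite -[c%:MP]mulr1 mul_mpolyC dhomogZ // dhomog1.
  move: A0; rewrite (K_of_Cx_homfrac hc) -[_%:F]divr1 -tofrac1 => A0.
  rewrite nuE ?oner_neq0 //; last by apply: contraNneq A0 => ->; rewrite tofrac0 mul0r.
  rewrite (_ : vord (1 : vhat n C) = 0%N) ?subr0 ?ler0n //.
  by apply: vord_uniq => //; rewrite vcomp1; apply: oner_neq0.
exists 1%N, (fun=> K_of_Cx c%:MP%:F); split.
- exists (fun=> 1); split=> [_|c' c0 i|_ [p [q [q0 ->]]]].
  + by exists 1, 1; rewrite !rmorph1 hornerC oner_neq0 divr1.
  + by move/eqP: c0; rewrite big_ord1 mulr1 fmorph_eq0 (ord1 i) => /eqP.
  + exists (fun=> p.[1] / q.[1]); rewrite big_ord1 mulr1 fmorph_div.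
    by rewrite -!horner_map !rmorph1.
- move=> _; exists 0, 0%N, 0%N, (fun k => if k == 0 then c%:MP else 0); split.
    move=> k _; split=> [|a0].
      apply/homogP; case: eqP => _; last by exists 0%N; apply: dhomog0.
      by exists 0%N; rewrite -[c%:MP]mulr1 mul_mpolyC dhomogZ // dhomog1.
    have [kz|kz] := eqVneq k 0; last by move: a0; rewrite (negbTE kz) => /eqP[].
    rewrite kz /=.
    have -> : mpdeg (c%:MP : {mpoly C[n]}) = 0%N by rewrite /mpdeg msizeC; case: eqP.
    by lia.
  case=> [|N].
    by rewrite big_ord0 [X in nu_ge _ X]subr0; apply: nuA; rewrite addr0.
  rewrite big_ord_recl big1 => [|i _]; last by rewrite /= mul0r.
  rewrite [X in nu_ge _ (_ - X)]addr0 tofrac1 exp1rz divr1 /=.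
  by move=> A0; rewrite subrr eqxx in A0.
- by move=> k; apply: nuA; rewrite mulr0 oppr0.
- by rewrite big_ord1 expr0 mulr1.
Qed.

End Constants.

(** Without variables the only multi-index is 0, so a power series is a constant and [P] splits over
    [C]. *)
Lemma constant_factorization (C : closedFieldType) (L : fieldType)
    (iota : {rmorphism {fraction (vhat 0 C)} -> L}) (P : {poly mseries 0 C}) :
  P \is monic -> exists s : seq {poly L},
    (forall q, q \in s ->
      [/\ q \is monic, size q = 2%N & forall i, Ph_series iota 1 0 1 q`_i]) /\
    map_poly (L_of_mseries iota) P = \prod_(q <- s) q.
Proof.
move=> P1; pose g : {rmorphism C -> mseries 0 C} := @mseries_of_mpoly 0 C \o @mpolyC 0 C.
pose G : {rmorphism C -> L} := L_of_mpoly iota \o @mpolyC 0 C.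
pose p := \poly_(i < size P) mscoef P`_i 0%MM.
have PE : P = map_poly g p.
  apply/polyP => i; rewrite coef_map coef_poly; case: ltnP => [_|lePi]; last first.
    by rewrite nth_default // [RHS](rmorph0 g).
  apply: mseriesP => u; rewrite /= mcoeffC (_ : u = 0%MM) ?eqxx ?mulr1 //.
  by apply/mnmP => -[].
have gG : L_of_mseries iota \o g =1 G.
  move=> c; rewrite /= /L_of_mpoly /L_of_Cx /=; congr (iota _).
  have := fracmapE (@vhat_of_mpoly_inj 0 C) c%:MP (oner_neq0 _).
  by rewrite !rmorph1 !divr1.
have p1 : p \is monic.
  have gl : g (lead_coef p) = 1.
    have := P1; rewrite monicE PE lead_coefE size_map_poly coef_map -lead_coefE.
    by move/eqP.
  apply/monicP; have := congr1 (fun u => mscoef u 0%MM) gl.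
  by rewrite /= mcoeffC eqxx mulr1.
have [zs] := closed_field_poly_normal p.
rewrite (monicP p1) scale1r => pE.
exists [seq 'X - (G z)%:P | z <- zs]; split; last first.
  rewrite big_map PE -map_poly_comp (eq_map_poly gG) pE rmorph_prod.
  by apply: eq_bigr => z _; rewrite rmorphB /= map_polyX map_polyC.
move=> _ /mapP[z _ ->]; rewrite monicXsubC size_XsubC; split=> // i.
have -> : 'X - (G z)%:P = map_poly G ('X - z%:P).
  by rewrite rmorphB /= map_polyX map_polyC.
by rewrite coef_map; apply: Ph_series_const.
Qed.

Theorem theorem5p8 (R : realType) (n : nat)
  (L : closedFieldType) (iota : {rmorphism {fraction (vhat n R[i])} -> L})
  (L_algebraic : forall z : L, algebraicOver iota z)
  (P : {poly mseries n R[i]}) (P_monic : P \is monic) :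
  exists (w : rat) (g : L) (h : {mpoly R[i][n]}),
    [/\ 0 <= w, integral_homogeneous iota w g, h != 0 & h \is homog mdeg] /\
    exists s : seq {poly L},
      (forall q, q \in s ->
         [/\ q \is monic, size q = 2%N & forall i, Ph_series iota h w g q`_i]) /\
      map_poly (L_of_mseries iota) P = \prod_(q <- s) q.
Proof.
case: n iota L_algebraic P P_monic => [|n] iota _ P P1; last first.
  by apply: homogeneous_factorization P1; apply: pchar_num.
exists 0, 1, 1; split; last exact: constant_factorization.
split=> //; [|exact: oner_neq0 | by apply/homogP; exists 0%N; apply: dhomog1].
split; first exact: algebraic1.
(* $\Gamma = z - 1$; with $w = 0$ and no variables every monomial has degree 0. *)
exists ('X - 1); split; [|exact: monicXsubC|].
  exists 0 => j u _; rewrite mul0r addr0 (_ : u = 0%MM) ?mdeg0 //.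
  by apply/mnmP => -[].
by rewrite rmorphB rmorph1 /= map_polyX rootE !hornerE subrr.
Qed.
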